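(* Let $f:[0,\pi]\to\mathbb{R}$ be a differentiable function with $f(w)=O(w^{3})$ as $w\to 0$. Suppose that there are constants $a,b\in\mathbb{R}$ such that for every compact convex set $K\subset\mathbb{R}^2$ with boundary of class $C^2$, with perimeter $L$ and area $F$, one has $$\int_{P\notin K} f(\omega(P))\,dP = aL^{2}+bF,$$ where $\omega(P)$ is the visual angle of $K$ from the point $P$ and where $a,b$ do not depend on $K$. Then there is a constant $\lambda\in\mathbb{R}$ such that $f(\omega)=\lambda(\omega-\sin\omega)$ for all $\omega\in[0,\pi]$, and in this case $a=\lambda/2$ and $b=-\pi\lambda$.
   Context: Convex sets are planar, compact, with boundary of class $C^2$ (in particular with nonempty interior). For a point $P\notin K$, the visual angle $\omega(P)\in(0,\pi)$ of $K$ from $P$ is the angle under which $K$ is seen from $P$, i.e. the angle at $P$ of the smallest angular sector with vertex $P$ containing $K$ (the angle between the two support lines of $K$ through $P$). $dP$ denotes Lebesgue area measure in the plane. *)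

(* Defs.v *)
From HB Require Import structures.
From mathcomp Require Import all_boot all_order all_algebra.
From mathcomp Require Import all_classical all_reals all_analysis.

Set Implicit Arguments.
Unset Strict Implicit.
Unset Printing Implicit Defensive.

Import Order.TTheory GRing.Theory Num.Theory.
Import numFieldNormedType.Exports.

Local Open Scope classical_set_scope.
Local Open Scope ring_scope.

(* Differentiability on a closed interval, one-sided at the endpoints. *)
Definition differentiable_on_cc (R : realType) (f : R -> R) (u v : R) : Prop :=
  forall x : R, x \in `[u, v] ->
    cvg ((fun y => (f y - f x) / (y - x)) @ within `[u, v]%classic x^').

Definition convex (R : realType) (K : set (R * R)) : Prop :=
  @convex_set R (R^o * R^o)%type K.

Definition frontier (R : realType) (K : set (R * R)) : set (R * R) :=
  closure K `\` interior K.

Definition class_C2 (R : realType) (g : R -> R) : Prop :=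
  [/\ forall t, derivable g t 1,
      forall t, derivable (derive1 g) t 1
    & continuous (derive1 (derive1 g))].

(* The Euclidean norm of the velocity; the library norm on R * R is the
   maximum of the absolute values of the coordinates. *)
Definition speed (R : realType) (gamma : R -> R * R) (t : R) : R :=
  Num.sqrt (derive1 (fst \o gamma) t ^+ 2 + derive1 (snd \o gamma) t ^+ 2).

(* The boundary of K is of class C^2: it is the trace of the simple closed
   regular curve gamma of class C^2, which has period T. *)
Definition C2_boundary (R : realType) (K : set (R * R)) (T : R)
    (gamma : R -> R * R) : Prop :=
  [/\ 0 < T,
      class_C2 (fst \o gamma) /\ class_C2 (snd \o gamma),
      forall t, gamma (t + T) = gamma t,
      forall t, speed gamma t != 0
    & set_inj `[0, T[%classic gamma /\ gamma @` `[0, T[%classic = frontier K].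

Definition curve_length (R : realType) (gamma : R -> R * R) (T : R) : R :=
  \int[@lebesgue_measure R]_(t in `[0, T]) speed gamma t.

Definition lebesgue_measure2 (R : realType) :
    {measure set (measurableTypeR R * measurableTypeR R) -> \bar R} :=
  (@lebesgue_measure R \x @lebesgue_measure R)%E.

Definition area (R : realType) (K : set (R * R)) : R :=
  fine (lebesgue_measure2 R (K : set (measurableTypeR R * measurableTypeR R))).

Definition sector (R : realType) (P : R * R) (theta w : R) : set (R * R) :=
  [set Q | exists r t : R, [/\ 0 <= r, theta <= t <= theta + w
    & Q = (P.1 + r * cos t, P.2 + r * sin t)]].

(* The opening of the smallest angular sector with vertex P containing K. *)
Definition visual_angle (R : realType) (K : set (R * R)) (P : R * R) : R :=
  inf [set w : R | 0 <= w /\ exists theta : R, K `<=` sector P theta w].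

(* Main.v *)
Require Import Defs.
From HB Require Import structures.
From mathcomp Require Import all_boot all_order all_algebra.
From mathcomp Require Import all_classical all_reals all_analysis.
From mathcomp Require Import measurable_realfun.
From mathcomp Require Import ring lra.

(* Write n(x) = (cos x, sin x) and describe a convex body by its support function p, as
   {P | P.n(x) <= p(x) for all x}.  Perturb the unit disc, p = 1, by nonnegative bumps
   h1, h2 supported in disjoint intervals of ]0, pi[.  In the mixed difference of the
   hypothesis over the bodies 1 + h1 + h2, 1 + h1, 1 + h2 and 1 the areas cancel, since the
   first and last bodies are the union and the intersection of the other two, and the
   squared perimeters leave 2 a (int h1)(int h2).  On the other side only those P contribute
   which lie on lines hitting each bump but missing the disc, and for f = phi of class C^2
   one gets int int phi''(pi - y + x) h1(x) h2(y) / sin(y - x).  Adding the identities for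
   (b cos, c sin) and (b sin, - c cos) removes the denominator; integrating by parts twice
   moves the derivatives to b, so by approximation the identity holds for f itself and reads
   int int g(pi - y + x) b''(x) c(y) = 0 with g(w) = f(w) - 2 a (w - sin w).  Choosing for
   b'' a second difference of narrow bumps shows that g satisfies Jensen's equation, hence
   is affine, and the decay of f at 0 forces g = 0.

   The coefficient b is read off the unit disc: integrating |sin(y - x)| over the pairs of
   directions x, y with |P.n(x)|, |P.n(y)| <= 1 gives 2 (w - sin w) for a point P seeing the
   disc under the angle w, and exchanging the integrals evaluates its integral over P. *)

Set Implicit Arguments.
Unset Strict Implicit.
Unset Printing Implicit Defensive.

Import Order.TTheory GRing.Theory Num.Theory.
Import numFieldNormedType.Exports.

Local Open Scope classical_set_scope.
Local Open Scope ring_scope.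

(** For a single body the integrand over the exterior is not confined to a bounded region, so the
    integrals of nearby functions f cannot be compared. The mixed difference vanishes outside a
    fixed square once the two intervals have disjoint closures; it is therefore Lipschitz in f for
    the uniform norm on [0, pi], and this carries the identity from class C^2 to f after the
    derivatives have left phi. Tonelli asks for phi'' >= 0; a bounded phi'' is brought to this case
    by adding a multiple of x^2. The function x - sin x enters because its second derivative is sin:
    the double integral with sin in the place of phi'', times 2 a, is exactly what the squared
    perimeters leave. A perturbation has to be nonnegative. The factors cos, sin and - cos comply if
    the first interval lies in ]0, pi / 2[ and the second in ]pi / 2,
    pi[, and pi - y + x still reaches all of ]0, pi[. Only b'' is prescribed, whereas b itself must
    be a nonnegative bump; the second difference of a convex function provides one. Finitely many
    derivatives are enough, so all bumps come from powers of a truncated cosine. *)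

Lemma is_derive_continuous (R : realType) (f : R -> R) (df x : R) :
  is_derive x 1 f df -> {for x, continuous f}.
Proof.
by move=> h; apply: differentiable_continuous; apply/derivable1_diffP; case: h.
Qed.

Lemma is_derive_MVT (R : realType) (f df : R -> R) (u v : R) : u < v ->
  (forall x : R, is_derive x 1 f (df x)) ->
  exists2 c, u < c < v & f v - f u = df c * (v - u).
Proof.
move=> uv fdf; have [|c cuv ->] := @MVT R f df u v uv (fun x _ => fdf x).
  by apply: continuous_subspaceT => x; exact: is_derive_continuous (fdf x).
by exists c.
Qed.

(** * Sturm comparison for q'' + q > 0 *)

(** [E] is the Wronskian of q and the solution sin (x - y) of s'' + s = 0. Its derivative is (q'' +
    q) sin (x - y), positive between [x0] and [x], its value at [x] is q x, and at [x0] it is q1 x0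
    times a nonnegative sine. *)
Lemma sturm_right (R : realType) (q q1 q2 : R -> R) (x0 x : R) :
  (forall y : R, is_derive y 1 q (q1 y)) -> (forall y : R, is_derive y 1 q1 (q2 y)) ->
  (forall y, 0 < q2 y + q y) -> q x0 = 0 -> 0 <= q1 x0 ->
  x0 < x <= x0 + pi -> 0 < q x.
Proof.
move=> dq dq1 q2q qx0 q1x0 /andP[x0x xpi].
pose E y := q1 y * sin (x - y) + q y * cos (x - y).
have dE (y : R) : is_derive y 1 E ((q2 y + q y) * sin (x - y)).
  apply: is_derive_eq; rewrite /GRing.scale/=; ring.
have [c /andP[x0c cx] Ec] := is_derive_MVT x0x dE.
have : 0 < E x - E x0.
  rewrite Ec !mulr_gt0//; last lra.
  by apply: sin_gt0_pi; apply/andP; split; lra.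
rewrite /E subrr sin0 cos0 qx0 mulr0 mulr1 add0r mul0r addr0 subr_gt0.
apply: le_lt_trans; rewrite mulr_ge0//; apply: sin_ge0_pi.
by apply/andP; split; lra.
Qed.

Lemma sturm_left (R : realType) (q q1 q2 : R -> R) (x0 x : R) :
  (forall y : R, is_derive y 1 q (q1 y)) -> (forall y : R, is_derive y 1 q1 (q2 y)) ->
  (forall y, 0 < q2 y + q y) -> q x0 = 0 -> q1 x0 <= 0 ->
  x0 - pi <= x < x0 -> 0 < q x.
Proof.
move=> dq dq1 q2q qx0 q1x0 /andP[x0x xpi].
pose r y := q (- y); pose r1 y := - q1 (- y); pose r2 y := q2 (- y).
have -> : q x = r (- x) by rewrite /r opprK.
apply: (@sturm_right R r r1 r2 (- x0)).
- move=> y; apply: (is_derive_eq (is_derive1_comp (dq (- y)) (is_deriveNid _ _))).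
  by rewrite mulrN1.
- move=> y; apply: (is_derive_eq
    (is_deriveN (is_derive1_comp (dq1 (- y)) (is_deriveNid _ _)))).
  by rewrite mulrN1 opprK.
- by move=> y; exact: q2q.
- by rewrite /r opprK.
- by rewrite /r1 opprK oppr_ge0.
- by apply/andP; split; lra.
Qed.

(** * Periodic functions *)

Section periodic.
Variables (R : realType) (A : Type) (g : R -> A) (T : R).
Hypothesis gT : forall x, g (x + T) = g x.

Lemma periodic_int (k : int) x : g (x + k%:~R * T) = g x.
Proof.
have nat_case (n : nat) y : g (y + n%:R * T) = g y.
  elim: n y => [|n IHn] y; first by rewrite mul0r addr0.
  by rewrite -addn1 natrD mulrDl mul1r addrA gT IHn.
case: k => n; first by rewrite -pmulrn nat_case.
rewrite NegzE mulrNz -(nat_case n.+1 (x + _)); congr g.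
by rewrite -pmulrn; ring.
Qed.

Lemma periodic_fund (c x : R) : 0 < T ->
  exists2 k : int, c <= x + k%:~R * T < c + T & g (x + k%:~R * T) = g x.
Proof.
move=> T0; exists (- Num.floor ((x - c) / T)); last exact: periodic_int.
have /andP[lo hi] := floor_itv ((x - c) / T).
rewrite mulrNz; move: lo hi; set m := (Num.floor _)%:~R => lo hi.
have e : (x - c) / T * T = x - c by rewrite divfK// gt_eqF.
have : m * T <= (x - c) / T * T by rewrite ler_pM2r.
have : (x - c) / T * T < (m + 1) * T by rewrite ltr_pM2r// -intrD1.
rewrite e => h1 h2; apply/andP; split; lra.
Qed.

End periodic.

Lemma sin_2pi (R : realType) (x : R) : sin (x + 2 * pi) = sin x.
Proof. by rewrite mulr_natl sinD2pi. Qed.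

Lemma cos_2pi (R : realType) (x : R) : cos (x + 2 * pi) = cos x.
Proof. by rewrite mulr_natl cosD2pi. Qed.

Lemma sinDpiE (R : realType) (x : R) : sin (x + pi) = - sin x.
Proof. exact: sinDpi. Qed.

Lemma cosDpiE (R : realType) (x : R) : cos (x + pi) = - cos x.
Proof. exact: cosDpi. Qed.

Lemma twopi_gt0 (R : realType) : 0 < 2 * pi :> R.
Proof. by rewrite mulr_gt0 ?pi_gt0. Qed.
#[global] Hint Resolve twopi_gt0 : core.

(** * Bodies given by a support function *)

Definition dotn (R : realType) (P : R * R) (x : R) : R :=
  P.1 * cos x + P.2 * sin x.

(* Three derivatives of [p] are needed for the boundary, parametrised by its normal angle
   in [contact], to be of class C^2. *)
Record support_function (R : realType) (p p1 p2 p3 : R -> R) : Prop :=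
  SupportFunction {
    sf_d1 : forall x : R, is_derive x 1 p (p1 x);
    sf_d2 : forall x : R, is_derive x 1 p1 (p2 x);
    sf_d3 : forall x : R, is_derive x 1 p2 (p3 x);
    sf_c3 : continuous p3;
    sf_per : forall x, p (x + 2 * pi) = p x;
    sf_gt0 : forall x, 0 < p x;
    sf_curv : forall x, 0 < p2 x + p x }.

Definition body (R : realType) (p : R -> R) : set (R * R) :=
  [set P | forall x, dotn P x <= p x].

(** The point of the envelope of the lines P.n(x) = p(x): its coordinates in the frame n(x), n(x +
    pi / 2) are p(x) and p'(x). *)
Definition contact (R : realType) (p p1 : R -> R) (x : R) : R * R :=
  (p x * cos x - p1 x * sin x, p x * sin x + p1 x * cos x).

Section dotn.
Variable R : realType.
Implicit Types (P Q : R * R) (x : R).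

Lemma dotn_2pi P x : dotn P (x + 2 * pi) = dotn P x.
Proof. by rewrite /dotn sin_2pi cos_2pi. Qed.

Lemma dotnDpi P x : dotn P (x + pi) = - dotn P x.
Proof. by rewrite /dotn sinDpiE cosDpiE; ring. Qed.

Lemma dotnB P Q x : dotn (P - Q) x = dotn P x - dotn Q x.
Proof. by case: P Q => [a b] [c d]; rewrite /dotn/=; ring. Qed.

Lemma is_derive_dotn P x : is_derive x 1 (dotn P) (dotn P (x + pi / 2)).
Proof.
apply: is_derive_eq; rewrite /dotn cosDpihalf sinDpihalf /GRing.scale/=; ring.
Qed.

Lemma is_derive_dotn' P x :
  is_derive x 1 (fun y => dotn P (y + pi / 2)) (- dotn P x).
Proof.
rewrite (_ : (fun _ => _) = fun y => P.1 * - sin y + P.2 * cos y).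
  by apply: is_derive_eq; rewrite /dotn /GRing.scale/=; ring.
by apply/funext => y; rewrite /dotn cosDpihalf sinDpihalf.
Qed.

Lemma dotn_le P x : dotn P x <= `|P.1| + `|P.2|.
Proof.
rewrite /dotn lerD// (le_trans (ler_norm _))// normrM ler_piMr ?cos_max//.
exact: sin_max.
Qed.

Lemma dotn_continuous x : continuous (fun P : R * R => dotn P x).
Proof.
by move=> P; apply: cvgD; apply: cvgM;
  [exact: cvg_fst|exact: cvg_cst|exact: cvg_snd|exact: cvg_cst].
Qed.

End dotn.

Section body.
Variables (R : realType) (p p1 p2 p3 : R -> R).
Hypothesis sf : support_function p p1 p2 p3.
Implicit Types (P Q : R * R) (x y : R).

Local Notation gap P := (fun x => p x - dotn P x).
Local Notation gap1 P := (fun x => p1 x - dotn P (x + pi / 2)).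

Lemma sf_continuous : continuous p.
Proof. by move=> x; exact: is_derive_continuous (sf_d1 sf x). Qed.

Lemma gap_derive P x : is_derive x 1 (gap P) (gap1 P x).
Proof. exact: is_deriveB (sf_d1 sf x) (is_derive_dotn P x). Qed.

Lemma gap1_derive P x : is_derive x 1 (gap1 P) (p2 x + dotn P x).
Proof.
by apply: (is_derive_eq (is_deriveB (sf_d2 sf x) (is_derive_dotn' P x))); ring.
Qed.

Lemma gap_continuous P : continuous (gap P).
Proof. by move=> x; exact: is_derive_continuous (gap_derive P x). Qed.

(** Since n'' = - n, the point drops out of gap'' + gap, which is the radius of curvature p'' + p
    whatever P is. Sturm comparison thus applies to the gap of every point. *)
Lemma gap_curv P x : 0 < p2 x + dotn P x + (p x - dotn P x).
Proof. by have := sf_curv sf x; lra. Qed.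

Lemma gap_right P x y : dotn P x = p x -> dotn P (x + pi / 2) <= p1 x ->
  x < y <= x + pi -> dotn P y < p y.
Proof.
move=> Px P1x xy; rewrite -subr_gt0.
apply: (sturm_right (gap_derive P) (gap1_derive P) (gap_curv P) _ _ xy).
  by rewrite Px subrr.
by rewrite subr_ge0.
Qed.

Lemma gap_left P x y : dotn P x = p x -> p1 x <= dotn P (x + pi / 2) ->
  x - pi <= y < x -> dotn P y < p y.
Proof.
move=> Px P1x xy; rewrite -subr_gt0.
apply: (sturm_left (gap_derive P) (gap1_derive P) (gap_curv P) _ _ xy).
  by rewrite Px subrr.
by rewrite subr_le0.
Qed.

Lemma dotn_contact x : dotn (contact p p1 x) x = p x.
Proof.
rewrite -[RHS]mulr1 -(cos2Dsin2 x) /dotn/=; ring.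
Qed.

Lemma dotn_contact1 x : dotn (contact p p1 x) (x + pi / 2) = p1 x.
Proof.
rewrite /dotn cosDpihalf sinDpihalf -[RHS]mulr1 -(cos2Dsin2 x)/=; ring.
Qed.

Lemma dotn_contact_lt x y : x - pi <= y <= x + pi -> y != x ->
  dotn (contact p p1 x) y < p y.
Proof.
move=> /andP[h1 h2]; rewrite neq_lt => /orP[yx|xy].
  by apply: (@gap_left _ x); rewrite ?dotn_contact ?dotn_contact1// h1.
by apply: (@gap_right _ x); rewrite ?dotn_contact ?dotn_contact1// xy.
Qed.

Lemma contact_body x : body p (contact p p1 x).
Proof.
move=> y; have [k /andP[h1 h2] _] :=
  @periodic_fund R R p _ (sf_per sf) (x - pi) y (twopi_gt0 R).
rewrite -(periodic_int (sf_per sf) k) -(periodic_int (dotn_2pi _) k).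
have [->|neq] := eqVneq (y + k%:~R * (2 * pi)) x; first by rewrite dotn_contact.
by apply/ltW/dotn_contact_lt => //; apply/andP; split; lra.
Qed.

(** The gap of a point of the body is nonnegative, so a zero is a minimum and the derivative
    vanishes there; this supplies the second coordinate of P in the frame of n(x). *)
Lemma contact_unique P x : body p P -> dotn P x = p x -> P = contact p p1 x.
Proof.
move=> KP Px.
have d0 : is_derive x 1 (gap P) 0.
  apply: (@derive1_at_min _ _ (x - 1) (x + 1)).
  - by lra.
  - by move=> t _; have [] := gap_derive P t.
  - by rewrite in_itv/=; apply/andP; split; lra.
  - by move=> t _; rewrite Px subrr subr_ge0.
have /eqP : gap1 P x = 0.
  by rewrite -(derive_val (is_derive := gap_derive P x)) (derive_val (is_derive := d0)).
rewrite subr_eq0 => /eqP P1x.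
have {}P1x : p1 x = P.1 * - sin x + P.2 * cos x.
  by rewrite P1x /dotn cosDpihalf sinDpihalf.
rewrite /contact P1x -Px /dotn [LHS]surjective_pairing; congr pair.
  rewrite -[LHS]mulr1 -(cos2Dsin2 x); ring.
rewrite -[LHS]mulr1 -(cos2Dsin2 x); ring.
Qed.

(** Uniqueness of the contact point needs only the periodicity of [p]; that of [p1] is deduced from
    this lemma in [sf_per1]. *)
Lemma contact_2pi x : contact p p1 (x + 2 * pi) = contact p p1 x.
Proof.
apply/esym/contact_unique; first exact: contact_body.
by rewrite dotn_2pi dotn_contact (sf_per sf).
Qed.

Lemma contact_inj x y : x < y < x + 2 * pi -> contact p p1 x <> contact p p1 y.
Proof.
move=> /andP[xy yx] e.
have [yp|py] := leP y (x + pi).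
  have := @dotn_contact_lt x y; rewrite e dotn_contact ltxx gt_eqF//.
  by move=> /(_ _ isT) H; apply/notF/H; apply/andP; split; lra.
have := @dotn_contact_lt (x + 2 * pi) y; rewrite contact_2pi e dotn_contact ltxx.
rewrite lt_eqF// => /(_ _ isT) H; apply/notF/H; apply/andP; split; lra.
Qed.

Lemma body_interior P : (forall x, dotn P x < p x) -> (body p)° P.
Proof.
move=> Pp; have [c _ hc] := @EVT_min R (gap P) 0 (2 * pi) (ltW (twopi_gt0 R))
  (continuous_subspaceT (@gap_continuous P)).
have e0 : 0 < gap P c by rewrite subr_gt0.
(* Balls of R * R are squares, so both coordinates may move by the radius and P.n(x) by twice as
   much: half of the minimal gap is safe. *)
apply/nbhs_ballP; exists (gap P c / 2) => /=; first by rewrite divr_gt0.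
move=> Q [/= b1 b2] x.
have [k /andP[h1 h2] _] := @periodic_fund R R p _ (sf_per sf) 0 x (twopi_gt0 R).
rewrite -(periodic_int (sf_per sf) k) -(periodic_int (dotn_2pi _) k).
set y := x + _; rewrite add0r in h2.
have := hc y; rewrite in_itv/= h1 (ltW h2) => /(_ isT) hy.
have := dotn_le (Q - P) y; rewrite dotnB.
have -> : (Q - P).1 = Q.1 - P.1 by case: (Q) (P) => ? ? [].
have -> : (Q - P).2 = Q.2 - P.2 by case: (Q) (P) => ? ? [].
rewrite (distrC Q.1) (distrC Q.2).
move: b1 b2 hy e0; rewrite /ball/= => *; lra.
Qed.

Lemma body_closed : closed (body p).
Proof.
have -> : body p = \bigcap_(x in [set: R]) [set P | dotn P x <= p x].
  by rewrite eqEsubset; split => P /= KP x; [move=> _|]; exact: KP.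
apply: closed_bigI => x _.
have -> : [set P | dotn P x <= p x] = (fun P => dotn P x) @^-1` [set y | y <= p x].
  by [].
by apply: closed_comp; [move=> P _; exact: dotn_continuous|exact: closed_le].
Qed.

Lemma body_frontier : frontier (body p) = range (contact p p1).
Proof.
rewrite /frontier -(closure_id _).1; last exact: body_closed.
rewrite eqEsubset; split => [P [KP nKP]|P [x _ <-]].
  have [x Px] : exists x, p x <= dotn P x.
    by apply: contrapT => /forallNP h; apply/nKP/body_interior => x; rewrite ltNge; apply/negP/h.
  exists x => //; apply/esym/contact_unique => //.
  by apply/eqP; rewrite eq_le Px (KP x).
split; first exact: contact_body.
move=> /nbhs_ballP[e /= e0 eK].
(* A push by e / 2 along the outer normal stays in the ball but crosses the support line. *)
pose Q := contact p p1 x + (e / 2 * cos x, e / 2 * sin x).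
have : body p Q.
  apply: eK; split; rewrite /ball/= opprD addNKr normrN normrM.
    rewrite (@le_lt_trans _ _ `|e / 2|)// ?ler_piMr ?cos_max// gtr0_norm; lra.
  rewrite (@le_lt_trans _ _ `|e / 2|)// ?ler_piMr ?sin_max// gtr0_norm; lra.
move=> /(_ x); rewrite leNgt => /negP; apply.
have -> : dotn Q x = dotn (contact p p1 x) x + e / 2.
  rewrite -[X in _ + X]mulr1 -[X in _ * X](cos2Dsin2 x) /Q /dotn.
  by move: (contact p p1 x) => [c d]/=; ring.
rewrite dotn_contact; lra.
Qed.

Lemma body_interior_nonempty : interior (body p) !=set0.
Proof.
exists 0; apply: body_interior => x.
by rewrite /dotn/= !mul0r addr0 (sf_gt0 sf).
Qed.

Lemma body_convex : convex (body p).
Proof.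
move=> P Q l; rewrite !inE => KP KQ x.
have -> : dotn (conv l P Q) x = l%:num * dotn P x + (1 - l%:num) * dotn Q x.
  case: P KP Q KQ => [a b] _ [c d] _; rewrite /dotn/= /GRing.scale/=. rewrite /unstable.onem; ring.
have := KP x; have := KQ x; have : 0 <= l%:num <= 1 by apply/andP.
nra.
Qed.

Lemma body_compact : compact (body p).
Proof.
have [c _ hc] := @EVT_max R p 0 (2 * pi) (ltW (twopi_gt0 R))
  (continuous_subspaceT sf_continuous).
have pc x : p x <= p c.
  have [k /andP[h1 h2] <-] := @periodic_fund R R p _ (sf_per sf) 0 x (twopi_gt0 R).
  by apply: hc; rewrite in_itv/= h1 ltW// -[X in _ < X]add0r.
have cM : compact (`[- p c, p c]%classic `*` `[- p c, p c]%classic : set (R * R)).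
  by apply: compact_setX; exact: segment_compact.
apply: (subclosed_compact body_closed cM) => -[a b] KP.
have K0 := le_trans (KP 0) (pc 0).
have Kp := le_trans (KP pi) (pc pi).
have Kh := le_trans (KP (pi / 2)) (pc (pi / 2)).
have Kt := le_trans (KP (pi / 2 + pi)) (pc (pi / 2 + pi)).
move: K0 Kp Kh Kt; rewrite dotnDpi /dotn/= cos0 sin0 cospi sinpi cos_pihalf sin_pihalf.
by rewrite !in_itv/= => *; split; apply/andP; split; lra.
Qed.

Lemma contact_derive1 x : is_derive x 1 (fst \o contact p p1) (- (p2 x + p x) * sin x).
Proof.
have := sf_d1 sf x; have := sf_d2 sf x => d2 d1.
apply: (@is_derive_eq _ _ _ (fun x => p x * cos x - p1 x * sin x)).
by rewrite /GRing.scale/=; ring.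
Qed.

Lemma contact_derive2 x : is_derive x 1 (snd \o contact p p1) ((p2 x + p x) * cos x).
Proof.
have := sf_d1 sf x; have := sf_d2 sf x => d2 d1.
apply: (@is_derive_eq _ _ _ (fun x => p x * sin x + p1 x * cos x)).
by rewrite /GRing.scale/=; ring.
Qed.

Lemma derive1_contact1 : derive1 (fst \o contact p p1) = fun x => - (p2 x + p x) * sin x.
Proof.
by apply/funext => x; rewrite derive1E (derive_val (is_derive := contact_derive1 x)).
Qed.

Lemma derive1_contact2 : derive1 (snd \o contact p p1) = fun x => (p2 x + p x) * cos x.
Proof.
by apply/funext => x; rewrite derive1E (derive_val (is_derive := contact_derive2 x)).
Qed.

Lemma contact_speed x : speed (contact p p1) x = p2 x + p x.
Proof.
rewrite /speed derive1_contact1 derive1_contact2.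
rewrite -[RHS]ger0_norm ?ltW ?(sf_curv sf)// -sqrtr_sqr; congr Num.sqrt.
rewrite -[RHS]mulr1 -(cos2Dsin2 x); ring.
Qed.

End body.

(** * The boundary as a curve, and its length *)

Lemma continuous_integrable (R : realType) (f : R -> R) (u v : R) :
  continuous f -> (@lebesgue_measure R).-integrable `[u, v] (EFin \o f).
Proof.
move=> cf; apply: continuous_compact_integrable; first exact: segment_compact.
exact: continuous_subspaceT.
Qed.

Lemma Rintegral_derive (R : realType) (F f : R -> R) (u v : R) : u < v ->
  (forall x : R, is_derive x 1 F (f x)) -> continuous f ->
  \int[@lebesgue_measure R]_(x in `[u, v]) f x = F v - F u.
Proof.
move=> uv dF cf; rewrite /Rintegral (continuous_FTC2 uv (F := F)) ?fineB//.
- exact: continuous_subspaceT.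
- split.
  + by move=> x _; have [] := dF x.
  + apply: cvg_at_right_filter; exact: is_derive_continuous (dF u).
  + apply: cvg_at_left_filter; exact: is_derive_continuous (dF v).
- by move=> x _; rewrite derive1E (derive_val (is_derive := dF x)).
Qed.

Section body_curve.
Variables (R : realType) (p p1 p2 p3 : R -> R).
Hypothesis sf : support_function p p1 p2 p3.
Implicit Types (P Q : R * R) (x y : R).

Lemma contact_derive11 x :
  is_derive x 1 (fun y => - (p2 y + p y) * sin y)
    (- (p3 x + p1 x) * sin x - (p2 x + p x) * cos x).
Proof.
have := sf_d1 sf x; have := sf_d3 sf x => d3 d1.
by apply: is_derive_eq; rewrite /GRing.scale/=; ring.
Qed.

Lemma contact_derive22 x :
  is_derive x 1 (fun y => (p2 y + p y) * cos y)
    ((p3 x + p1 x) * cos x - (p2 x + p x) * sin x).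
Proof.
have := sf_d1 sf x; have := sf_d3 sf x => d3 d1.
by apply: is_derive_eq; rewrite /GRing.scale/=; ring.
Qed.

Lemma sf_c1 : continuous p1.
Proof. by move=> x; exact: is_derive_continuous (sf_d2 sf x). Qed.

Lemma sf_c2 : continuous p2.
Proof. by move=> x; exact: is_derive_continuous (sf_d3 sf x). Qed.

Lemma contact_C2 :
  class_C2 (fst \o contact p p1) /\ class_C2 (snd \o contact p p1).
Proof.
have c0 := sf_continuous sf; have c1 := sf_c1; have c2 := sf_c2.
have c3 := sf_c3 sf; have cs := @continuous_sin R; have cc := @continuous_cos R.
split; split.
- by move=> x; have [] := contact_derive1 sf x.
- by move=> x; rewrite (derive1_contact1 sf); have [] := contact_derive11 x.
- rewrite (derive1_contact1 sf) [X in continuous X](_ : _ = fun x =>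
    - (p3 x + p1 x) * sin x - (p2 x + p x) * cos x); last first.
    apply/funext => x.
    by rewrite derive1E (derive_val (is_derive := contact_derive11 x)).
  move=> x; apply: cvgB; apply: cvgM; [|exact: cs| |exact: cc].
    by apply: cvgN; apply: cvgD; [exact: c3|exact: c1].
  by apply: cvgD; [exact: c2|exact: c0].
- by move=> x; have [] := contact_derive2 sf x.
- by move=> x; rewrite (derive1_contact2 sf); have [] := contact_derive22 x.
- rewrite (derive1_contact2 sf) [X in continuous X](_ : _ = fun x =>
    (p3 x + p1 x) * cos x - (p2 x + p x) * sin x); last first.
    apply/funext => x.
    by rewrite derive1E (derive_val (is_derive := contact_derive22 x)).
  move=> x; apply: cvgB; apply: cvgM; [|exact: cc| |exact: cs].
    by apply: cvgD; [exact: c3|exact: c1].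
  by apply: cvgD; [exact: c2|exact: c0].
Qed.

Lemma body_C2_boundary : C2_boundary (body p) (2 * pi) (contact p p1).
Proof.
split.
- exact: twopi_gt0.
- exact: contact_C2.
- by move=> t; exact: (contact_2pi sf).
- by move=> t; rewrite (contact_speed sf) gt_eqF ?(sf_curv sf).
split.
  move=> x y; rewrite !inE/= !in_itv/= => /andP[x0 x2] /andP[y0 y2] e.
  apply/eqP; rewrite eq_le !leNgt; apply/andP; split; apply/negP => xy.
    by apply: (contact_inj sf _ (esym e)); apply/andP; split; lra.
  by apply: (contact_inj sf _ e); apply/andP; split; lra.
rewrite (body_frontier sf) eqEsubset; split=> [P [x _ <-]|P [x _ <-]].
  by exists x.
have [k] := @periodic_fund R _ _ _ (contact_2pi sf) 0 x (twopi_gt0 R).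
rewrite add0r => kx <-; exists (x + k%:~R * (2 * pi)) => //.
Qed.

Lemma sf_per1 x : p1 (x + 2 * pi) = p1 x.
Proof.
rewrite -(dotn_contact1 p p1) (contact_2pi sf) addrAC dotn_2pi.
exact: dotn_contact1.
Qed.

(** Cauchy's perimeter formula: the speed is p'' + p, and p'' integrates to 0 over a period. *)
Lemma curve_length_contact : curve_length (contact p p1) (2 * pi) =
  \int[@lebesgue_measure R]_(x in `[0, 2 * pi]) p x.
Proof.
rewrite /curve_length.
under eq_Rintegral => x _ do rewrite (contact_speed sf).
have i0 := @continuous_integrable R _ 0 (2 * pi) (sf_continuous sf).
have i2 := @continuous_integrable R _ 0 (2 * pi) sf_c2.
rewrite RintegralD// (Rintegral_derive (twopi_gt0 R) (sf_d2 sf) sf_c2).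
by rewrite -[in X in p1 X - _](add0r (2 * pi)) sf_per1 subrr add0r.
Qed.

End body_curve.

Lemma polar (R : realType) (a b c : R) : exists r t : R,
  [/\ 0 <= r, c <= t < c + 2 * pi & (a, b) = (r * cos t, r * sin t)].
Proof.
pose r := Num.sqrt (a ^+ 2 + b ^+ 2).
suff [t ab] : exists t, (a, b) = (r * cos t, r * sin t).
  have [k kt _] := @periodic_fund R _ _ _ (@cos_2pi R) c t (twopi_gt0 R).
  exists r, (t + k%:~R * (2 * pi)); split=> //; first exact: sqrtr_ge0.
  by rewrite !periodic_int//; [exact: sin_2pi|exact: cos_2pi].
have r2 : r ^+ 2 = a ^+ 2 + b ^+ 2 by rewrite sqr_sqrtr// addr_ge0 ?sqr_ge0.
have [r0|r0] := eqVneq r 0.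
  exists 0; move: r2; rewrite r0 expr0n/= => /esym/eqP.
  by rewrite paddr_eq0 ?sqr_ge0// !sqrf_eq0 => /andP[/eqP-> /eqP->]; rewrite !mul0r.
have rp : 0 < r by rewrite lt_neqAle eq_sym r0 sqrtr_ge0.
have ar : (a / r) ^+ 2 + (b / r) ^+ 2 = 1.
  by rewrite !expr_div_n -mulrDl -r2 divff// expf_neq0.
have ar1 : -1 <= a / r <= 1.
  by have b0 := sqr_ge0 (b / r); apply/andP; split; nra.
have sE : sin (acos (a / r)) = `|b / r|.
  by rewrite sin_acos// -ar addrAC subrr add0r sqrtr_sqr.
have aK : cos (acos (a / r)) = a / r by apply: acosK; rewrite in_itv.
have [b0|b0] := leP 0 b.
  exists (acos (a / r)); rewrite aK sE ger0_norm ?divr_ge0 ?(ltW rp)//.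
  by congr pair; field.
have br : b / r < 0 by rewrite ltr_pdivrMr ?mul0r.
exists (- acos (a / r)); rewrite cosN sinN aK sE (ltr0_norm br).
by congr pair; field.
Qed.

(** * The visual angle of a body *)

Section arc.
Variables (R : realType) (p p1 p2 p3 : R -> R).
Hypothesis sf : support_function p p1 p2 p3.
Implicit Types (P Q : R * R) (x y : R).

(* The lines with normal n(x) through [P] miss the body exactly for [x] in ]u, v[, so the
   support lines through [P] are those of [u] and [v]. *)
Definition arc P u v := [/\ u < v < u + pi, dotn P u = p u /\ dotn P v = p v,
  forall x, u < x < v -> p x < dotn P x
  & forall x, v < x < u + 2 * pi -> dotn P x < p x].

(** The gap is negative at [x], so its derivative at the later zero [y] cannot be negative:
    comparison to the left would make the gap positive at [x]. Comparison to the right then applies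
    at [y]. *)
Lemma arc_zero P x y : dotn P y = p y -> p x < dotn P x -> x < y <= x + pi ->
  forall z, y < z <= y + pi -> dotn P z < p z.
Proof.
move=> Py Px /andP[xy yx] z; apply: (gap_right sf Py).
rewrite leNgt; apply/negP => /ltW h.
suff : dotn P x < p x by rewrite ltNge (ltW Px).
by apply: (gap_left sf Py h); apply/andP; split; lra.
Qed.

Lemma arc_zero' P x y : dotn P y = p y -> p x < dotn P x -> x - pi <= y < x ->
  forall z, y - pi <= z < y -> dotn P z < p z.
Proof.
move=> Py Px /andP[xy yx] z; apply: (gap_left sf Py).
rewrite leNgt; apply/negP => /ltW h.
suff : dotn P x < p x by rewrite ltNge (ltW Px).
by apply: (gap_right sf Py h); apply/andP; split; lra.
Qed.

Lemma gap_IVT P x y : x <= y -> p x <= dotn P x -> dotn P y <= p y ->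
  exists2 z, x <= z <= y & dotn P z = p z.
Proof.
move=> xy Px Py.
have [||z zxy] := @IVT R (fun x => p x - dotn P x) x y 0 xy.
- exact: continuous_subspaceT (@gap_continuous _ _ _ _ _ sf P).
- rewrite ge_min le_max !subr_le0 !subr_ge0 Px Py.
  by rewrite orbT.
- by move=> /eqP; rewrite subr_eq0 => /eqP e; exists z; rewrite ?e.
Qed.

Lemma gap_IVT' P x y : x <= y -> dotn P x <= p x -> p y <= dotn P y ->
  exists2 z, x <= z <= y & dotn P z = p z.
Proof.
move=> xy Px Py.
have [||z zxy] := @IVT R (fun x => p x - dotn P x) x y 0 xy.
- exact: continuous_subspaceT (@gap_continuous _ _ _ _ _ sf P).
- by rewrite ge_min le_max !subr_le0 !subr_ge0 Px Py orbT.
- by move=> /eqP; rewrite subr_eq0 => /eqP e; exists z; rewrite ?e.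
Qed.

(** Because [p] is positive, a direction that separates P from the body has a nonseparating
    opposite. The gap is negative at c and positive at c - pi and c + pi, which yields the zeros u
    and v; [arc_zero] and [arc_zero'] exclude any further sign change. *)
Lemma arc_exists P c : p c < dotn P c -> exists u v, u < c < v /\ arc P u v.
Proof.
move=> Pc; have pi0 := pi_gt0 R.
have Pcpi : dotn P (c + pi) < p (c + pi).
  by rewrite dotnDpi; have := sf_gt0 sf c; have := sf_gt0 sf (c + pi); lra.
have Pcpi' : dotn P (c - pi) < p (c - pi).
  rewrite -[in X in X < _](dotn_2pi) -[in X in _ < X](sf_per sf).
  by have -> : c - pi + 2 * pi = c + pi by ring.
have [|||v /andP[cv vc] Pv] := @gap_IVT P c (c + pi); [lra|exact/ltW..|].
have [|||u /andP[cu uc] Pu] := @gap_IVT' P (c - pi) c; [lra|exact/ltW..|].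
have {}cv : c < v by rewrite lt_neqAle cv andbT; apply/eqP => e; rewrite -e in Pv; lra.
have {}uc : u < c by rewrite lt_neqAle uc andbT; apply/eqP => e; rewrite e in Pu; lra.
have {}vc : v < c + pi by rewrite lt_neqAle vc andbT; apply/eqP => e; rewrite e in Pv; lra.
have {}cu : c - pi < u by rewrite lt_neqAle cu andbT; apply/eqP => e; rewrite -e in Pu; lra.
have Pv1 := @arc_zero P c v Pv Pc ltac:(apply/andP; split; lra).
have Pu1 := @arc_zero' P c u Pu Pc ltac:(apply/andP; split; lra).
have Puv x : u < x < v -> p x < dotn P x.
  move=> /andP[ux xv]; rewrite ltNge; apply/negP => Px.
  have [cx|xc] := leP c x.
    have [|z /andP[cz zx] Pz] := gap_IVT cx _ Px; first exact/ltW.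
    have {}cz : c < z.
      by rewrite lt_neqAle cz andbT; apply/eqP => e; rewrite -e in Pz; lra.
    have := @arc_zero P c z Pz Pc ltac:(apply/andP; split; lra) v
      ltac:(apply/andP; split; lra).
    by rewrite Pv ltxx.
  have [|z /andP[xz zc] Pz] := gap_IVT' (ltW xc) Px; first exact/ltW.
  have {}zc : z < c.
    by rewrite lt_neqAle zc andbT; apply/eqP => e; rewrite e in Pz; lra.
  have := @arc_zero' P c z Pz Pc ltac:(apply/andP; split; lra) u
    ltac:(apply/andP; split; lra).
  by rewrite Pu ltxx.
have vu : v < u + pi.
  rewrite ltNge; apply/negP => uv.
  have Pupi : dotn P (u + pi) < p (u + pi).
    by rewrite dotnDpi Pu; have := sf_gt0 sf u; have := sf_gt0 sf (u + pi); lra.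
  have [e|n] := eqVneq v (u + pi); first by rewrite -e Pv ltxx in Pupi.
  have : u < u + pi < v by rewrite (lt_neqAle (u + pi)) uv eq_sym n ltrDl pi0.
  by move=> /Puv; rewrite ltNge (ltW Pupi).
exists u, v; split; first by rewrite uc.
split => //; first by rewrite vu andbT; lra.
move=> x /andP[vx xu].
have [xv|xv] := leP x (v + pi); first by apply: Pv1; rewrite vx.
rewrite -(subrK (2 * pi) x) dotn_2pi (sf_per sf).
by apply: Pu1; apply/andP; split; lra.
Qed.

Lemma nbodyP P : (~` body p) P -> exists c, p c < dotn P c.
Proof. by move=> /existsNP[c /negP]; rewrite -ltNge => h; exists c. Qed.



Lemma cos_gt0_shift x : 3 / 2 * pi < x < 5 / 2 * pi -> 0 < cos x.
Proof.
move=> /andP[h1 h2]; rewrite -(subrK (2 * pi) x) cos_2pi cos_gt0_pihalf//.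
by apply/andP; split; lra.
Qed.

Lemma dotn_polar P Q r t x :
  Q = (P.1 + r * cos t, P.2 + r * sin t) -> dotn Q x - dotn P x = r * cos (t - x).
Proof. by move=> ->; rewrite cosB /dotn/=; ring. Qed.

(** The direction t of Q - P makes no acute angle with n(u) or n(v). With t taken in the period from
    v + pi / 2, the condition at v bounds t by v + 3 pi / 2 and the one at u by u + 3 pi / 2. *)
Lemma body_sector P u v : arc P u v -> body p `<=` sector P (v + pi / 2) (pi - (v - u)).
Proof.
move=> [/andP[uv vu] [Pu Pv] _ _] Q KQ.
have [r [t [r0 /andP[h1 h2] e]]] := @polar R (Q.1 - P.1) (Q.2 - P.2) (v + pi / 2).
have eQ : Q = (P.1 + r * cos t, P.2 + r * sin t).
  case: e => e1 e2; rewrite -e1 -e2 [LHS]surjective_pairing.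
  by congr pair; ring.
have [rz|rz] := eqVneq r 0.
  exists 0, (v + pi / 2); split => //; first by apply/andP; split; lra.
  by rewrite eQ rz !mul0r.
have rp : 0 < r by rewrite lt_neqAle eq_sym rz.
exists r, t; split => //; rewrite h1/=.
have Qu := dotn_polar u eQ; have Qv := dotn_polar v eQ.
have hu : r * cos (t - u) <= 0 by rewrite -Qu Pu subr_le0.
have hv : r * cos (t - v) <= 0 by rewrite -Qv Pv subr_le0.
rewrite pmulr_rle0// in hu; rewrite pmulr_rle0// in hv.
have tv : t <= v + 3 / 2 * pi.
  rewrite leNgt; apply/negP => h.
  have : 0 < cos (t - v) by apply: cos_gt0_shift; apply/andP; split; lra.
  by rewrite ltNge hv.
have : t <= u + 3 / 2 * pi.
  rewrite leNgt; apply/negP => h.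
  have : 0 < cos (t - u) by apply: cos_gt0_shift; apply/andP; split; lra.
  by rewrite ltNge hu.
lra.
Qed.

(** The contact points at u and v are seen from P in directions [t1] and [t2] that agree with u - pi
    / 2 and v + pi / 2 modulo 2 pi. Both lie in the sector, so their difference is at most w in
    absolute value. *)
Lemma sector_opening P u v theta w : arc P u v -> 0 <= w ->
  body p `<=` sector P theta w -> pi - (v - u) <= w.
Proof.
move=> [/andP[uv vu] [Pu Pv] _ _] w0 KS; rewrite leNgt; apply/negP => wlt.
have [r1 [t1 [r10 /andP[t1l t1r] e1]]] := KS _ (contact_body sf u).
have [r2 [t2 [r20 /andP[t2l t2r] e2]]] := KS _ (contact_body sf v).
have s0 : 0 < sin (v - u) by apply: sin_gt0_pi; apply/andP; split; lra.
have C1v : dotn (contact p p1 u) v < p v.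
  by apply: (dotn_contact_lt sf); [apply/andP; split; lra|rewrite gt_eqF].
have C2u : dotn (contact p p1 v) u < p u.
  by apply: (dotn_contact_lt sf); [apply/andP; split; lra|rewrite lt_eqF].
have := dotn_polar u e1; rewrite dotn_contact Pu subrr => /esym/eqP.
have := dotn_polar v e1 => d1.
have r1p : r1 != 0.
  by apply/eqP => rz; move: d1; rewrite rz mul0r Pv => /eqP; rewrite subr_eq0 lt_eqF.
have {}r1p : 0 < r1 by rewrite lt_neqAle eq_sym r1p.
rewrite mulf_eq0 gt_eqF//= => /eqP cx.
have {}d1 : cos (t1 - v) < 0 by rewrite -(pmulr_rlt0 _ r1p) -d1 Pv subr_lt0.
have := dotn_polar v e2; rewrite dotn_contact Pv subrr => /esym/eqP.
have := dotn_polar u e2 => d2.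
have r2p : r2 != 0.
  by apply/eqP => rz; move: d2; rewrite rz mul0r Pu => /eqP; rewrite subr_eq0 lt_eqF.
have {}r2p : 0 < r2 by rewrite lt_neqAle eq_sym r2p.
rewrite mulf_eq0 gt_eqF//= => /eqP cy.
have {}d2 : cos (t2 - u) < 0 by rewrite -(pmulr_rlt0 _ r2p) -d2 Pu subr_lt0.
set x := t1 - u in cx; set y := t2 - v in cy.
have sx : sin x = -1.
  have : sin x ^+ 2 = 1 by rewrite -(cos2Dsin2 x) cx expr0n add0r.
  move: d1; have -> : t1 - v = x - (v - u) by rewrite /x; ring.
  rewrite cosB cx mul0r add0r pmulr_llt0// => ? /eqP.
  by rewrite sqrf_eq1 => /orP[/eqP|/eqP//]; lra.
have sy : sin y = 1.
  have : sin y ^+ 2 = 1 by rewrite -(cos2Dsin2 y) cy expr0n add0r.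
  move: d2; have -> : t2 - u = y + (v - u) by rewrite /y; ring.
  rewrite cosD cy mul0r add0r oppr_lt0 pmulr_lgt0// => ? /eqP.
  by rewrite sqrf_eq1 => /orP[/eqP//|/eqP]; lra.
(* Comparing cosines avoids finding the multiples of 2 pi: |t1 - t2| <= w < pi - (v - u), and cos is
   strictly decreasing on [0, pi]. *)
have : cos (t1 - t2) = cos (pi - (v - u)).
  have -> : t1 - t2 = (x - y) - (v - u) by rewrite /x /y; ring.
  clearbody x y.
  by rewrite !cosB cospi sinpi !sinB cx cy sx sy; ring.
rewrite -cos_norm => /eqP; rewrite gt_eqF// ltr_cos.
- rewrite (le_lt_trans _ wlt)// ler_norml; apply/andP; split; lra.
- rewrite in_itv/= normr_ge0/= ler_norml; apply/andP; split; lra.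
- by rewrite in_itv/=; apply/andP; split; lra.
Qed.

Lemma visual_angle_arc P u v : arc P u v -> visual_angle (body p) P = pi - (v - u).
Proof.
move=> Puv; have [/andP[uv vu] _ _ _] := Puv.
apply/eqP; rewrite eq_le; apply/andP; split.
  apply: ge_inf; first by exists 0 => w [].
  split; first by lra.
  by exists (v + pi / 2); exact: body_sector.
apply: lb_le_inf.
  exists (pi - (v - u)); split; first by lra.
  by exists (v + pi / 2); exact: body_sector.
by move=> w [w0 [theta h]]; exact: sector_opening Puv w0 h.
Qed.

End arc.

(** * Integration in the coordinates P.n(x), P.n(y) *)

Section lebesgue_affine.
Local Open Scope ereal_scope.
Context {R : realType}.
Local Notation mu := (@lebesgue_measure R).

Lemma measurable_affine (c d : R) :
  measurable_fun setT (fun x : measurableTypeR R => c * x + d : measurableTypeR R)%R.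
Proof. by apply: measurable_funD => //; exact: measurable_funM. Qed.

(** By uniqueness of Lebesgue measure it is enough to compare on half-open intervals; for c < 0 the
    preimage is closed at the other end. *)
Lemma lebesgue_measure_affine (c d : R) (A : set R) : (c != 0)%R -> measurable A ->
  mu A = `|c|%:E * mu ((fun x => c * x + d)%R @^-1` A).
Proof.
move=> c0 mA.
pose phi (x : measurableTypeR R) : measurableTypeR R := (c * x + d)%R.
have mphi : measurable_fun setT phi by exact: measurable_affine.
pose push : {measure set (measurableTypeR R) -> \bar R} :=
  measure_function_pushforward__canonical__measure_function_Measure mu mphi.
pose nu := mscale (NngNum (normr_ge0 c)) push.
suff H : forall X, ocitv X -> mu X = nu X by exact: (@lebesgue_measure_unique R nu H A mA).
move=> _ [[a b]] _ <-.
have [ba|ab] := leP b a.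
  rewrite set_itv_ge ?measure0 -?leNgt ?bnd_simp//.
have cn : (0 < `|c|)%R by rewrite normr_gt0.
rewrite -[RHS]/(`|c|%:E * mu (phi @^-1` `]a, b]%classic)) lebesgue_measure_itv/= lte_fin ab.
have [cp|cp|/eqP] := ltgtP c 0%R; last by rewrite (negbTE c0).
  rewrite (_ : phi @^-1` _ = `[(b - d) / c, (a - d) / c[%classic)%R; last first.
    apply/seteqP; split=> x; rewrite /= !in_itv/= /phi.
      move=> /andP[h1 h2]; apply/andP; split.
        by rewrite ler_ndivrMr//; lra.
      by rewrite ltr_ndivlMr//; lra.
    rewrite ler_ndivrMr// ltr_ndivlMr// => /andP[h1 h2]; apply/andP; split; lra.
  rewrite lebesgue_measure_itv/= lte_fin ltr_ndivrMr// divfK ?lt_eqF//.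
  rewrite ltrD2r ab -!EFinB -EFinM; congr EFin.
  by rewrite ltr0_norm//; field.
rewrite (_ : phi @^-1` _ = `](a - d) / c, (b - d) / c]%classic)%R; last first.
  apply/seteqP; split=> x; rewrite /= !in_itv/= /phi.
    move=> /andP[h1 h2]; apply/andP; split.
      by rewrite ltr_pdivrMr//; lra.
    by rewrite ler_pdivlMr//; lra.
  rewrite ltr_pdivrMr// ler_pdivlMr// => /andP[h1 h2]; apply/andP; split; lra.
rewrite lebesgue_measure_itv/= lte_fin ltr_pdivrMr// divfK ?gt_eqF//.
rewrite ltrD2r ab -!EFinB -EFinM; congr EFin.
by rewrite gtr0_norm//; field.
Qed.

Lemma ge0_integral_affine (c d : R) (F : R -> \bar R) : (c != 0)%R ->
  measurable_fun setT F -> (forall x, 0 <= F x) ->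
  \int[mu]_x F x = `|c|%:E * \int[mu]_x F (c * x + d)%R.
Proof.
move=> c0 mF F0.
pose phi (x : measurableTypeR R) : measurableTypeR R := (c * x + d)%R.
have mphi : measurable_fun setT phi by exact: measurable_affine.
pose push : {measure set (measurableTypeR R) -> \bar R} :=
  measure_function_pushforward__canonical__measure_function_Measure mu mphi.
pose nu := mscale (NngNum (normr_ge0 c)) push.
transitivity (\int[nu]_x F x).
  apply: eq_measure_integral => A mA _.
  exact: lebesgue_measure_affine.
rewrite ge0_integral_mscale//; congr (_ * _).
by rewrite ge0_integral_pushforward.
Qed.

Lemma ge0_integral_translation (u v d : R) (F : R -> \bar R) :
  measurable_fun setT F -> (forall x, 0 <= F x) ->
  \int[mu]_(x in `[(u + d)%R, (v + d)%R[) F x = \int[mu]_(x in `[u, v[) F (x + d)%R.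
Proof.
move=> mF F0; rewrite integral_mkcond [RHS]integral_mkcond.
rewrite (@ge0_integral_affine 1%R d) ?oner_eq0//; last 2 first.
- by apply/measurable_restrict => //; exact: measurable_funTS.
- by move=> x; apply: erestrict_ge0.
rewrite normr1 mul1e; apply: eq_integral => x _.
rewrite mul1r !patchE; congr (if _ then _ else _).
by apply/idP/idP; rewrite !inE /= !in_itv/=; rewrite lerD2r ltrD2r.
Qed.

(** The window is first moved by whole periods until it starts at some c' in [0, T[; its overhang
    beyond T is then moved back onto [0, c'[. *)
Lemma ge0_integral_periodic (T c : R) (F : R -> \bar R) : (0 < T)%R ->
  measurable_fun setT F -> (forall x, 0 <= F x) -> (forall x, F (x + T)%R = F x) ->
  \int[mu]_(x in `[c, (c + T)%R[) F x = \int[mu]_(x in `[0%R, T[) F x.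
Proof.
move=> T0 mF F0 FT.
have [k /andP[k0 kT] _] := periodic_fund FT 0 c T0.
have -> : \int[mu]_(x in `[c, (c + T)%R[) F x =
    \int[mu]_(x in `[(c + k%:~R * T)%R, (c + k%:~R * T + T)%R[) F x.
  rewrite (addrAC c) ge0_integral_translation//.
  by apply: eq_integral => x _; rewrite (periodic_int FT).
set c' := (c + _)%R in k0 kT *; rewrite add0r in kT.
have mFA (A : set R) : measurable_fun A F by exact: measurable_funTS.
have -> : (`[c', (c' + T)%R[ = `[c', T[ `|` `[T, (c' + T)%R[)%classic.
  apply/seteqP; split => x /=; rewrite !in_itv/=.
    by move=> /andP[-> ->]; rewrite !andbT/=; case: (leP T x); [right|left].
  by move=> [/andP[h1 h2]|/andP[h1 h2]]; apply/andP; split; lra.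
rewrite ge0_integral_setU//; last 2 first.
- exact: mFA.
- by apply/disj_setPS => x [] /=; rewrite !in_itv/= => /andP[_ h] /andP[h' _]; lra.
have -> : \int[mu]_(x in `[T, (c' + T)%R[) F x = \int[mu]_(x in `[0%R, c'[) F x.
  rewrite -[X in `[X, _[%classic](add0r T) ge0_integral_translation//.
  by apply: eq_integral => x _; rewrite FT.
rewrite addeC -ge0_integral_setU//; last 2 first.
- exact: mFA.
- by apply/disj_setPS => x [] /=; rewrite !in_itv/= => /andP[_ h] /andP[h' _]; lra.
congr (integral _ _ _); apply/seteqP; split => x /=; rewrite !in_itv/=.
  by move=> [/andP[h1 h2]|/andP[h1 h2]]; apply/andP; split; lra.
by move=> /andP[-> ->]; rewrite !andbT/=; case: (leP c' x); [right|left].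
Qed.

End lebesgue_affine.

Section dotn_change_of_variables.
Local Open Scope ereal_scope.
Context {R : realType}.
Local Notation mu := (@lebesgue_measure R).
Local Notation mu2 := (mu \x mu).

Lemma measurable_dotn (x : R) :
  measurable_fun setT (fun P : measurableTypeR R * measurableTypeR R => dotn P x : measurableTypeR R).
Proof.
by apply: measurable_funD; apply: measurable_funM.
Qed.

(** The map P -> (P.n(x), P.n(y)) is linear with determinant sin (y - x). Two affine substitutions
    on the line, one before and one after an exchange of integrals, give the Jacobian. The first
    replaces the second coordinate of P by u = P.n(x) and divides by sin x, hence 0 < x < pi; [K] is
    H in the variables a and u. *)
Lemma ge0_integral_dotn2 (x y : R) (H : R * R -> \bar R) :
  (0 < x < pi)%R -> sin (y - x) != 0%R ->
  measurable_fun setT (H : measurableTypeR R * measurableTypeR R -> \bar R) ->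
  (forall z, 0 <= H z) ->
  \int[mu2]_P H (dotn P x, dotn P y) = `|sin (y - x)|^-1%:E * \int[mu2]_z H z.
Proof.
move=> x0 s0 mH H0.
have sx : (0 < sin x)%R by exact: sin_gt0_pi.
set s := sin (y - x) in s0 *.
have mP : measurable_fun setT (fun P : measurableTypeR R * measurableTypeR R =>
    (dotn P x, dotn P y) : measurableTypeR R * measurableTypeR R).
  by apply: measurable_fun_pair; exact: measurable_dotn.
rewrite fubini_tonelli1//; last exact: (measurableT_comp mH mP).
pose K (a u : R) := H (u, (- s / sin x) * a + u * sin y / sin x)%R.
have mK : measurable_fun setT (fun z : measurableTypeR R * measurableTypeR R => K z.1 z.2).
  apply: (measurableT_comp mH); apply: measurable_fun_pair => //.
  apply: measurable_funD; first exact: measurable_funM.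
  by apply: measurable_funM => //; exact: measurable_funM.
have step1 (a : R) : \int[mu]_b H (dotn (a, b) x, dotn (a, b) y) =
    (sin x)^-1%:E * \int[mu]_u K a u.
  rewrite (@ge0_integral_affine _ (sin x) (a * cos x)%R (K a)) ?gt_eqF//; last 2 first.
  - exact: (measurable_fun_pair2 a mK).
  - by move=> u; exact: H0.
  rewrite muleA gtr0_norm// -EFinM mulVf ?gt_eqF// mul1e.
  apply: eq_integral => b _; congr H; congr pair; rewrite /dotn/=; first by ring.
  by rewrite /s sinB; field; rewrite gt_eqF.
under eq_integral do rewrite /fubini_F step1.
rewrite ge0_integralZl; [|by []| | |]; last 3 first.
- exact: (@measurable_fun_fubini_tonelli_F _ _ _ _ _ mu _ mK (fun z => H0 _)).
- by move=> a _; apply: integral_ge0 => u _; exact: H0.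
- by rewrite lee_fin invr_ge0 ltW.
have -> : \int[mu]_a \int[mu]_u K a u = \int[mu]_u \int[mu]_a K a u.
  exact: (fubini_tonelli _ mK (fun z => H0 _)).
have c0 : (- s / sin x)%R != 0%R by rewrite mulf_neq0 ?oppr_eq0// invr_neq0// gt_eqF.
have step2 (u : R) : \int[mu]_a K a u = (sin x / `|s|)%:E * \int[mu]_v H (u, v).
  rewrite (@ge0_integral_affine _ (- s / sin x)%R (u * sin y / sin x)%R
    (fun v => H (u, v)))//; last exact: (measurable_fun_pair2 u mH).
  rewrite muleA -EFinM normrM normrN normfV (gtr0_norm sx).
  have -> : (sin x / `|s| * (`|s| / sin x) = 1)%R.
    by field; rewrite normr_eq0 s0 gt_eqF.
  by rewrite mul1e.
under eq_integral do rewrite step2.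
rewrite ge0_integralZl; [|by []| | |]; last 3 first.
- exact: (@measurable_fun_fubini_tonelli_F _ _ _ _ _ mu _ mH H0).
- by move=> a _; exact: integral_ge0.
- by rewrite lee_fin divr_ge0 ?normr_ge0 ?(ltW sx).
rewrite muleA -EFinM mulrA mulVf ?gt_eqF// mul1r; congr (_ * _).
by rewrite fubini_tonelli1.
Qed.

End dotn_change_of_variables.

(** * The measure of separating directions and the visual angle *)

Section separating.
Context {R : realType}.
Local Notation mu := (@lebesgue_measure R).
Implicit Types (p : R -> R) (P : R * R) (I : set R).

(** For I a full period, pi minus this number is the visual angle. Unlike an infimum over sectors,
    the measure of a section is measurable in P by Tonelli, and it also makes sense on the body,
    where it is 0. *)
Definition separating I p P : R := fine (mu (I `&` [set x | p x < dotn P x])).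

Lemma measurable_dotn_pair : measurable_fun setT
  (fun z : (measurableTypeR R * measurableTypeR R) * measurableTypeR R =>
     dotn z.1 z.2 : measurableTypeR R).
Proof.
have m1 : measurable_fun setT
    (fun z : (measurableTypeR R * measurableTypeR R) * measurableTypeR R => z.1.1).
  exact: measurableT_comp.
have m2 : measurable_fun setT
    (fun z : (measurableTypeR R * measurableTypeR R) * measurableTypeR R => z.1.2).
  exact: measurableT_comp.
apply: measurable_funD; apply: measurable_funM => //.
- apply: (measurableT_comp (f := @cos R)) => //.
  by apply: continuous_measurable_fun; exact: continuous_cos.
- apply: (measurableT_comp (f := @sin R)) => //.
  by apply: continuous_measurable_fun; exact: continuous_sin.
Qed.

Lemma measurable_separating_set I p P : measurable I -> measurable_fun setT p ->
  measurable (I `&` [set x | p x < dotn P x]).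
Proof.
move=> mI mp; apply: measurableI => //.
have mP : measurable_fun setT (fun x : measurableTypeR R => dotn P x : measurableTypeR R).
  exact: (measurable_fun_pair2 P measurable_dotn_pair).
rewrite -[X in measurable X]setTI.
have h := measurable_fun_ltr mp mP.
by apply: (h measurableT [set true]).
Qed.

Lemma measurable_separating I p : measurable I -> measurable_fun setT p ->
  measurable_fun setT
    (separating I p : measurableTypeR R * measurableTypeR R -> measurableTypeR R).
Proof.
move=> mI mp.
pose A := [set z : (measurableTypeR R * measurableTypeR R) * measurableTypeR R |
  I z.2 /\ p z.2 < dotn z.1 z.2].
have mA : measurable A.
  have -> : A = (snd @^-1` I) `&` [set z | p z.2 < dotn z.1 z.2] by [].
  apply: measurableI.
    rewrite -[X in measurable X]setTI.
    exact: (@measurable_snd _ _ (measurableTypeR R * measurableTypeR R)%type _ measurableT _ mI).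
  rewrite -[X in measurable X]setTI.
  have h := measurable_fun_ltr (measurableT_comp mp measurable_snd) measurable_dotn_pair.
  by apply: (h measurableT [set true]).
have -> : separating I p = fine \o (mu \o xsection A).
  apply/funext => P; rewrite /separating /=; congr (fine (mu _)).
  by apply/seteqP; split => x; rewrite /xsection/= inE.
apply: measurableT_comp => //; exact: measurable_fun_xsection.
Qed.

End separating.

Section body_separating.
Context {R : realType}.
Local Notation mu := (@lebesgue_measure R).
Variables (p p1 p2 p3 : R -> R).
Hypothesis sf : support_function p p1 p2 p3.
Implicit Types P : R * R.

Lemma sf_measurable : measurable_fun setT p.
Proof. by apply: continuous_measurable_fun; exact: sf_continuous sf. Qed.

Lemma separating_arc P u v : arc p P u v -> separating `[0, 2 * pi[ p P = v - u.
Proof.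
move=> [/andP[uv vu] [Pu Pv] Puv Pvu].
pose S := [set x | p x < dotn P x].
have mS : measurable S.
  have := measurable_separating_set P (@measurableT _ (measurableTypeR R)) sf_measurable.
  by rewrite setTI.
(* As the integral of a periodic indicator, the measure does not depend on the period chosen; on [u,
   u + 2 pi[ the separating directions form the single interval ]u, v[. *)
pose F x : \bar R := (\1_S x)%:E.
have mF : measurable_fun setT F by exact/measurable_EFinP/measurable_indic.
have F0 x : (0 <= F x)%E by rewrite lee_fin.
have FT x : F (x + 2 * pi) = F x.
  rewrite /F !indicE; congr (_%:R)%:E; congr nat_of_bool.
  by apply/idP/idP; rewrite !inE /S/= dotn_2pi (sf_per sf).
have := ge0_integral_periodic u (twopi_gt0 R) mF F0 FT.
rewrite /F !integral_indic//.
move=> e; rewrite /separating setIC -e.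
have -> : S `&` `[u, (u + 2 * pi)[ = `]u, v[%classic.
  apply/seteqP; split => x; rewrite /S/= !in_itv/=.
    move=> [Px /andP[ux xu]]; apply/andP; split.
      by rewrite lt_neqAle ux andbT; apply/eqP => ux'; rewrite -ux' Pu ltxx in Px.
    rewrite ltNge; apply/negP => vx.
    have [xv|xv] := eqVneq x v; first by rewrite xv Pv ltxx in Px.
    have /Pvu : v < x < u + 2 * pi by rewrite lt_neqAle eq_sym xv vx.
    by rewrite ltNge (ltW Px).
  by move=> uxv; split; [exact: Puv|move: uxv => /andP[h1 h2]; apply/andP; split; lra].
by rewrite -[X in fine X]/(lebesgue_measure `]u, v[%classic) lebesgue_measure_itv/= lte_fin uv.
Qed.

Lemma separating_body P : body p P -> separating `[0, 2 * pi[ p P = 0.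
Proof.
move=> KP; rewrite /separating (_ : _ `&` _ = set0) ?measure0//.
by apply/seteqP; split => // x [_ /=]; rewrite ltNge KP.
Qed.

(* The visual angle outside the body, and [pi] on the body. *)
Definition angle P := pi - separating `[0, 2 * pi[ p P.

Lemma visual_angleE P : (~` body p) P -> visual_angle (body p) P = angle P.
Proof.
move=> /nbodyP[c /(arc_exists sf)[u [v [_ Puv]]]].
by rewrite (visual_angle_arc sf Puv) /angle (separating_arc Puv).
Qed.

Lemma angle_itv P : 0 <= angle P <= pi.
Proof.
rewrite /angle; have [KP|/nbodyP[c /(arc_exists sf)[u [v [_ Puv]]]]] := pselect (body p P).
  by rewrite separating_body// subr0 lexx pi_ge0.
rewrite (separating_arc Puv); have [/andP[h1 h2] _ _ _] := Puv.
by apply/andP; split; lra.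
Qed.

Lemma measurable_angle : measurable_fun setT
  (angle : measurableTypeR R * measurableTypeR R -> measurableTypeR R).
Proof.
apply: measurable_funB => //.
by apply: measurable_separating; [exact: measurable_itv|exact: sf_measurable].
Qed.

End body_separating.

(** n(x) is the combination of n(a) and n(b) with the positive coefficients sin (b - x) / sin (b -
    a) and sin (x - a) / sin (b - a), whose sum is at least 1. *)
Lemma dotn_gt1_between (R : realType) (P : R * R) (a b x : R) :
  1 < dotn P a -> 1 < dotn P b -> a < x < b -> b < a + pi -> 1 < dotn P x.
Proof.
move=> Pa Pb /andP[ax xb] ba.
have e : dotn P x * sin (b - a) = sin (b - x) * dotn P a + sin (x - a) * dotn P b.
  by rewrite /dotn !sinB; ring.
have sX : 0 < sin (b - x) by apply: sin_gt0_pi; apply/andP; split; lra.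
have sY : 0 < sin (x - a) by apply: sin_gt0_pi; apply/andP; split; lra.
have s0 : 0 < sin (b - a) by apply: sin_gt0_pi; apply/andP; split; lra.
have sXY : sin (b - a) <= sin (b - x) + sin (x - a).
  have -> : b - a = (b - x) + (x - a) by ring.
  rewrite sinD; have := cos_le1 (b - x); have := cos_le1 (x - a); nra.
rewrite -(ltr_pM2r s0) mul1r e; nra.
Qed.

(** * Mixed differences over two bumps on the unit disc *)

Record bump_on (R : realType) (l r : R) (h : R -> R) : Prop := BumpOn {
  bump_ge0 : forall x, 0 <= h x;
  bump_out : forall x, 0 <= x < 2 * pi -> ~~ (l < x < r) -> h x = 0;
  bump_per : forall x, h (x + 2 * pi) = h x;
  bump_cont : continuous h }.

(* The directions in ]l, r[ of the lines through [P] that miss the unit disc but not the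
   body of support function 1 + h. *)
Definition strip (R : realType) (l r : R) (h : R -> R) (P : R * R) : set R :=
  [set x | l < x < r /\ 1 < dotn P x <= 1 + h x].

Section support_one.
Variable R : realType.

Lemma support_one : support_function (fun=> 1 : R) (fun=> 0) (fun=> 0) (fun=> 0).
Proof.
split=> //; try by move=> x; exact: is_derive_cst.
by move=> x; exact: cvg_cst.
Qed.

End support_one.

Section separating_bump.
Context {R : realType}.
Local Notation mu := (@lebesgue_measure R).
Implicit Types P : R * R.

(** Adding h to q removes exactly the strip from the separating directions, and as q is 1 on the
    window the strip ignores the rest of q. With q = 1 and with q = 1 + h2 this gives the same loss
    for h1, so the effects of the two bumps add up. *)
Lemma separating_bump (q h g : R -> R) (l r : R) P : 0 < l -> r < 2 * pi ->
  bump_on l r h -> continuous q ->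
  (forall x, l < x < r -> q x = 1) -> g =1 (fun x => q x + h x) ->
  measurable (strip l r h P) /\
  separating `[0, 2 * pi[ q P =
    separating `[0, 2 * pi[ g P + fine (mu (strip l r h P)).
Proof.
move=> l0 r2 bh cq q1 gE.
have cg : continuous g.
  by rewrite (funext gE) => x; apply: cvgD; [exact: cq|exact: (bump_cont bh)].
have mq := continuous_measurable_fun cq; have mg := continuous_measurable_fun cg.
have mJ : measurable (`[0, 2 * pi[%classic : set R) by exact: measurable_itv.
have mSq := measurable_separating_set P mJ mq.
have mSg := measurable_separating_set P mJ mg.
set J := `[0, 2 * pi[%classic in mJ mSq mSg *.
have qg x : q x <= g x by rewrite gE lerDl (bump_ge0 bh).
have SE : strip l r h P =
    (J `&` [set x | q x < dotn P x]) `\` (J `&` [set x | g x < dotn P x]).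
  apply/seteqP; split=> x; rewrite /J /= !in_itv/=.
    move=> [lxr /andP[h1 h2]]; have q1x := q1 _ lxr; have gx := gE x.
    move: (lxr) => /andP[h3 h4]; split; first by split; [apply/andP; split|]; lra.
    by move=> [_]; lra.
  move=> [[Jx qx] ngx]; have {}ngx : dotn P x <= g x.
    by rewrite leNgt; apply/negP => h'; apply: ngx.
  have [lxr|nlxr] := boolP (l < x < r); last first.
    have := bump_out bh Jx nlxr; have := gE x; lra.
  by split => //; have := q1 _ lxr; have := gE x => *; apply/andP; split; lra.
have mS : measurable (strip l r h P) by rewrite SE; exact: measurableD.
split=> //.
have muJ : (lebesgue_measure J < +oo)%E.
  by rewrite /J lebesgue_measure_itv/= lte_fin twopi_gt0 -EFinD ltry.
have Jfin (S : set R) : measurable S -> S `<=` J -> mu S \is a fin_num.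
  move=> mS' SJ; rewrite ge0_fin_numE ?measure_ge0//.
  by apply: le_lt_trans (le_measure mu _ _ SJ) muJ; rewrite ?inE.
rewrite /separating -fineD.
- congr fine; rewrite SE -measureU//.
  + congr (mu _); rewrite setDUK//.
    by move=> x [Jx gx]; split => //=; rewrite (le_lt_trans (qg x)).
  + exact: measurableD.
  + by rewrite setDIK.
- by apply: Jfin => // x [].
- by apply: Jfin => //; rewrite SE => x [[]].
Qed.
End separating_bump.

Section strips_ends_order.
Context {R : realType}.
Variables (l1 r1 l2 r2 p u u' v' v : R) (D q k1 k2 : R -> R).
Hypothesis windows : [/\ 0 < l1, l1 < r1, r1 <= l2, l2 < r2 & r2 < p].
Hypotheses (ur1v : u < r1 < v) (u'r1v' : u' < r1 < v').
Hypotheses (vup : v < u + p) (v'u'p : v' < u' + p).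
Hypotheses (Dp : forall x, D (x + 2 * p) = D x) (qp : forall x, q (x + 2 * p) = q x).
Hypotheses (Du : D u = 1) (Dv : D v = 1) (Du' : D u' = q u') (Dv' : D v' = q v').
Hypotheses (D_in : forall x, u < x < v -> 1 < D x)
  (D_out : forall x, v < x < u + 2 * p -> D x < 1)
  (q_in : forall x, u' < x < v' -> q x < D x)
  (q_out : forall x, v' < x < u' + 2 * p -> D x < q x).
Hypotheses (q1 : forall x, l1 < x < r1 -> q x = 1 + k1 x)
  (q2 : forall x, l2 < x < r2 -> q x = 1 + k2 x)
  (ql1 : q l1 = 1) (qr2 : q r2 = 1) (q_between : forall x, r1 <= x <= l2 -> q x = 1).

Let S1 := [set x | l1 < x < r1 /\ 1 < D x <= 1 + k1 x].
Let S2 := [set x | l2 < x < r2 /\ 1 < D x <= 1 + k2 x].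

Let S1_ge x : S1 x -> u < x.
Proof.
move=> [/andP[lx xr] /andP[Dx _]]; have [w1 w2 w3 w4 w5] := windows.
rewrite ltNge; apply/negP => xu; have [e|n] := eqVneq x u.
  by rewrite e Du ltxx in Dx.
suff : D x < 1 by rewrite ltNge (ltW Dx).
rewrite -Dp; apply: D_out; have h1 := vup; have /andP[h2 h3] := ur1v.
have xltu : x < u by rewrite lt_neqAle n.
by apply/andP; split; lra.
Qed.

Let S1_le x : S1 x -> x <= u'.
Proof.
move=> [lxr /andP[_ Dx]]; have /andP[lx xr] := lxr; have /andP[_ h] := u'r1v'.
rewrite leNgt; apply/negP => u'x; have : q x < D x.
  by apply: q_in; rewrite u'x (lt_trans xr).
by rewrite q1// ltNge Dx.
Qed.

Let S2_le x : S2 x -> x < v.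
Proof.
move=> [/andP[lx xr] /andP[Dx _]]; have [w1 w2 w3 w4 w5] := windows.
rewrite ltNge; apply/negP => vx; have [e|n] := eqVneq x v.
  by rewrite e Dv ltxx in Dx.
suff : D x < 1 by rewrite ltNge (ltW Dx).
apply: D_out; rewrite lt_neqAle eq_sym n vx/=.
by have h1 := vup; have /andP[h2 h3] := ur1v; lra.
Qed.

Let S2_ge x : S2 x -> v' <= x.
Proof.
move=> [lxr /andP[_ Dx]]; have /andP[lx xr] := lxr; have /andP[h _] := u'r1v'.
rewrite leNgt; apply/negP => xv'; have : q x < D x.
  apply: q_in; rewrite xv' andbT; have [_ _ w3 _ _] := windows.
  exact: lt_trans h (le_lt_trans w3 lx).
by rewrite q2// ltNge Dx.
Qed.

Hypotheses (S1_ex : S1 !=set0) (S2_ex : S2 !=set0).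

Let uu' : u < u'.
Proof. by have [x Sx] := S1_ex; exact: lt_le_trans (S1_ge Sx) (S1_le Sx). Qed.

Let v'v : v' < v.
Proof. by have [x Sx] := S2_ex; exact: le_lt_trans (S2_ge Sx) (S2_le Sx). Qed.

Let l1u' : l1 < u'.
Proof. by have [x Sx] := S1_ex; have [/andP[lx _] _] := Sx; exact: lt_le_trans lx (S1_le Sx). Qed.

Let v'r2 : v' < r2.
Proof. by have [x Sx] := S2_ex; have [/andP[_ xr] _] := Sx; exact: le_lt_trans (S2_ge Sx) xr. Qed.

Let u_ge : l1 <= u.
Proof.
have [w1 w2 _ _ _] := windows; have /andP[_ rv] := ur1v.
rewrite leNgt; apply/negP => ul1.
have h : 1 < D l1 by apply: D_in; rewrite ul1 (lt_trans w2).
suff : D l1 < q l1 by rewrite ql1 ltNge (ltW h).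
rewrite -Dp -qp; apply: q_out; have h1 := v'u'p; have h2 := l1u'.
have [_ _ w3 w4 w5] := windows; have /andP[h3 _] := u'r1v'.
by apply/andP; split; lra.
Qed.

Let v'_ge : l2 <= v'.
Proof.
have /andP[ur _] := ur1v; have /andP[_ rv'] := u'r1v'.
rewrite leNgt; apply/negP => vl2.
have : 1 < D v' by apply: D_in; rewrite v'v (lt_trans ur).
by rewrite Dv' q_between ?ltxx// !ltW.
Qed.

Let v_le : v <= r2.
Proof.
have [w1 w2 w3 w4 w5] := windows; have /andP[ur _] := ur1v.
rewrite leNgt; apply/negP => r2v.
have h : 1 < D r2.
  by apply: D_in; rewrite r2v (lt_trans ur)// (le_lt_trans w3).
suff : D r2 < q r2 by rewrite qr2 ltNge (ltW h).
apply: q_out; rewrite v'r2/=; have h1 := l1u'; lra.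
Qed.

(** Here [D] stands for [dotn P], [q] for [pc] and [p] for pi, so ]u, v[ and ]u', v'[ are the
    separating arcs for the disc and for the largest body. The strips are what the first arc has
    beyond the second. Nonempty strips force u < u' and v' < v, and since q is 1 at [l1], at [r2]
    and between the windows, the two arcs cannot begin or end outside the windows. *)
Lemma strips_ends_order : [/\ [/\ l1 <= u, u < u' & u' <= r1], [/\ l2 <= v', v' < v & v <= r2],
  S1 = `]u, u']%classic & S2 = `[v', v[%classic].
Proof.
have /andP[ur rv] := ur1v; have /andP[u'r rv'] := u'r1v'.
split=> //; first by split=> //; exact: ltW.
- apply/seteqP; split=> x; rewrite [X in _ -> X]/= ?[X in X -> _]/= in_itv/=.
    by move=> Sx; rewrite S1_ge//= S1_le.
  move=> /andP[ux xu'].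
  have lxr : l1 < x < r1 by rewrite (le_lt_trans u_ge)//= (le_lt_trans xu').
  split=> //; rewrite D_in/=; last by rewrite ux (le_lt_trans xu')// (lt_trans u'r).
  rewrite -q1//; have [->|n] := eqVneq x u'; first by rewrite Du'.
  have [w1 _ w3 w4 w5] := windows; have h1 := v'u'p; have h2 := u_ge; have h3 := uu'.
  have xltu' : x < u' by rewrite lt_neqAle n.
  by apply: ltW; rewrite -Dp -qp; apply: q_out; apply/andP; split; lra.
- apply/seteqP; split=> x; rewrite [X in _ -> X]/= ?[X in X -> _]/= in_itv/=.
    by move=> Sx; rewrite S2_ge//= S2_le.
  move=> /andP[v'x xv].
  have Dx : 1 < D x by apply: D_in; rewrite xv andbT (lt_trans ur)// (lt_le_trans rv').
  have lxr : l2 < x < r2.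
    rewrite (lt_le_trans xv)// andbT lt_neqAle (le_trans v'_ge)// andbT.
    apply/eqP => e; have e' : x = v' by apply/le_anti; rewrite v'x -e v'_ge.
    move: Dx; rewrite e' Dv' q_between ?ltxx// (ltW rv') -e' -e lexx//.
  split=> //; rewrite Dx/= -q2//; have [->|n] := eqVneq x v'; first by rewrite Dv'.
  have v'ltx : v' < x by rewrite lt_neqAle eq_sym n.
  have [w1 _ w3 w4 w5] := windows; have h2 := l1u'; have /andP[_ xr2] := lxr.
  by apply: ltW; apply: q_out; apply/andP; split; lra.
Qed.

End strips_ends_order.

Section two_bumps.
Context {R : realType}.
Local Notation mu := (@lebesgue_measure R).
Variables (l1 r1 l2 r2 : R) (h1 h2 : R -> R).
Hypothesis windows : [/\ 0 < l1, l1 < r1, r1 <= l2, l2 < r2 & r2 < pi].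
Hypotheses (bump1 : bump_on l1 r1 h1) (bump2 : bump_on l2 r2 h2).
Let one : R -> R := fun=> 1.
Let pa (x : R) := 1 + h1 x.
Let pb (x : R) := 1 + h2 x.
Let pc (x : R) := 1 + h1 x + h2 x.
Variables (pa1 pa2 pa3 pb1 pb2 pb3 pc1 pc2 pc3 : R -> R).
Hypotheses (sfa : support_function pa pa1 pa2 pa3)
  (sfb : support_function pb pb1 pb2 pb3)
  (sfc : support_function pc pc1 pc2 pc3).
Implicit Types (P : R * R) (phi : R -> R).

Local Notation SA := (strip l1 r1 h1).
Local Notation SB := (strip l2 r2 h2).

Let h1_out (x : R) : 0 <= x < 2 * pi -> ~~ (l1 < x < r1) -> h1 x = 0.
Proof. exact: (bump_out bump1). Qed.

Let h2_out (x : R) : 0 <= x < 2 * pi -> ~~ (l2 < x < r2) -> h2 x = 0.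
Proof. exact: (bump_out bump2). Qed.

Let h1_between (x : R) : r1 <= x <= pi -> h1 x = 0.
Proof.
move=> /andP[a b]; have := pi_gt0 R => p0; have [w1 w2 w3 w4 w5] := windows.
apply: h1_out.
  by apply/andP; split; lra.
by apply/negP => /andP[c d]; lra.
Qed.

Let h2_between (x : R) : 0 <= x <= l2 -> h2 x = 0.
Proof.
move=> /andP[a b]; have := pi_gt0 R => p0; have [w1 w2 w3 w4 w5] := windows.
apply: h2_out.
  by apply/andP; split; lra.
by apply/negP => /andP[c d]; lra.
Qed.

Lemma strips_ends P : SA P !=set0 -> SB P !=set0 ->
  exists u u' v' v, [/\ [/\ l1 <= u, u < u' & u' <= r1], [/\ l2 <= v', v' < v & v <= r2],
    SA P = `]u, u']%classic, SB P = `[v', v[%classic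
    & angle one P = pi - (v - u)].
Proof.
move=> [a [/andP[la ar] /andP[Pa Pa']]] [b [/andP[lb br] /andP[Pb Pb']]].
have pi0 := pi_gt0 R; have [w1 w2 w3 w4 w5] := windows.
(* Both bumps vanish at [r1], so this one direction separates P from the disc and from the body of
   [pc], and both arcs can be taken around it. *)
have Pr1 : 1 < dotn P r1 by apply: (dotn_gt1_between Pa Pb); [apply/andP; split|]; lra.
have pc_r1 : pc r1 = 1.
  by rewrite /pc h1_between ?h2_between ?addr0//; apply/andP; split; lra.
have pc_l2 x : r1 <= x <= l2 -> pc x = 1.
  by move=> /andP[? ?]; rewrite /pc h1_between ?h2_between ?addr0//; apply/andP; split; lra.
have pc_l1 : pc l1 = 1.
  rewrite /pc h1_out ?ltxx//; last by apply/andP; split; lra.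
  by rewrite h2_between ?addr0//; apply/andP; split; lra.
have pc_r2 : pc r2 = 1.
  rewrite /pc h1_between; last by apply/andP; split; lra.
  rewrite h2_out ?addr0 ?ltxx ?andbF//; apply/andP; split; lra.
have [u [v [/andP[ur1 r1v] uv]]] := @arc_exists R one _ _ _ (support_one R) P r1 Pr1.
have := Pr1; rewrite -pc_r1 => /(arc_exists sfc)[u' [v' [/andP[u'r1 r1v'] uv']]].
have ang : angle one P = pi - (v - u).
  by rewrite /angle (separating_arc (support_one R) uv).
have [/andP[_ vu] [Pu Pv] Puv Pvu] := uv.
have [/andP[_ vu'] [Pu' Pv'] Puv' Pvu'] := uv'.
rewrite /one/= in Pu Pv Puv Pvu.
have pcA x : l1 < x < r1 -> pc x = 1 + h1 x.
  by move=> /andP[? ?]; rewrite /pc h2_between ?addr0//; apply/andP; split; lra.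
have pcB x : l2 < x < r2 -> pc x = 1 + h2 x.
  by move=> /andP[? ?]; rewrite /pc h1_between ?addr0//; apply/andP; split; lra.
have pc2pi x : pc (x + 2 * pi) = pc x by exact: (sf_per sfc).
exists u, u', v', v; rewrite ang.
have [||||[? ? ?] [? ? ?] ? ?] := @strips_ends_order R l1 r1 l2 r2 pi u u' v' v (dotn P) pc h1 h2 windows
  _ _ vu vu' (dotn_2pi P) pc2pi Pu Pv Pu' Pv' Puv Pvu Puv' Pvu' pcA pcB pc_l1 pc_r2 pc_l2.
- by rewrite ur1.
- by rewrite u'r1.
- by exists a; rewrite /= la ar Pa.
- by exists b; rewrite /= lb br Pb.
- by split.
Qed.

Lemma angle_bumps P :
  [/\ angle pa P = angle one P + fine (mu (SA P)),
      angle pb P = angle one P + fine (mu (SB P))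
    & angle pc P = angle one P + fine (mu (SA P)) + fine (mu (SB P))].
Proof.
have [w1 w2 w3 w4 w5] := windows; have p0 := pi_gt0 R.
have c1 : continuous one by exact: (sf_continuous (support_one R)).
have cb : continuous pb by exact: (sf_continuous sfb).
have [|_ ea] := @separating_bump R one h1 pa l1 r1 P w1 _ bump1 c1 (fun _ _ => erefl) (fun=> erefl).
  by lra.
have [||_ eb] := @separating_bump R one h2 pb l2 r2 P _ _ bump2 c1 (fun _ _ => erefl) (fun=> erefl).
- by lra.
- by lra.
have [|||_ ec] := @separating_bump R pb h1 pc l1 r1 P w1 _ bump1 cb.
- by lra.
- by move=> x /andP[? ?]; rewrite /pb h2_between ?addr0//; apply/andP; split; lra.
- by move=> x; rewrite /pc /pb; ring.
by rewrite /angle ea; move: ea; rewrite eb ec => ea; split; lra.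
Qed.

(** Modulo 2 pi every direction is outside at least one window, and there one of the two support
    functions is 1. *)
Lemma body_bumps_cap : body pa `&` body pb = body one.
Proof.
apply/seteqP; split=> [P [Pa Pb] x|P P1]; last first.
  split=> x; apply: le_trans (P1 x) _; rewrite lerDl.
    exact: (bump_ge0 bump1).
  exact: (bump_ge0 bump2).
have [k kx _] := @periodic_fund R _ _ _ (dotn_2pi P) 0 x (twopi_gt0 R).
rewrite -(periodic_int (dotn_2pi P) k); move: kx; rewrite add0r; move: (x + _) => y yt.
have [y1|y1] := boolP (l1 < y < r1); last first.
  by have := Pa y; rewrite /pa h1_out// addr0.
have [w1 w2 w3 w4 w5] := windows.
have := Pb y; rewrite /pb h2_between ?addr0//; move: y1 => /andP[? ?].
by apply/andP; split; lra.
Qed.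

(** Suppose P lies in the large body but in neither of the others. As [pc] differs from [pb] only on
    the first window and from [pa] only on the second, each window contains a direction separating P
    from the disc, hence so does [r1] in between; but [pc] is 1 at [r1]. *)
Lemma body_bumps_cup : body pa `|` body pb = body pc.
Proof.
have [w1 w2 w3 w4 w5] := windows; have p0 := pi_gt0 R.
apply/seteqP; split=> [P [Pa|Pb] x|P Pc].
- by apply: le_trans (Pa x) _; rewrite /pc lerDl (bump_ge0 bump2).
- apply: le_trans (Pb x) _; rewrite /pc /pb addrAC lerDl (bump_ge0 bump1)//.
apply: contrapT => /not_orP[/nbodyP[a0 Pa0] /nbodyP[b0 Pb0]].
have [ka kat kaE] := @periodic_fund R _ _ _ (sf_per sfa) 0 a0 (twopi_gt0 R).
have [kb kbt kbE] := @periodic_fund R _ _ _ (sf_per sfb) 0 b0 (twopi_gt0 R).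
rewrite -kaE -(periodic_int (dotn_2pi P) ka) in Pa0.
rewrite -kbE -(periodic_int (dotn_2pi P) kb) in Pb0.
move: kat kbt Pa0 Pb0; rewrite !add0r.
(* The names cross over: [a] is the direction that separates P from the body of [pb], and it will
   lie in the first window; [b] is the one for [pa]. *)
move: (a0 + _) (b0 + _) => b a bt at' Pb Pa {kaE kbE}.
have al : l1 < a < r1.
  apply/negPn/negP => na; have := Pc a; move: Pa; rewrite /pc /pb h1_out//.
  lra.
have bl : l2 < b < r2.
  apply/negPn/negP => nb; have := Pc b; move: Pb; rewrite /pc /pa h2_out//.
  lra.
move: al bl => /andP[? ?] /andP[? ?].
have Pr : 1 < dotn P r1.
  apply: (@dotn_gt1_between _ _ a b); last by lra.
  - by apply: le_lt_trans Pa; rewrite /pb lerDl (bump_ge0 bump2).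
  - by apply: le_lt_trans Pb; rewrite /pa lerDl (bump_ge0 bump1).
  - by apply/andP; split; lra.
have := Pc r1; rewrite /pc h1_between ?h2_between; first by lra.
  by apply/andP; split; lra.
by apply/andP; split; lra.
Qed.

(* This combination cancels every modular functional of the bodies, such as the area. *)
Definition mixed_difference phi P :=
  phi (angle pc P) - phi (angle pa P) - phi (angle pb P) + phi (angle one P).

Lemma mixed_difference0 phi P : SA P = set0 \/ SB P = set0 ->
  mixed_difference phi P = 0.
Proof.
have [ea eb ec] := angle_bumps P; rewrite /mixed_difference ec ea eb.
by move=> [->|->]; rewrite measure0/= !addr0; ring.
Qed.

End two_bumps.

(** * Mixed differences as double integrals over directions *)

Section FTC_ereal.
Context {R : realType}.
Local Notation mu := (@lebesgue_measure R).
Variables (F f : R -> R) (u v : R).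
Hypotheses (uv : u < v) (dF : forall x : R, is_derive x 1 F (f x)) (cf : continuous f).

Lemma integral_derive_cc : (\int[mu]_(x in `[u, v]) (f x)%:E = (F v - F u)%:E)%E.
Proof.
rewrite -(Rintegral_derive uv dF cf) /Rintegral fineK//.
apply: integrable_fin_num => //; exact: continuous_integrable.
Qed.

Lemma integral_derive_oc : (\int[mu]_(x in `]u, v]) (f x)%:E = (F v - F u)%:E)%E.
Proof.
rewrite integral_itv_obnd_cbnd ?integral_derive_cc//.
apply/measurable_EFinP/measurable_funTS.
exact: continuous_measurable_fun.
Qed.

Lemma integral_derive_co : (\int[mu]_(x in `[u, v[) (f x)%:E = (F v - F u)%:E)%E.
Proof.
rewrite integral_itv_bndo_bndc ?integral_derive_cc//.
apply/measurable_EFinP/measurable_funTS.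
exact: continuous_measurable_fun.
Qed.

End FTC_ereal.

Section shift_derive.
Context {R : realType}.
Variables (F f : R -> R).
Hypothesis dF : forall x : R, is_derive x 1 F (f x).

Lemma is_derive_subl (c x y : R) :
  is_derive y 1 (fun y => F (c - y + x)) (- f (c - y + x)).
Proof.
have di : is_derive y (1 : R) (fun y => c - y + x) (-1).
  by apply: is_derive_eq; ring.
apply: (is_derive_eq (@is_derive1_comp _ F (fun y => c - y + x) _ _ _ (dF _) di)).
by rewrite mulrN1.
Qed.

Lemma is_derive_addr (c x : R) : is_derive x 1 (fun x => F (c + x)) (f (c + x)).
Proof.
have di : is_derive x (1 : R) (fun x => c + x) 1.
  by apply: is_derive_eq; ring.
apply: (is_derive_eq (@is_derive1_comp _ F (fun x => c + x) _ _ _ (dF _) di)).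
by rewrite mulr1.
Qed.

End shift_derive.

Lemma measurable_subadd (R : realType) (g : R -> R) : continuous g ->
  measurable_fun setT (fun z : measurableTypeR R * measurableTypeR R =>
    g (pi - z.2 + z.1) : measurableTypeR R).
Proof.
move=> cg; apply: (measurableT_comp (f := g)); first exact: continuous_measurable_fun.
apply: measurable_funD; last exact: measurable_fst.
by apply: measurable_funB; [exact: measurable_cst|exact: measurable_snd].
Qed.

Lemma sigma_finite_plane (R : realType) :
  sigma_finite setT (@lebesgue_measure R \x @lebesgue_measure R)%E.
Proof.
have /sigma_finiteP[F [TF ndF Foo]] := sigma_finiteT (@lebesgue_measure R).
exists (fun n => F n `*` F n).
  apply/esym; rewrite -setXTT TF predeqE => -[x y]; split.
    by move=> [n _ []/= ? ?]; split; exists n.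
  move=> [/= [n _ Fnx] [k _ Fky]]; exists (maxn n k) => //; split.
  - by move: x Fnx; exact/subsetPset/ndF/leq_maxl.
  - by move: y Fky; exact/subsetPset/ndF/leq_maxr.
move=> n; have [mF Fn] := Foo n; split; first exact: measurableX.
by rewrite product_measure1E// lte_mul_pinfty ?measure_ge0// ge0_fin_numE ?measure_ge0.
Qed.

Lemma fubini_tonelli_plane (R : realType)
    (K : (measurableTypeR R * measurableTypeR R) *
      (measurableTypeR R * measurableTypeR R) -> \bar R) :
  measurable_fun setT K -> (forall w, 0 <= K w)%E ->
  (\int[@lebesgue_measure R \x @lebesgue_measure R]_P
     \int[@lebesgue_measure R \x @lebesgue_measure R]_z K (P, z) =
   \int[@lebesgue_measure R \x @lebesgue_measure R]_z
     \int[@lebesgue_measure R \x @lebesgue_measure R]_P K (P, z))%E.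
Proof.
move=> mK K0.
pose m := lebesgue_integral_fubini_product_measure1__canonical__measure_function_Measure
  (@lebesgue_measure R) (@lebesgue_measure R).
pose sm := Measure_isSigmaFinite.Build _ _ _ m (sigma_finite_plane R).
pose ms := HB.pack_for (SigmaFiniteMeasure.type _ R) (Measure.sort m) sm.
exact: (fubini_tonelli (m1 := ms) (m2 := ms) K mK K0).
Qed.

Section tonelli.
Context {R : realType}.
Local Notation mu := (@lebesgue_measure R).
Local Notation mu2 := (mu \x mu)%E.
Variables (l1 r1 l2 r2 : R) (h1 h2 : R -> R).
Hypothesis windows : [/\ 0 < l1, l1 < r1, r1 <= l2, l2 < r2 & r2 < pi].
Hypotheses (bump1 : bump_on l1 r1 h1) (bump2 : bump_on l2 r2 h2).
Let one : R -> R := fun=> 1.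
Let pa (x : R) := 1 + h1 x.
Let pb (x : R) := 1 + h2 x.
Let pc (x : R) := 1 + h1 x + h2 x.
Variables (pa1 pa2 pa3 pb1 pb2 pb3 pc1 pc2 pc3 : R -> R).
Hypotheses (sfa : support_function pa pa1 pa2 pa3)
  (sfb : support_function pb pb1 pb2 pb3)
  (sfc : support_function pc pc1 pc2 pc3).
Implicit Types (P z : R * R) (phi : R -> R).

Local Notation SA := (strip l1 r1 h1).
Local Notation SB := (strip l2 r2 h2).
Local Notation Delta := (mixed_difference h1 h2).

Let in_window z := (l1 < z.1 < r1) && (l2 < z.2 < r2).
Let in_strips P z :=
  (1 < dotn P z.1 <= 1 + h1 z.1) && (1 < dotn P z.2 <= 1 + h2 z.2).

Let strip_kernel (g : R -> R) P z : R :=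
  if in_window z && in_strips P z then g (pi - z.2 + z.1) else 0.

(** The area of the parallelogram of the points P for which z.1 and z.2 belong to the two strips. *)
Definition strip_weight z : R :=
  if (l1 < z.1 < r1) && (l2 < z.2 < r2) then h1 z.1 * h2 z.2 / sin (z.2 - z.1) else 0.

(* The strips of [P] are intervals ]u, u'] and [v', v[, and the four angles at [P] are
   pi - s + t with s among v', v and t among u, u'; hence the mixed difference is the
   integral of [phi2] over the product of the strips. *)
Lemma Delta_strip_kernel phi phi1 phi2 P :
  (forall x : R, is_derive x 1 phi (phi1 x)) ->
  (forall x : R, is_derive x 1 phi1 (phi2 x)) -> continuous phi2 ->
  (forall x, 0 <= phi2 x) ->
  (\int[mu2]_z (strip_kernel phi2 P z)%:E = (Delta phi P)%:E)%E.
Proof.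
move=> d1 d2 c2 phi2_ge0.
have [A0|/set0P A0] := eqVneq (SA P) set0.
  rewrite (mixed_difference0 windows bump1 bump2 sfb phi (or_introl A0)).
  apply: integral0_eq => z _; rewrite /strip_kernel; case: ifPn => // /andP[/andP[h _] /andP[h' _]].
  by have : SA P z.1 by []; rewrite A0.
have [B0|/set0P B0] := eqVneq (SB P) set0.
  rewrite (mixed_difference0 windows bump1 bump2 sfb phi (or_intror B0)).
  apply: integral0_eq => z _; rewrite /strip_kernel; case: ifPn => // /andP[/andP[_ h] /andP[_ h']].
  by have : SB P z.2 by []; rewrite B0.
have [u [u' [v' [v [[l1u uu' u'r1] [l2v' v'v vr2] SAE SBE ang]]]]] :=
  strips_ends windows bump1 bump2 sfc A0 B0.
have kE z : strip_kernel phi2 P z =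
    if (u < z.1 <= u') && (v' <= z.2 < v) then phi2 (pi - z.2 + z.1) else 0.
  rewrite /strip_kernel; congr (if _ then _ else _).
  have e1 : (u < z.1 <= u') = (l1 < z.1 < r1) && (1 < dotn P z.1 <= 1 + h1 z.1).
    have : SA P z.1 <-> `]u, u']%classic z.1 by rewrite SAE.
    rewrite /strip/= in_itv/= => -[i1 i2].
    by apply/idP/idP; [move=> /i2[-> ->]|move=> /andP[x1 x2]; exact: i1].
  have e2 : (v' <= z.2 < v) = (l2 < z.2 < r2) && (1 < dotn P z.2 <= 1 + h2 z.2).
    have : SB P z.2 <-> `[v', v[%classic z.2 by rewrite SBE.
    rewrite /strip/= in_itv/= => -[i1 i2].
    by apply/idP/idP; [move=> /i2[-> ->]|move=> /andP[x1 x2]; exact: i1].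
  by rewrite e1 e2 /in_window /in_strips andbACA.
under eq_integral do rewrite kE.
rewrite fubini_tonelli1; last 2 first.
- apply/measurable_EFinP; apply: measurable_fun_ifT => //; last exact: measurable_subadd.
  by do !apply: measurable_and;
    do ?[exact: measurable_fun_ltr|exact: measurable_fun_ler].
- by move=> z; rewrite lee_fin; case: ifP.
rewrite /fubini_F/=.
have inner x : (\int[mu]_y ((if (u < x <= u') && (v' <= y < v)
      then phi2 (pi - y + x) else 0)%R)%:E)%E =
    if u < x <= u' then (phi1 (pi - v' + x) - phi1 (pi - v + x))%:E else 0%:E.
  case: ifPn => uxu' /=; last exact: integral0.
  have d y : is_derive y (1 : R) (fun y => - phi1 (pi - y + x)) (phi2 (pi - y + x)).
    apply: (is_derive_eq (is_deriveN (is_derive_subl d2 pi x y))).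
    by rewrite opprK.
  have c : continuous (fun y => phi2 (pi - y + x)).
    move=> y; apply: continuous_comp; last exact: c2.
    by apply: cvgD; [apply: cvgB; [exact: cvg_cst|exact: cvg_id]|exact: cvg_cst].
  rewrite -[RHS]/((phi1 (pi - v' + x) - phi1 (pi - v + x))%:E).
  have -> : phi1 (pi - v' + x) - phi1 (pi - v + x) =
      - phi1 (pi - v + x) - (- phi1 (pi - v' + x)) by ring.
  rewrite -(integral_derive_co v'v d c) [RHS]integral_mkcond.
  apply: eq_integral => y _; rewrite patchE mem_setE in_itv/=.
  by case: ifP.
under eq_integral do rewrite inner.
have d x : is_derive x (1 : R) (fun x => phi (pi - v' + x) - phi (pi - v + x))
    (phi1 (pi - v' + x) - phi1 (pi - v + x)).
  exact: is_deriveB (is_derive_addr d1 _ _) (is_derive_addr d1 _ _).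
have c : continuous (fun x => phi1 (pi - v' + x) - phi1 (pi - v + x)).
  move=> x; apply: cvgB.
    exact: is_derive_continuous (is_derive_addr d2 _ _).
  exact: is_derive_continuous (is_derive_addr d2 _ _).
transitivity (\int[mu]_(x in `]u, u']) (phi1 (pi - v' + x) - phi1 (pi - v + x))%:E)%E.
  rewrite [RHS]integral_mkcond; apply: eq_integral => x _.
  by rewrite patchE mem_setE in_itv/=; case: ifP.
rewrite (integral_derive_oc uu' d c); congr EFin.
have [ea eb ec] := angle_bumps windows bump1 bump2 sfb P.
rewrite /mixed_difference ec ea eb ang SAE SBE.
have -> : fine (mu `]u, u']%classic) = u' - u.
  by rewrite -[X in fine X]/(lebesgue_measure _) lebesgue_measure_itv/= lte_fin uu'.
have -> : fine (mu `[v', v[%classic) = v - v'.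
  by rewrite -[X in fine X]/(lebesgue_measure _) lebesgue_measure_itv/= lte_fin v'v.
have -> : pi - (v - u) + (u' - u) + (v - v') = pi - v' + u' by ring.
have -> : pi - (v - u) + (u' - u) = pi - v + u' by ring.
have -> : pi - (v - u) + (v - v') = pi - v' + u by ring.
have -> : pi - (v - u) = pi - v + u by ring.
ring.
Qed.

Lemma measurable_strip_kernel (g : R -> R) : continuous g ->
  measurable_fun setT (fun w : (measurableTypeR R * measurableTypeR R) *
      (measurableTypeR R * measurableTypeR R) =>
    strip_kernel g w.1 w.2 : measurableTypeR R).
Proof.
move=> cg.
have m1 : measurable_fun setT (fun w : (measurableTypeR R * measurableTypeR R) *
      (measurableTypeR R * measurableTypeR R) => w.2.1) by exact: measurableT_comp.
have m2 : measurable_fun setT (fun w : (measurableTypeR R * measurableTypeR R) *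
      (measurableTypeR R * measurableTypeR R) => w.2.2) by exact: measurableT_comp.
have md1 : measurable_fun setT (fun w : (measurableTypeR R * measurableTypeR R) *
      (measurableTypeR R * measurableTypeR R) => dotn w.1 w.2.1 : measurableTypeR R).
  exact: (measurableT_comp measurable_dotn_pair (measurable_fun_pair measurable_fst m1)).
have md2 : measurable_fun setT (fun w : (measurableTypeR R * measurableTypeR R) *
      (measurableTypeR R * measurableTypeR R) => dotn w.1 w.2.2 : measurableTypeR R).
  exact: (measurableT_comp measurable_dotn_pair (measurable_fun_pair measurable_fst m2)).
have mh1 : measurable_fun setT (fun w : (measurableTypeR R * measurableTypeR R) *
      (measurableTypeR R * measurableTypeR R) => 1 + h1 w.2.1 : measurableTypeR R).
  apply: measurable_funD => //.
  exact: (measurableT_comp (continuous_measurable_fun (bump_cont bump1)) m1).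
have mh2 : measurable_fun setT (fun w : (measurableTypeR R * measurableTypeR R) *
      (measurableTypeR R * measurableTypeR R) => 1 + h2 w.2.2 : measurableTypeR R).
  apply: measurable_funD => //.
  exact: (measurableT_comp (continuous_measurable_fun (bump_cont bump2)) m2).
apply: measurable_fun_ifT => //.
  by do !apply: measurable_and; do ?[exact: measurable_fun_ltr|exact: measurable_fun_ler].
exact: (measurableT_comp (measurable_subadd cg) measurable_snd).
Qed.

Lemma integral_strip_kernel (g : R -> R) z : (forall x, 0 <= g x) ->
  (\int[mu2]_P (strip_kernel g P z)%:E = (g (pi - z.2 + z.1) * strip_weight z)%:E)%E.
Proof.
move=> g0; rewrite /strip_kernel /strip_weight -/(in_window z).
case: ifPn => [|zW]; last by rewrite mulr0 /=; exact: integral0.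
move=> /andP[/andP[a1 a2] /andP[b1 b2]].
have [w1 w2 w3 w4 w5] := windows.
have s0 : 0 < sin (z.2 - z.1) by apply: sin_gt0_pi; apply/andP; split; lra.
pose A := `]1, 1 + h1 z.1]%classic; pose B := `]1, 1 + h2 z.2]%classic.
have mA : measurable (A : set (measurableTypeR R)) by exact: measurable_itv.
have mB : measurable (B : set (measurableTypeR R)) by exact: measurable_itv.
pose H (q : R * R) : \bar R := ((g (pi - z.2 + z.1))%:E * (\1_(A `*` B) q)%:E)%E.
transitivity (\int[mu2]_P H (dotn P z.1, dotn P z.2))%E.
  apply: eq_integral => P _; rewrite /H /in_strips indicE /=.
  have -> : ((dotn P z.1, dotn P z.2) \in A `*` B) =
      (1 < dotn P z.1 <= 1 + h1 z.1) && (1 < dotn P z.2 <= 1 + h2 z.2).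
    apply/idP/idP; rewrite inE /A /B /= !in_itv/=.
      by move=> [-> ->].
    by move=> /andP[-> ->].
  by case: ifP => _; rewrite ?mule1 ?mule0.
have mAB : measurable (A `*` B : set (measurableTypeR R * measurableTypeR R)).
  exact: measurableX.
rewrite ge0_integral_dotn2 ?gt_eqF//; last 3 first.
- by apply/andP; split; lra.
- apply/measurable_EFinP.
  by apply: measurable_funM => //; exact: measurable_indic.
- by move=> q; rewrite /H -EFinM lee_fin mulr_ge0.
rewrite ge0_integralZl//; last 2 first.
- by apply/measurable_EFinP; exact: measurable_indic.
- by rewrite lee_fin.
rewrite integral_indic// setIT.
have muI (w : R) : 0 <= w -> lebesgue_measure (`]1, 1 + w]%classic : set R) = w%:E.
  rewrite le_eqVlt => /predU1P[<-|w0]; rewrite lebesgue_measure_itv/= lte_fin.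
    by rewrite addr0 ltxx.
  by rewrite ltrDl w0 -EFinB addrC addKr.
rewrite [X in (_ * (_ * X))%E](_ : _ = (h1 z.1 * h2 z.2)%:E); last first.
  apply: (eq_trans (product_measure1E mu mu mA mB)).
  rewrite EFinM; congr (_ * _)%E; apply: muI.
    exact: bump_ge0 bump1 _.
  exact: bump_ge0 bump2 _.
by rewrite -!EFinM gtr0_norm//; congr EFin; ring.
Qed.

(** One kernel is integrated in two orders: with P fixed it gives the mixed difference, with the
    directions fixed the area of a parallelogram. The sign of [phi2] makes Tonelli applicable
    without an integrability argument. *)
Lemma integral_mixed_difference phi phi1 phi2 :
  (forall x : R, is_derive x 1 phi (phi1 x)) ->
  (forall x : R, is_derive x 1 phi1 (phi2 x)) -> continuous phi2 ->
  (forall x, 0 <= phi2 x) ->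
  (\int[mu2]_P (Delta phi P)%:E =
   \int[mu2]_z (phi2 (pi - z.2 + z.1) * strip_weight z)%:E)%E.
Proof.
move=> d1 d2 c2 phi2_ge0.
under eq_integral do rewrite -(Delta_strip_kernel _ d1 d2 c2 phi2_ge0).
under [RHS]eq_integral do rewrite -(integral_strip_kernel _ phi2_ge0).
pose K (w : (measurableTypeR R * measurableTypeR R) *
    (measurableTypeR R * measurableTypeR R)) := (strip_kernel phi2 w.1 w.2)%:E.
have mK : measurable_fun setT K.
  by apply/measurable_EFinP; exact: measurable_strip_kernel.
have K0 w : (0 <= K w)%E by rewrite /K lee_fin /strip_kernel; case: ifP.
exact: (fubini_tonelli_plane mK K0).
Qed.

End tonelli.

(** * Primitives and approximation by functions of class C^2 *)

Lemma continuous_maxr0 (R : realType) : continuous (fun x : R => Num.max x 0).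
Proof. by move=> x; apply: continuous_max; [exact: cvg_id|exact: cvg_cst]. Qed.

Lemma primitive_right (R : realType) (f : R -> R) : continuous f ->
  (forall x, x <= 0 -> f x = 0) -> exists F, forall x : R, is_derive x 1 F (f x).
Proof.
move=> cf f0; pose mu := @lebesgue_measure R.
have fi u : mu.-integrable [set` Interval -oo%O (BRight u)] (EFin \o f).
  have mI : measurable (`[0, u]%classic : set (measurableTypeR R)) by exact: measurable_itv.
  have := continuous_integrable 0 u cf.
  move=> /(integrable_mkcond _ mI) h.
  apply/(integrable_mkcond _ _); first exact: measurable_itv.
  apply: eq_integrable h => //= x _; rewrite !patchE !mem_setE !in_itv/=.
  case: (leP x u) => _; rewrite ?andbF//=; case: (leP 0 x) => // x0.
  by rewrite /= f0 ?ltW.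
exists (fun x => \int[mu]_(t in [set` Interval -oo%O (BRight x)]) f t) => x.
have [||dF FE] := @continuous_FTC1 R f -oo%O x (x + 1) _ (fi _) _ (cf x).
- by rewrite ltrDl.
- by rewrite /Order.lt/=.
by apply: DeriveDef; [exact: dF|rewrite -derive1E].
Qed.

(** f - f 0 is the sum of a function vanishing on the negative half-line and one vanishing on the
    positive half-line; the second is reflected, and the integral from minus infinity serves
    both. *)
Lemma primitive_exists (R : realType) (f : R -> R) : continuous f ->
  exists F, forall x : R, is_derive x 1 F (f x).
Proof.
move=> cf.
have [||U dU] := @primitive_right R (fun x => f (Num.max x 0) - f 0).
- move=> x; apply: cvgB; last exact: cvg_cst.
  by apply: continuous_comp; [exact: continuous_maxr0|exact: cf].
- by move=> x x0; rewrite max_r// subrr.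
have [||V dV] := @primitive_right R (fun x => f (Num.min (- x) 0) - f 0).
- move=> x; apply: cvgB; last exact: cvg_cst.
  apply: continuous_comp; last exact: cf.
  apply: continuous_min; last exact: cvg_cst.
  exact: opp_continuous.
- by move=> x x0; rewrite min_r ?subrr// oppr_ge0.
exists (fun x => U x - V (- x) + f 0 * x) => x.
have dV' := is_derive1_comp (dV (- x)) (is_deriveNid x (1 : R)).
have dlin : is_derive x (1 : R) (fun x => f 0 * x) (f 0).
  by apply: is_derive_eq; rewrite /GRing.scale/=; ring.
apply: (is_derive_eq (is_deriveD (is_deriveB (dU x) dV') dlin)).
rewrite !opprK; case: (leP x 0) => x0; ring.
Qed.

(** Only [x] is confined to the interval: the Steklov means also take values of f slightly beyond
    [v]. *)
Lemma heine (R : realType) (f : R -> R) (u v e : R) : continuous f -> 0 < e ->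
  exists2 d, 0 < d & forall x y, u <= x <= v -> `|y - x| < d -> `|f y - f x| < e.
Proof.
move=> cf e0.
have /compact_near_coveringP cv := @segment_compact R u v.
have : \forall d \near 0^'+, `[u, v] `<=` [set x | forall y, `|y - x| < d -> `|f y - f x| < e].
  apply: (cv R (0^'+)) => x _.
  have /cvgrPdist_lt/(_ (e / 2)) := cf x; rewrite divr_gt0// => /(_ isT).
  move=> /nbhs_ballP[r /= r0 rf].
  exists (ball x (r / 2), [set d | 0 < d < r / 2]) => /=.
    split; first by apply: nbhsx_ballx; rewrite divr_gt0.
    by near=> d; apply/andP; split=> //; near: d; apply: nbhs_right_lt; rewrite divr_gt0.
  move=> [z d] [/= zx /andP[d0 dr]] y yz.
  have h1 : `|f x - f z| < e / 2 by apply: rf; rewrite /ball/= (lt_trans zx)//; lra.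
  have h2 : `|f x - f y| < e / 2.
    apply: rf; rewrite /ball/= (_ : x - y = (x - z) - (y - z)); last by ring.
    by rewrite (le_lt_trans (ler_normB _ _))//; move: zx; rewrite /ball/=; lra.
  rewrite (_ : f y - f z = (f x - f z) - (f x - f y)); last by ring.
  by rewrite (le_lt_trans (ler_normB _ _))//; lra.
move=> nd; near (0 : R)^'+ => d; exists d => //.
have h : `[u, v] `<=` [set x | forall y, `|y - x| < d -> `|f y - f x| < e] by near: d.
by move=> x y xuv; apply: h; rewrite /= in_itv.
Unshelve. all: by end_near. Qed.

(* Steklov means: the second difference quotient of a second primitive of [f]. *)
Lemma C2_approximation (R : realType) (f : R -> R) (C u v e : R) : continuous f ->
  (forall x, `|f x| <= C) -> 0 < e ->
  exists (phi phi1 phi2 : R -> R) (M : R),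
    [/\ forall x : R, is_derive x 1 phi (phi1 x),
        forall x : R, is_derive x 1 phi1 (phi2 x), continuous phi2,
        forall x, `|phi2 x| <= M
      & forall x, u <= x <= v -> `|phi x - f x| <= e].
Proof.
move=> cf fC e0; have [d d0 fd] := heine u v cf e0.
have [F dF] := primitive_exists cf.
have cF : continuous F by move=> x; exact: is_derive_continuous (dF x).
have [G dG] := primitive_exists cF.
(* The second difference looks ahead by 2 h, which must stay below d. *)
pose h := d / 4; have h0 : 0 < h by rewrite divr_gt0.
pose D2 (g : R -> R) x := h ^- 2 * (g (2 * h + x) - 2 * g (h + x) + g x).
have dD2 (g k : R -> R) : (forall x : R, is_derive x 1 g (k x)) ->
    forall x : R, is_derive x 1 (D2 g) (D2 k x).
  move=> dg x; have dg1 := is_derive_addr dg (2 * h) x; have dg2 := is_derive_addr dg h x.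
  have dg3 := dg x.
  by apply: is_derive_eq; rewrite /D2 /GRing.scale/=; ring.
exists (D2 G), (D2 F), (D2 f), (h ^- 2 * (4 * C)); split.
- exact: dD2.
- exact: dD2.
- move=> x; apply: cvgM; first exact: cvg_cst.
  have ca c : continuous (fun x => f (c + x)).
    move=> y; apply: continuous_comp; last exact: cf.
    by apply: cvgD; [exact: cvg_cst|exact: cvg_id].
  apply: cvgD; last exact: cf.
  by apply: cvgB; [exact: ca|apply: cvgM; [exact: cvg_cst|exact: ca]].
- move=> x; rewrite /D2 normrM gtr0_norm ?invr_gt0 ?exprn_gt0// ler_pM2l ?invr_gt0 ?exprn_gt0//.
  rewrite (le_trans (ler_normD _ _))//.
  have := ler_normB (f (2 * h + x)) (2 * f (h + x)); rewrite normrM (ger0_norm (ler0n _ _)).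
  by have := fC (2 * h + x); have := fC (h + x); have := fC x; lra.
- move=> x xuv.
  (* Two mean values, for the increment of G and then for F, turn the quotient into f at a point c2
     with x < c2 < x + 2 h. *)
  have [|c1 /andP[xc1 c1h] e1] := @is_derive_MVT R (fun y => G (h + y) - G y)
    (fun y => F (h + y) - F y) x (h + x) ltac:(lra).
    by move=> y; exact: is_deriveB (is_derive_addr dG h y) (dG y).
  have [c2 /andP[c1c2 c2h] e2] := @is_derive_MVT R F f c1 (h + c1) ltac:(lra) dF.
  have -> : D2 G x = f c2.
    rewrite /D2 (_ : _ - _ + _ = G (h + (h + x)) - G (h + x) - (G (h + x) - G x)).
      by rewrite e1 e2; field; rewrite gt_eqF.
    by rewrite (_ : 2 * h + x = h + (h + x)); ring.
  apply/ltW/fd => //; rewrite gtr0_norm; last by lra.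
  by have h4 : h * 4 = d; [rewrite /h; field|lra].
Qed.

Lemma continuous_bounded_itv (R : realType) (f : R -> R) (u v : R) : continuous f ->
  exists2 M, 0 <= M & forall x, u <= x <= v -> `|f x| <= M.
Proof.
move=> cf; have [uv|vu] := leP u v; last first.
  by exists 0 => // x /andP[ux xv]; lra.
have [|c _ hc] := @EVT_max R (fun x => `|f x|) u v uv.
  apply: continuous_subspaceT => x; apply: continuous_comp; first exact: cf.
  exact: norm_continuous.
by exists `|f c| => // x xuv; apply: hc; rewrite in_itv.
Qed.

Lemma continuous_subadd (R : realType) (phi : R -> R) (x y : R) : continuous phi ->
  {for y, continuous (fun y => phi (pi - y + x))}.
Proof.
move=> cphi; apply: continuous_comp; last exact: cphi.
by apply: cvgD; [apply: cvgB; [exact: cvg_cst|exact: cvg_id]|exact: cvg_cst].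
Qed.

Lemma continuous_subadd2 (R : realType) (phi : R -> R) (x y : R) : continuous phi ->
  {for x, continuous (fun x => phi (pi - y + x))}.
Proof.
move=> cphi; apply: continuous_comp; last exact: cphi.
by apply: cvgD; [exact: cvg_cst|exact: cvg_id].
Qed.

Lemma inner_continuous (R : realType) (phi k : R -> R) (l r : R) :
  continuous phi -> continuous k ->
  continuous (fun y => \int[@lebesgue_measure R]_(x in `[l, r]) (phi (pi - y + x) * k x)).
Proof.
move=> cphi ck y0.
have [M M0 hM] := @continuous_bounded_itv R phi (pi - (y0 + 1) + l) (pi - (y0 - 1) + r) cphi.
have cf y : continuous (fun x => phi (pi - y + x) * k x).
  by move=> x; apply: cvgM; [exact: continuous_subadd2|exact: ck].
have := @continuity_under_integral R _ _ (@lebesgue_measure R)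
  (fun y x => phi (pi - y + x) * k x) `[l, r] (measurable_itv _) (y0 - 1) (y0 + 1)
  _ _ (fun x => M * `|k x|).
move=> /(_ (fun y _ => continuous_integrable l r (cf y))).
apply.
- apply: aeW => x _ y _.
  by apply: cvgM; [exact: continuous_subadd|exact: cvg_cst].
- apply: continuous_integrable => x; apply: cvgM; first exact: cvg_cst.
  by apply: continuous_comp; [exact: ck|exact: norm_continuous].
- move=> y /=; rewrite in_itv/= => /andP[h1 h2]; apply: aeW => x /=; rewrite in_itv/= => /andP[h3 h4].
  by rewrite normrM ler_wpM2r// hM//; apply/andP; split; lra.
- by rewrite inE/= in_itv/=; apply/andP; split; lra.
Qed.

Definition square (R : realType) (C : R) : set (measurableTypeR R * measurableTypeR R) :=
  `[- C, C]%classic `*` `[- C, C]%classic.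

Lemma measurable_square (R : realType) (C : R) : measurable (square C).
Proof. by apply: measurableX; exact: measurable_itv. Qed.

Lemma square_measure (R : realType) (C : R) : 0 <= C ->
  ((@lebesgue_measure R \x @lebesgue_measure R) (square C) = ((2 * C) ^+ 2)%:E)%E.
Proof.
move=> C0; have mI : measurable (`[- C, C]%classic : set (measurableTypeR R)).
  exact: measurable_itv.
apply: (eq_trans (product_measure1E _ _ mI mI)).
have muI : lebesgue_measure (`[- C, C]%classic : set R) = (2 * C)%:E.
  rewrite lebesgue_measure_itv/= lte_fin.
  case: ltP => [_|CC]; first by rewrite -EFinB; congr EFin; ring.
  by congr EFin; lra.
rewrite [X in (X * _)%E](_ : _ = (2 * C)%:E)//.
by rewrite [X in (_ * X)%E](_ : _ = (2 * C)%:E)// -EFinM expr2.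
Qed.

Lemma square_measure_ltey (R : realType) (C : R) : 0 <= C ->
  ((@lebesgue_measure R \x @lebesgue_measure R) (square C) < +oo)%E.
Proof. by move=> C0; rewrite square_measure// ltry. Qed.

(** * The integrated mixed difference as a functional of phi *)

Section mixed_functional.
Context {R : realType}.
Local Notation mu := (@lebesgue_measure R).
Local Notation mu2 := (mu \x mu)%E.
Variables (l1 r1 l2 r2 : R) (h1 h2 : R -> R).
Hypothesis windows : [/\ 0 < l1, l1 < r1, r1 <= l2, l2 < r2 & r2 < pi].
Hypothesis r1l2 : r1 < l2.
Hypotheses (bump1 : bump_on l1 r1 h1) (bump2 : bump_on l2 r2 h2).
Let one : R -> R := fun=> 1.
Let pa (x : R) := 1 + h1 x.
Let pb (x : R) := 1 + h2 x.
Let pc (x : R) := 1 + h1 x + h2 x.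
Variables (pa1 pa2 pa3 pb1 pb2 pb3 pc1 pc2 pc3 : R -> R).
Hypotheses (sfa : support_function pa pa1 pa2 pa3)
  (sfb : support_function pb pb1 pb2 pb3)
  (sfc : support_function pc pc1 pc2 pc3).
Implicit Types (P z : R * R) (phi : R -> R).

Local Notation SA := (strip l1 r1 h1).
Local Notation SB := (strip l2 r2 h2).
Local Notation Delta := (mixed_difference h1 h2).

Definition mixed_functional phi : R := \int[mu2]_P Delta phi P.

(** Directions a, b in the two strips give a linear system for P with bounded right-hand side and
    determinant sin (b - a). The strict inequality r1 < l2 keeps the determinant away from 0, and
    Cramer's rule bounds P; so the mixed difference has bounded support. *)
Lemma strips_box : exists2 C, 0 <= C & forall P, SA P !=set0 -> SB P !=set0 ->
  `|P.1| <= C /\ `|P.2| <= C.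
Proof.
have [w1 w2 w3 w4 w5] := windows; have w6 := r1l2; have p0 := pi_gt0 R.
have [M1 M10 hM1] := @continuous_bounded_itv R h1 0 pi (bump_cont bump1).
have [M2 M20 hM2] := @continuous_bounded_itv R h2 0 pi (bump_cont bump2).
(* The interval contains all values of b - a and lies inside ]0, pi[, so the minimum of the sine on
   it is positive. *)
have [|c] := @EVT_min R (@sin R) (l2 - r1) (r2 - l1) ltac:(lra).
  by apply: continuous_subspaceT; exact: continuous_sin.
rewrite in_itv/= => /andP[c1 c2] hc.
have s0 : 0 < sin c by apply: sin_gt0_pi; apply/andP; split; lra.
pose C := (1 + M1 + (1 + M2)) / sin c.
exists C; first by rewrite divr_ge0 ?ltW//; lra.
move=> P [a [/andP[la ar] /andP[Pa Pa']]] [b [/andP[lb br] /andP[Pb Pb']]].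
have sab : sin c <= sin (b - a) by apply: hc; rewrite in_itv/=; apply/andP; split; lra.
have A1 : `|dotn P a| <= 1 + M1.
  have e1 := hM1 a ltac:(apply/andP; split; lra); have e2 := ler_norm (h1 a).
  by rewrite gtr0_norm; lra.
have B1 : `|dotn P b| <= 1 + M2.
  have e1 := hM2 b ltac:(apply/andP; split; lra); have e2 := ler_norm (h2 b).
  by rewrite gtr0_norm; lra.
have key (q s t : R) : q * sin (b - a) = dotn P a * s - dotn P b * t ->
    `|s| <= 1 -> `|t| <= 1 -> `|q| <= C.
  move=> e s1 t1; rewrite /C ler_pdivlMr//.
  apply: (@le_trans _ _ (`|q| * sin (b - a))); first by rewrite ler_wpM2l.
  have sp : 0 < sin (b - a) by exact: lt_le_trans sab.
  rewrite -[X in _ * X](gtr0_norm sp) -normrM e (le_trans (ler_normB _ _))//.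
  rewrite !normrM lerD//.
    by rewrite (le_trans _ A1)// ler_piMr.
  by rewrite (le_trans _ B1)// ler_piMr.
split.
  apply: (key _ (sin b) (sin a)); rewrite ?sin_max//.
  by rewrite /dotn sinB; ring.
apply: (key _ (- cos b) (- cos a)); rewrite ?normrN ?cos_max//.
by rewrite /dotn sinB; ring.
Qed.

Let Delta_out phi P C : (forall P, SA P !=set0 -> SB P !=set0 ->
  `|P.1| <= C /\ `|P.2| <= C) ->
  ~ (`[- C, C]%classic `*` `[- C, C]%classic) P -> Delta phi P = 0.
Proof.
move=> box nP; apply: (mixed_difference0 windows bump1 bump2 sfb).
have [A0|/set0P A0] := eqVneq (SA P) set0; first by left.
have [B0|/set0P B0] := eqVneq (SB P) set0; first by right.
have [a b] := box P A0 B0.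
by exfalso; apply: nP; split; rewrite /= in_itv/= -ler_norml.
Qed.

Lemma Delta_bound phi psi P e :
  (forall x, 0 <= x <= pi -> `|phi x - psi x| <= e) ->
  `|Delta phi P - Delta psi P| <= 4 * e.
Proof.
move=> h.
have hc := h _ (angle_itv sfc P); have ha := h _ (angle_itv sfa P).
have hb := h _ (angle_itv sfb P); have h1' := h _ (angle_itv (support_one R) P).
rewrite /mixed_difference -/pa -/pb -/pc.
move: hc ha hb h1'; rewrite !ler_norml => /andP[? ?] /andP[? ?] /andP[? ?] /andP[? ?].
by apply/andP; split; lra.
Qed.

Lemma measurable_Delta phi : continuous phi -> measurable_fun setT
  (Delta phi : measurableTypeR R * measurableTypeR R -> measurableTypeR R).
Proof.
move=> cphi; have mphi := continuous_measurable_fun cphi.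
apply: measurable_funD.
  apply: measurable_funB.
    apply: measurable_funB.
      exact: (measurableT_comp mphi (measurable_angle sfc)).
    exact: (measurableT_comp mphi (measurable_angle sfa)).
  exact: (measurableT_comp mphi (measurable_angle sfb)).
exact: (measurableT_comp mphi (measurable_angle (support_one R))).
Qed.

Local Notation Q := square.

Lemma Delta_integrable phi : continuous phi ->
  mu2.-integrable setT (EFin \o Delta phi).
Proof.
move=> cphi; have [C C0 box] := strips_box.
have [M M0 hM] := @continuous_bounded_itv R phi 0 pi cphi.
have D0 P : Delta (fun=> 0) P = 0 by rewrite /mixed_difference; ring.
have bnd P : `|Delta phi P| <= 4 * M.
  by rewrite -[Delta phi P]subr0 -(D0 P); apply: Delta_bound => x xpi; rewrite subr0 hM.
have iQ : mu2.-integrable (Q C) (EFin \o Delta phi).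
  apply: measurable_bounded_integrable; first exact: measurable_square.
  - exact: square_measure_ltey.
  - by apply: measurable_funTS; exact: measurable_Delta.
  - exists (4 * M); split; first exact: num_real.
    by move=> x Mx P _; exact: le_trans (bnd P) (ltW Mx).
have := (integrable_mkcond _ (measurable_square C)).1 iQ.
apply: eq_integrable => // P _; rewrite patchE; case: ifPn => //.
by rewrite notin_setE => nP; rewrite /= (Delta_out phi box nP).
Qed.

(** Four values of phi at angles in [0, pi], integrated over a fixed square. This continuity is what
    later replaces phi of class C^2 by a merely continuous function. *)
Lemma mixed_functional_lip : exists2 V, 0 <= V & forall phi psi e,
  continuous phi -> continuous psi -> 0 <= e ->
  (forall x, 0 <= x <= pi -> `|phi x - psi x| <= e) ->
  `|mixed_functional phi - mixed_functional psi| <= e * V.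
Proof.
have [C C0 box] := strips_box; exists (4 * (2 * C) ^+ 2).
  by rewrite mulr_ge0// sqr_ge0.
move=> phi psi e cphi cpsi e0 h.
have iphi := Delta_integrable cphi; have ipsi := Delta_integrable cpsi.
have idiff : mu2.-integrable setT (EFin \o (fun P => Delta phi P - Delta psi P)).
  by have := integrableB measurableT iphi ipsi; apply: eq_integrable.
rewrite /mixed_functional -RintegralB// (le_trans (le_normr_Rintegral _ idiff))//.
have icst : mu2.-integrable setT (EFin \o (cst (4 * e) \_ (Q C))).
  rewrite -restrict_EFin; apply/(integrable_mkcond _ (measurable_square C)).
  apply: measurable_bounded_integrable; first exact: measurable_square.
  - exact: square_measure_ltey.
  - exact: measurable_cst.
  - exact: bounded_cst.
apply: (@le_trans _ _ (\int[mu2]_P (cst (4 * e) \_ (Q C)) P)).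
  apply: le_Rintegral => //.
    exact: (integrable_norm idiff).
  move=> P _; rewrite patchE; case: ifPn => [_|]; first exact: Delta_bound.
  by rewrite notin_setE => nP; rewrite !(Delta_out _ box nP) subrr normr0.
rewrite -Rintegral_mkcond Rintegral_cst; last exact: measurable_square.
rewrite [X in _ * fine X](_ : _ = ((2 * C) ^+ 2)%:E); last exact: square_measure.
by rewrite /= [leRHS]mulrCA mulrA.
Qed.

Lemma mixed_functionalD (phi psi : R -> R) (c : R) : continuous phi -> continuous psi ->
  mixed_functional (fun x => phi x + c * psi x) =
  mixed_functional phi + c * mixed_functional psi.
Proof.
move=> cphi cpsi.
have iphi := Delta_integrable cphi; have ipsi := Delta_integrable cpsi.
have icpsi : mu2.-integrable setT (EFin \o (fun P => c * Delta psi P)).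
  by have := integrableZl measurableT c ipsi; apply: eq_integrable.
rewrite /mixed_functional -RintegralZl// -RintegralD//.
by apply: eq_Rintegral => P _; rewrite /mixed_difference; ring.
Qed.

Lemma mixed_functional_convex phi phi1 phi2 :
  (forall x : R, is_derive x 1 phi (phi1 x)) ->
  (forall x : R, is_derive x 1 phi1 (phi2 x)) -> continuous phi2 ->
  (forall x, 0 <= phi2 x) ->
  (\int[mu2]_z (phi2 (pi - z.2 + z.1) * strip_weight l1 r1 l2 r2 h1 h2 z)%:E =
    (mixed_functional phi)%:E)%E.
Proof.
move=> d1 d2 c2 phi2_ge0.
have cphi : continuous phi by move=> x; exact: is_derive_continuous (d1 x).
rewrite -(integral_mixed_difference windows bump1 bump2 sfb sfc d1 d2 c2 phi2_ge0).
rewrite /mixed_functional /Rintegral fineK//.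
apply: (integrable_fin_num _ (Delta_integrable cphi)); exact: measurableT.
Qed.

End mixed_functional.

(** * The integral hypothesis for bodies and for mixed differences *)

Section clamp.
Context {R : realType}.

(* Composing with [clamp] makes a function continuous on [0, pi] continuous on the line. *)
Definition clamp (x : R) : R := Num.min (Num.max x 0) pi.

Lemma clamp_itv x : 0 <= clamp x <= pi.
Proof. by rewrite /clamp le_min le_max lexx orbT pi_ge0/= ge_min lexx orbT. Qed.

Lemma clamp_id x : 0 <= x <= pi -> clamp x = x.
Proof. by move=> /andP[x0 xpi]; rewrite /clamp max_l// min_l. Qed.

Lemma continuous_clamp : continuous clamp.
Proof.
move=> x; have := @continuous_min R R (fun x => Num.max x 0) (fun=> pi) x.
by apply; [exact: continuous_maxr0|exact: cvg_cst].
Qed.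

Lemma clamp_continuous (f : R -> R) : differentiable_on_cc f 0 pi ->
  continuous (f \o clamp).
Proof.
move=> fd x; have xI : clamp x \in `[0, pi] by rewrite in_itv/= clamp_itv.
(* Tolerance 1 bounds the difference quotients near the point by |l| + 1, a local Lipschitz
   estimate. *)
have /cvg_ex[l /cvgrPdist_lt/(_ 1 ltr01)] := fd _ xI.
rewrite near_withinE => /nbhs_ballP[d /= d0 hd].
apply/cvgrPdist_lt => e e0 /=.
have M0 : 0 < `|l| + 1 by rewrite ltr_wpDl.
pose k := Num.min d (e / (`|l| + 1)).
have k0 : 0 < k by rewrite lt_min d0 divr_gt0.
have /cvgrPdist_lt/(_ k k0) := @continuous_clamp x.
apply: filterS => y yk.
have [->|xy] := eqVneq (clamp y) (clamp x); first by rewrite subrr normr0.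
have yd : ball (clamp x) d (clamp y).
  by rewrite /ball/= (lt_le_trans yk)// /k ge_min lexx.
have yI : clamp y \in `[0, pi] by rewrite in_itv/= clamp_itv.
have := hd _ yd xy yI; set q := _ / _ => lq.
have yx0 : clamp y - clamp x != 0 by rewrite subr_eq0.
have -> : f (clamp x) - f (clamp y) = q * (clamp x - clamp y) by rewrite /q; field.
have ql : `|q| < `|l| + 1.
  by have := ler_normB l (l - q); rewrite opprB addrC subrK; lra.
rewrite normrM (le_lt_trans (ler_wpM2r (normr_ge0 _) (ltW ql)))//.
rewrite mulrC -ltr_pdivlMr// (lt_le_trans yk)// /k ge_min lexx orbT//.
Qed.

End clamp.

Section integral_body.
Context {R : realType}.
Local Notation mu := (@lebesgue_measure R).
Local Notation mu2 := (mu \x mu)%E.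
Variables (p p1 p2 p3 : R -> R).
Hypothesis sf : support_function p p1 p2 p3.
Implicit Types (P : R * R).

Lemma body_separating P : body p P <-> separating `[0, 2 * pi[ p P = 0.
Proof.
split; first exact: separating_body.
move=> s0; apply: contrapT => /nbodyP[c /(arc_exists sf)[u [v [_ Puv]]]].
have [/andP[uv _] _ _ _] := Puv.
by move: s0; rewrite (separating_arc sf Puv); lra.
Qed.

Lemma measurable_body :
  measurable (body p : set (measurableTypeR R * measurableTypeR R)).
Proof.
have -> : body p = setT `&` separating `[0, 2 * pi[ p @^-1` [set 0].
  by rewrite setTI; apply/seteqP; split => P /=; rewrite body_separating.
apply: (measurable_separating _ (sf_measurable sf)) => //; exact: measurable_itv.
Qed.

Lemma body_measure_fin : mu2 (body p) \is a fin_num.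
Proof.
have [M M0 hM] := @continuous_bounded_itv R p 0 (2 * pi) (sf_continuous sf).
have pi0 := pi_gt0 R.
have mI : measurable (`[- M, M]%classic : set (measurableTypeR R)) by exact: measurable_itv.
have KQ : body p `<=` `[- M, M]%classic `*` `[- M, M]%classic.
  move=> [x y] KP.
  have b c : 0 <= c <= 2 * pi -> dotn (x, y) c <= M.
    by move=> /hM h; rewrite (le_trans (KP c))// (le_trans _ h)// ler_norm.
  have K0 := b 0 ltac:(apply/andP; split; lra).
  have Kp := b pi ltac:(apply/andP; split; lra).
  have Kh := b (pi / 2) ltac:(apply/andP; split; lra).
  have Kt := b (pi / 2 + pi) ltac:(apply/andP; split; lra).
  move: K0 Kp Kh Kt; rewrite dotnDpi /dotn/= cos0 sin0 cospi sinpi cos_pihalf sin_pihalf.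
  by rewrite !in_itv/= => *; split; apply/andP; split; lra.
rewrite ge0_fin_numE ?measure_ge0//.
apply: (le_lt_trans _ (square_measure_ltey M0)).
apply: le_measure => //; rewrite inE; first exact: measurable_body.
exact: measurable_square.
Qed.

(** The extended integral is that of the positive part minus that of the negative part, so a finite
    value forces both to be finite. Integrability is thus read off the hypothesis itself. *)
Lemma integral_body (f : R -> R) (r : R) : differentiable_on_cc f 0 pi ->
  (\int[mu2]_(P in ~` body p) (f (visual_angle (body p) P))%:E = r%:E)%E ->
  mu2.-integrable setT (EFin \o (((f \o clamp) \o angle p) \_ (~` body p))) /\
  \int[mu2]_P ((((f \o clamp) \o angle p) \_ (~` body p)) P) = r.
Proof.
move=> fd; set g := _ \_ _.
have -> : (\int[mu2]_(P in ~` body p) (f (visual_angle (body p) P))%:E =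
    \int[mu2]_P (g P)%:E)%E.
  rewrite integral_mkcond; apply: eq_integral => P _.
  rewrite /g !patchE; case: ifPn => //; rewrite inE => nK.
  by rewrite /= (visual_angleE sf nK) (clamp_id (angle_itv sf P)).
move=> e.
have mg : measurable_fun setT (g : measurableTypeR R * measurableTypeR R -> measurableTypeR R).
  apply/measurable_restrict => //; first by apply: measurableC; exact: measurable_body.
  rewrite setTI; apply: measurable_funTS.
  exact: (measurableT_comp (continuous_measurable_fun (clamp_continuous fd)) (measurable_angle sf)).
suff ig : mu2.-integrable setT (EFin \o g) by split => //; rewrite /Rintegral e.
have mge : measurable_fun setT (EFin \o g : measurableTypeR R * measurableTypeR R -> \bar R).
  exact/measurable_EFinP.
have : (\int[mu2]_P (EFin \o g) P \is a fin_num)%E by rewrite e.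
rewrite integralE.
set A := (\int[_]_x _^\+ x)%E; set B := (\int[_]_x _^\- x)%E.
have A0 : (0 <= A)%E by apply: integral_ge0.
have B0 : (0 <= B)%E by apply: integral_ge0.
move=> AB.
have [Af Bf] : A \is a fin_num /\ B \is a fin_num.
  by move: AB A0 B0; case: A => [?||]//; case: B => [?||].
apply/integrableP; split => //.
have -> : (fun P => `|(EFin \o g) P|%E) = ((EFin \o g)^\+ \+ (EFin \o g)^\-)%E.
  by rewrite -fune_abse.
rewrite ge0_integralD//; last 2 first.
- exact: measurable_funepos.
- exact: measurable_funeneg.
by rewrite lte_add_pinfty// -ge0_fin_numE.
Qed.

End integral_body.

Definition visual_angle_formula (R : realType) (f : R -> R) (a b : R) : Prop :=
  forall (K : set (R * R)) (T : R) (gamma : R -> R * R),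
    compact K -> convex K -> interior K !=set0 -> C2_boundary K T gamma ->
    (\int[lebesgue_measure2 R]_(P in ~` K) (f (visual_angle K P))%:E)%E
    = (a * curve_length gamma T ^+ 2 + b * area K)%:E.

Section formula.
Context {R : realType}.
Local Notation mu := (@lebesgue_measure R).
Local Notation mu2 := (mu \x mu)%E.
Variables (f : R -> R) (a b : R).
Hypothesis f_diff : differentiable_on_cc f 0 pi.
Hypothesis f_int : visual_angle_formula f a b.

Lemma body_formula (p p1 p2 p3 : R -> R) (sf : support_function p p1 p2 p3) :
  let g := ((f \o clamp) \o angle p) \_ (~` body p) in
  mu2.-integrable setT (EFin \o g) /\
  \int[mu2]_P g P =
  a * (\int[mu]_(x in `[0, 2 * pi]) p x) ^+ 2 + b * fine (mu2 (body p)).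
Proof.
move=> g; rewrite -(curve_length_contact sf).
apply: (integral_body sf f_diff).
have h := @f_int _ _ _ (body_compact sf) (@body_convex _ p) (body_interior_nonempty sf) (body_C2_boundary sf).
exact: h.
Qed.

Variables (l1 r1 l2 r2 : R) (h1 h2 : R -> R).
Hypothesis windows : [/\ 0 < l1, l1 < r1, r1 <= l2, l2 < r2 & r2 < pi].
Hypothesis r1l2 : r1 < l2.
Hypotheses (bump1 : bump_on l1 r1 h1) (bump2 : bump_on l2 r2 h2).
Let one : R -> R := fun=> 1.
Let pa (x : R) := 1 + h1 x.
Let pb (x : R) := 1 + h2 x.
Let pc (x : R) := 1 + h1 x + h2 x.
Variables (pa1 pa2 pa3 pb1 pb2 pb3 pc1 pc2 pc3 : R -> R).
Hypotheses (sfa : support_function pa pa1 pa2 pa3)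
  (sfb : support_function pb pb1 pb2 pb3)
  (sfc : support_function pc pc1 pc2 pc3).

Lemma mixed_functional_formula : mixed_functional h1 h2 (f \o clamp) =
  2 * a * (\int[mu]_(x in `[0, 2 * pi]) h1 x) * (\int[mu]_(x in `[0, 2 * pi]) h2 x).
Proof.
have cap := body_bumps_cap windows bump1 bump2.
have cup := body_bumps_cup windows bump1 bump2 sfa sfb.
have [i1 e1] := body_formula (support_one R).
have [ia ea] := body_formula sfa.
have [ib eb] := body_formula sfb.
have [ic ec] := body_formula sfc.
set g1 := _ \_ _ in i1 e1; set ga := _ \_ _ in ia ea.
set gb := _ \_ _ in ib eb; set gc := _ \_ _ in ic ec.
have areas : fine (mu2 (body pc)) =
    fine (mu2 (body pa)) + fine (mu2 (body pb)) - fine (mu2 (body one)).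
  have fa := body_measure_fin sfa; have fb := body_measure_fin sfb.
  have f1 := body_measure_fin (support_one R).
  have eqm : (mu2 (body pc) = mu2 (body pa) + mu2 (body pb) - mu2 (body one))%E.
    rewrite -cup -cap; apply: measureUfinl.
    - exact: (measurable_body sfa).
    - exact: (measurable_body sfb).
    - by move: fa; rewrite ge0_fin_numE ?measure_ge0.
  move: fa fb f1 eqm.
  move: (mu2 (body pa)) (mu2 (body pb)) (mu2 (body one)) (mu2 (body pc)).
  by move=> [x| |] [y| |] [z| |] w // _ _ _ ->.
(* On a body the angle is pi, while the exterior integrand is 0. The resulting terms f(pi) cancel
   because the bodies of [pc] and [one] are the union and the intersection of the other two. *)
have Dg P : mixed_difference h1 h2 (f \o clamp) P = (gc P - ga P) - (gb P - g1 P).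
  have Kang (p : R -> R) : body p P -> angle p P = pi.
    by move=> KP; rewrite /angle (separating_body KP) subr0.
  have inC (A : set (R * R)) : P \in ~` A = ~~ (P \in A) by rewrite in_setC.
  rewrite /mixed_difference /gc /ga /gb /g1 !patchE !inC.
  rewrite -cap -cup in_setU in_setI.
  have [aP|aP] := boolP (P \in body pa); have [bP|bP] := boolP (P \in body pb) => /=.
  - have [Pa Pb] := (set_mem aP, set_mem bP).
    have Pc : body pc P by rewrite -cup; left.
    have P1 : body one P by rewrite -cap.
    by rewrite !Kang//; ring.
  - have Pa := set_mem aP.
    have Pc : body pc P by rewrite -cup; left.
    by rewrite (Kang pc)// (Kang pa)//; ring.
  - have Pb := set_mem bP.
    have Pc : body pc P by rewrite -cup; right.
    by rewrite (Kang pc)// (Kang pb)//; ring.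
  - by ring.
have iq (u v : R * R -> R) : mu2.-integrable setT (EFin \o u) ->
    mu2.-integrable setT (EFin \o v) ->
    mu2.-integrable setT (EFin \o (fun P => u P - v P)).
  by move=> iu iv; have := integrableB measurableT iu iv; apply: eq_integrable.
rewrite /mixed_functional; under eq_Rintegral do rewrite Dg.
rewrite RintegralB//; [|exact: iq|exact: iq].
rewrite (RintegralB _ ic ia)// (RintegralB _ ib i1)// ec ea eb e1 areas.
have ch1 := bump_cont bump1; have ch2 := bump_cont bump2.
have c1 : continuous (cst 1 : R -> R) by exact: cst_continuous.
have int1 := continuous_integrable 0 (2 * pi) c1.
have inth1 := continuous_integrable 0 (2 * pi) ch1.
have inth2 := continuous_integrable 0 (2 * pi) ch2.
have intb := continuous_integrable 0 (2 * pi) (sf_continuous sfa).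
have mI : measurable (`[0, 2 * pi]%classic : set (measurableTypeR R)) by exact: measurable_itv.
rewrite !RintegralD//; ring.
Qed.

End formula.

(** * Pairs of modulated bumps *)

(* [sb_small] keeps the radius of curvature of 1 + b s + c t positive for the phases s, t. *)
Record smooth_bump (R : realType) (l r : R) (b b1 b2 b3 : R -> R) : Prop := SmoothBump {
  sb_on : bump_on l r b;
  sb_d1 : forall x : R, is_derive x 1 b (b1 x);
  sb_d2 : forall x : R, is_derive x 1 b1 (b2 x);
  sb_d3 : forall x : R, is_derive x 1 b2 (b3 x);
  sb_c3 : continuous b3;
  sb_small : forall x, `|b2 x| + 2 * `|b1 x| < 1 / 2 }.

(** A trigonometric factor s with derivative t and s'' = - s. The instances are cos for windows left
    of pi / 2, - cos for windows right of it, and sin; nonnegativity on the window keeps the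
    modulated bump nonnegative. *)
Record phase (R : realType) (l r : R) (s t : R -> R) : Prop := Phase {
  ph_d1 : forall x : R, is_derive x 1 s (t x);
  ph_d2 : forall x : R, is_derive x 1 t (- s x);
  ph_per : forall x, s (x + 2 * pi) = s x;
  ph_le1 : forall x, `|s x| <= 1 /\ `|t x| <= 1;
  ph_ge0 : forall x, l < x < r -> 0 <= s x }.

Section modulated_bump.
Context {R : realType}.
Variables (l r : R) (b b1 b2 b3 s t : R -> R).
Hypotheses (sb : smooth_bump l r b b1 b2 b3) (ph : phase l r s t).

Definition modulated (x : R) := b x * s x.
Definition modulated1 (x : R) := b1 x * s x + b x * t x.
Definition modulated2 (x : R) := b2 x * s x + 2 * (b1 x * t x) - b x * s x.
Definition modulated3 (x : R) :=
  b3 x * s x + 3 * (b2 x * t x) - 3 * (b1 x * s x) - b x * t x.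

Lemma modulated_d1 (x : R) : is_derive x 1 modulated (modulated1 x).
Proof.
have := sb_d1 sb x; have := ph_d1 ph x => d1 d2.
by apply: is_derive_eq; rewrite /modulated1 /GRing.scale/=; ring.
Qed.

Lemma modulated_d2 (x : R) : is_derive x 1 modulated1 (modulated2 x).
Proof.
have d1 := sb_d1 sb x; have d2 := sb_d2 sb x.
have d4 := ph_d1 ph x; have d5 := ph_d2 ph x.
by apply: is_derive_eq; rewrite /modulated2 /GRing.scale/=; ring.
Qed.

Lemma modulated_d3 (x : R) : is_derive x 1 modulated2 (modulated3 x).
Proof.
have d1 := sb_d1 sb x; have d2 := sb_d2 sb x; have d3 := sb_d3 sb x.
have d4 := ph_d1 ph x; have d5 := ph_d2 ph x.
by apply: is_derive_eq; rewrite /modulated3 /GRing.scale/=; ring.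
Qed.

Lemma modulated_c3 : continuous modulated3.
Proof.
move=> x.
have c0 := is_derive_continuous (sb_d1 sb x).
have c1 := is_derive_continuous (sb_d2 sb x).
have c2 := is_derive_continuous (sb_d3 sb x).
have c3 := sb_c3 sb (x := x).
have cs := is_derive_continuous (ph_d1 ph x).
have ct := is_derive_continuous (ph_d2 ph x).
by apply: cvgB; [apply: cvgB; [apply: cvgD|]|]; do ?[apply: cvgM; [exact: cvg_cst|]]; exact: cvgM.
Qed.

Lemma modulated_bump : bump_on l r modulated.
Proof.
have bb := sb_on sb; split.
- have per x : modulated (x + 2 * pi) = modulated x.
    by rewrite /modulated (bump_per bb) (ph_per ph).
  move=> x; have [k kx <-] := @periodic_fund R R modulated _ per 0 x (twopi_gt0 R).
  move: kx; rewrite add0r; move: (x + _) => y yt.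
  have [ly|nly] := boolP (l < y < r); last by rewrite /modulated (bump_out bb yt nly) mul0r.
  by rewrite mulr_ge0 ?(bump_ge0 bb)// (ph_ge0 ph).
- by move=> x xt nx; rewrite /modulated (bump_out bb xt nx) mul0r.
- by move=> x; rewrite /modulated (bump_per bb) (ph_per ph).
- by move=> x; exact: is_derive_continuous (modulated_d1 x).
Qed.

(** As s'' = - s, the terms in b cancel and b'' s + 2 b' t remains. The margin 1 / 2 per bump lets
    two bumps be added to the disc, whose radius of curvature is 1. *)
Lemma modulated_curv (x : R) : - (1 / 2) < modulated2 x + modulated x.
Proof.
have sm := sb_small sb x; have [s1 t1] := ph_le1 ph x.
have e1 : `|b2 x * s x| <= `|b2 x| by rewrite normrM ler_piMr.
have e2 : `|b1 x * t x| <= `|b1 x| by rewrite normrM ler_piMr.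
have := ler_norm (- (b2 x * s x)); have := ler_norm (- (b1 x * t x)).
rewrite !normrN /modulated2 /modulated; lra.
Qed.

Lemma support_modulated :
  support_function (fun x => 1 + modulated x) modulated1 modulated2 modulated3.
Proof.
split.
- move=> x.
  apply: (is_derive_eq (is_deriveD (is_derive_cst (1 : R) x 1) (modulated_d1 x))).
  by rewrite add0r.
- exact: modulated_d2.
- exact: modulated_d3.
- exact: modulated_c3.
- by move=> x; rewrite (bump_per modulated_bump).
- by move=> x; rewrite ltr_wpDr// (bump_ge0 modulated_bump).
- by move=> x; have := modulated_curv x; lra.
Qed.

End modulated_bump.

Lemma support_modulated2 (R : realType) (l r l' r' : R)
    (b b1 b2 b3 s t b' b1' b2' b3' s' t' : R -> R) :
  smooth_bump l r b b1 b2 b3 -> phase l r s t ->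
  smooth_bump l' r' b' b1' b2' b3' -> phase l' r' s' t' ->
  support_function (fun x => 1 + modulated b s x + modulated b' s' x)
    (fun x => modulated1 b b1 s t x + modulated1 b' b1' s' t' x)
    (fun x => modulated2 b b1 b2 s t x + modulated2 b' b1' b2' s' t' x)
    (fun x => modulated3 b b1 b2 b3 s t x + modulated3 b' b1' b2' b3' s' t' x).
Proof.
move=> sb ph sb' ph'; split.
- move=> x; apply: (is_derive_eq (is_deriveD (is_deriveD (is_derive_cst (1 : R) x 1)
    (modulated_d1 sb ph x)) (modulated_d1 sb' ph' x))).
  by rewrite add0r.
- move=> x; exact: is_deriveD (modulated_d2 sb ph x) (modulated_d2 sb' ph' x).
- move=> x; exact: is_deriveD (modulated_d3 sb ph x) (modulated_d3 sb' ph' x).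
- by move=> x; apply: cvgD; [exact: (modulated_c3 sb ph)|exact: (modulated_c3 sb' ph')].
- by move=> x; rewrite (bump_per (modulated_bump sb ph)) (bump_per (modulated_bump sb' ph')).
- move=> x; have := bump_ge0 (modulated_bump sb ph) x.
  by have := bump_ge0 (modulated_bump sb' ph') x; lra.
- move=> x; have := modulated_curv sb ph x; have := modulated_curv sb' ph' x; lra.
Qed.

Section phases.
Context {R : realType}.

Lemma phase_cos (l r : R) : 0 <= l -> r <= pi / 2 -> phase l r cos (fun x => - sin x).
Proof.
move=> l0 rpi; split.
- by move=> x; exact: is_derive_cos.
- by move=> x; exact: is_derive_eq.
- exact: cos_2pi.
- by move=> x; rewrite normrN cos_max sin_max.
- by move=> x /andP[lx xr]; apply: cos_ge0_pihalf; apply/andP; split; lra.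
Qed.

Lemma phase_sin (l r : R) : 0 <= l -> r <= pi -> phase l r sin cos.
Proof.
move=> l0 rpi; split.
- by move=> x; exact: is_derive_sin.
- by move=> x; exact: is_derive_cos.
- exact: sin_2pi.
- by move=> x; rewrite cos_max sin_max.
- by move=> x /andP[lx xr]; apply: sin_ge0_pi; apply/andP; split; lra.
Qed.

Lemma phase_cosN (l r : R) : pi / 2 <= l -> r <= pi -> phase l r (fun x => - cos x) sin.
Proof.
move=> l0 rpi; split.
- by move=> x; apply: is_derive_eq; rewrite opprK.
- by move=> x; apply: is_derive_eq; rewrite opprK.
- by move=> x; rewrite cos_2pi.
- by move=> x; rewrite normrN cos_max sin_max.
- move=> x /andP[lx xr]; rewrite -cosDpiE -(subrK (2 * pi) (x + pi)) cos_2pi.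
  by apply: cos_ge0_pihalf; apply/andP; split; lra.
Qed.

End phases.

Lemma integral_EFin_itv (R : realType) (u : R -> R) (l r : R) : continuous u ->
  (\int[@lebesgue_measure R]_(x in `[l, r]) (u x)%:E)%E =
  (\int[@lebesgue_measure R]_(x in `[l, r]) u x)%:E.
Proof.
move=> cu; rewrite /Rintegral fineK//.
by apply: integrable_fin_num => //; exact: continuous_integrable.
Qed.

Lemma measurable_window (R : realType) (l1 r1 l2 r2 : R) :
  measurable_fun setT (fun z : measurableTypeR R * measurableTypeR R =>
    (l1 < z.1 < r1) && (l2 < z.2 < r2)).
Proof. by do !apply: measurable_and; exact: measurable_fun_ltr. Qed.

Lemma measurable_strip_weight (R : realType) (l1 r1 l2 r2 : R) (h1 h2 : R -> R) :
  0 < l1 -> r1 <= l2 -> r2 < pi -> continuous h1 -> continuous h2 ->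
  measurable_fun setT (strip_weight l1 r1 l2 r2 h1 h2 :
    measurableTypeR R * measurableTypeR R -> measurableTypeR R).
Proof.
move=> l10 rl r2pi c1 c2; rewrite /strip_weight.
apply: measurable_fun_if => //; first exact: measurable_window.
set W := _ `&` _.
have mW : measurable W.
  by have h := @measurable_window R l1 r1 l2 r2; apply: (h measurableT [set true]).
have mf1 : measurable_fun W (fun z : measurableTypeR R * measurableTypeR R => h1 z.1 : measurableTypeR R).
  by apply: measurable_funTS; exact: (measurableT_comp (continuous_measurable_fun c1)).
have mf2 : measurable_fun W (fun z : measurableTypeR R * measurableTypeR R => h2 z.2 : measurableTypeR R).
  by apply: measurable_funTS; exact: (measurableT_comp (continuous_measurable_fun c2)).
apply: measurable_funM; first exact: measurable_funM.
pose A : set (measurableTypeR R) := `]0, +oo[%classic.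
have mA : measurable A by exact: measurable_itv.
have mi : measurable_fun A (fun x : R => x^-1).
  apply: open_continuous_measurable_fun; first exact: interval_open.
  by move=> x; rewrite inE /A/= in_itv/= andbT => x0; apply: inv_continuous; rewrite gt_eqF.
apply: (measurable_comp mA _ mi).
  move=> _ [z [_ /= /andP[/andP[? ?] /andP[? ?]]] <-].
  by rewrite /A/= in_itv/= andbT; apply: sin_gt0_pi; apply/andP; split; lra.
apply: measurable_funTS.
apply: (measurableT_comp (continuous_measurable_fun (@continuous_sin R))).
by apply: measurable_funB; [exact: measurable_snd|exact: measurable_fst].
Qed.

(** * Integration by parts on windows, and the paired functional *)

Section itv_integral.
Context {R : realType}.
Local Notation mu := (@lebesgue_measure R).
Implicit Types (f g : R -> R) (l r k : R).

Lemma Rintegral_itvD f g l r k : continuous f -> continuous g ->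
  \int[mu]_(x in `[l, r]) (f x + k * g x) =
  \int[mu]_(x in `[l, r]) f x + k * \int[mu]_(x in `[l, r]) g x.
Proof.
move=> cf cg; have cG := continuous_integrable l r cg.
rewrite -RintegralZl// -RintegralD//; first exact: continuous_integrable.
by apply: continuous_integrable => x; apply: cvgM; [exact: cvg_cst|exact: cg].
Qed.

Lemma Rintegral_itv_norm f g l r : continuous f -> continuous g ->
  (forall x, l <= x <= r -> `|f x| <= g x) ->
  `|\int[mu]_(x in `[l, r]) f x| <= \int[mu]_(x in `[l, r]) g x.
Proof.
move=> cf cg fg; have iF := continuous_integrable l r cf.
rewrite (le_trans (le_normr_Rintegral _ iF))//.
apply: le_Rintegral => [//|||x].
- exact: (integrable_norm iF).
- exact: continuous_integrable.
- by rewrite /= in_itv/=; exact: fg.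
Qed.

Lemma Rintegral_support f (u v l r : R) : u <= l -> r <= v -> 
  (forall x, u <= x <= v -> ~~ (l <= x <= r) -> f x = 0) ->
  \int[mu]_(x in `[u, v]) f x = \int[mu]_(x in `[l, r]) f x.
Proof.
move=> ul rv f0; rewrite Rintegral_mkcond [RHS]Rintegral_mkcond.
apply: eq_Rintegral => x _; rewrite !patchE !mem_setE !in_itv/=.
case: ifPn => xuv; case: ifPn => // xlr; first exact: f0.
by case/negP: xuv; move/andP: xlr => [lx xr]; apply/andP; split; lra.
Qed.

End itv_integral.

Section smooth_bump.
Context {R : realType}.
Local Notation mu := (@lebesgue_measure R).
Variables (l r : R) (b b1 b2 b3 : R -> R).
Hypotheses (l0 : 0 < l) (lr : l < r) (rpi : r < pi) (sb : smooth_bump l r b b1 b2 b3).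

(** A nonnegative function has a minimum at each zero. This removes the boundary terms of both
    integrations by parts. *)
Lemma smooth_bump_end x : l <= x <= r -> ~~ (l < x < r) -> b x = 0 /\ b1 x = 0.
Proof.
move=> /andP[lx xr] nx; have bx : b x = 0.
  have h0 := l0; have hpi := rpi.
  by apply: (bump_out (sb_on sb)) => //; apply/andP; split; lra.
split=> //; have [|t _||t _|_ e] := @derive1_at_min R b (x - 1) (x + 1) x.
- by lra.
- by have [] := sb_d1 sb t.
- by rewrite in_itv/=; apply/andP; split; lra.
- by rewrite bx (bump_ge0 (sb_on sb)).
- by have [_ e'] := sb_d1 sb x; rewrite -e' e.
Qed.

Lemma smooth_bump_parts (phi phi1 phi2 : R -> R) (s : R) :
  (forall x : R, is_derive x 1 phi (phi1 x)) ->
  (forall x : R, is_derive x 1 phi1 (phi2 x)) -> continuous phi2 ->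
  \int[mu]_(x in `[l, r]) (phi2 (s + x) * b x) =
  \int[mu]_(x in `[l, r]) (phi (s + x) * b2 x).
Proof.
move=> d1 d2 cphi2.
have cb : continuous b by exact: bump_cont (sb_on sb).
have cb2 : continuous b2 by move=> x; exact: is_derive_continuous (sb_d3 sb x).
have cphi : continuous phi by move=> x; exact: is_derive_continuous (d1 x).
have shift (g : R -> R) : continuous g -> continuous (fun x => g (s + x)).
  move=> cg x; apply: continuous_comp; last exact: cg.
  by apply: cvgD; [exact: cvg_cst|exact: cvg_id].
have dF (x : R) : is_derive x 1 (fun x => phi1 (s + x) * b x - phi (s + x) * b1 x)
    (phi2 (s + x) * b x + -1 * (phi (s + x) * b2 x)).
  have e1 := is_derive_addr d1 s x; have e2 := is_derive_addr d2 s x.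
  have e3 := sb_d1 sb x; have e4 := sb_d2 sb x.
  by apply: is_derive_eq; rewrite /GRing.scale/=; ring.
have c1 : continuous (fun x => phi2 (s + x) * b x).
  by move=> x; apply: cvgM; [exact: shift|exact: cb].
have c2 : continuous (fun x => phi (s + x) * b2 x).
  by move=> x; apply: cvgM; [exact: shift|exact: cb2].
have := Rintegral_derive lr dF; rewrite Rintegral_itvD//.
have [-> ->] := @smooth_bump_end l ltac:(by rewrite lexx ltW) ltac:(by rewrite ltxx).
have [-> ->] := @smooth_bump_end r ltac:(by rewrite lexx ltW) ltac:(by rewrite ltxx andbF).
rewrite !mulr0 !subrr => h; apply/eqP; rewrite -subr_eq0 -mulN1r; apply/eqP/h.
move=> x; apply: cvgD; first exact: c1.
by apply: cvgM; [exact: cvg_cst|exact: c2].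
Qed.

End smooth_bump.

Definition pairing (R : realType) (l1 r1 l2 r2 : R) (c g k : R -> R) : R :=
  \int[@lebesgue_measure R]_(y in `[l2, r2])
    (c y * \int[@lebesgue_measure R]_(x in `[l1, r1]) (g (pi - y + x) * k x)).

Section pairing.
Context {R : realType}.
Local Notation mu := (@lebesgue_measure R).
Variables (l1 r1 l2 r2 : R) (c : R -> R).
Hypothesis cc : continuous c.
Local Notation E := (pairing l1 r1 l2 r2 c).
Implicit Types g k : R -> R.

Let c_in g k y : continuous g -> continuous k -> continuous (fun x => g (pi - y + x) * k x).
Proof. by move=> cg ck x; apply: cvgM; [exact: continuous_subadd2|exact: ck]. Qed.

Let c_out g k : continuous g -> continuous k ->
  continuous (fun y => c y * \int[mu]_(x in `[l1, r1]) (g (pi - y + x) * k x)).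
Proof. by move=> cg ck y; apply: cvgM; [exact: cc|exact: inner_continuous]. Qed.

Lemma pairingD g g' k (m : R) : continuous g -> continuous g' -> continuous k ->
  E (fun x => g x + m * g' x) k = E g k + m * E g' k.
Proof.
move=> cg cg' ck; rewrite /pairing -Rintegral_itvD; [|exact: c_out..].
apply: eq_Rintegral => y _; rewrite mulrCA -mulrDr; congr (_ * _).
rewrite -Rintegral_itvD; [|exact: c_in..].
by apply: eq_Rintegral => x _; ring.
Qed.

Lemma pairing_bound g k (e : R) : continuous g -> continuous k ->
  0 <= e -> (forall y, 0 <= c y) ->
  0 <= l1 -> r1 <= l2 -> r2 <= pi ->
  (forall x, 0 <= x <= pi -> `|g x| <= e) ->
  `|E g k| <= e * \int[mu]_(y in `[l2, r2]) (c y * \int[mu]_(x in `[l1, r1]) `|k x|).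
Proof.
move=> cg ck e0 c0 l10 rl r2pi ge.
have cn : continuous (fun x => `|k x|).
  by move=> x; apply: continuous_comp; [exact: ck|exact: norm_continuous].
have ce (h : R -> R) m : continuous h -> continuous (fun x => h x * m).
  by move=> ch x; apply: cvgM; [exact: ch|exact: cvg_cst].
have ce' (h : R -> R) m : continuous h -> continuous (fun x => m * h x).
  by move=> ch x; apply: cvgM; [exact: cvg_cst|exact: ch].
rewrite -RintegralZl//; last by apply: continuous_integrable; exact: ce.
apply: Rintegral_itv_norm; [exact: c_out|by do 2?[apply: ce'|apply: ce]|].
move=> y /andP[ly yr]; rewrite normrM ger0_norm// mulrCA ler_wpM2l//.
rewrite -RintegralZl//; last exact: continuous_integrable.
apply: Rintegral_itv_norm; [exact: c_in|exact: ce'|].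
move=> x /andP[lx xr]; rewrite normrM ler_wpM2r// ge//; apply/andP; split; lra.
Qed.

End pairing.

Section bump_pair.
Context {R : realType}.
Local Notation mu := (@lebesgue_measure R).
Local Notation mu2 := (mu \x mu)%E.
Variables (l1 r1 l2 r2 : R) (b b1 b2 b3 c c1 c2 c3 : R -> R).
Hypothesis windows : [/\ 0 < l1, l1 < r1, r1 < pi / 2 < l2, l2 < r2 & r2 < pi].
Hypotheses (sb : smooth_bump l1 r1 b b1 b2 b3) (sc : smooth_bump l2 r2 c c1 c2 c3).
Implicit Types phi : R -> R.

(* cos x sin y - sin x cos y cancels the denominator of [strip_weight]. *)
Definition paired_functional phi : R :=
  mixed_functional (modulated b cos) (modulated c sin) phi +
  mixed_functional (modulated b sin) (modulated c (fun y => - cos y)) phi.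

Local Notation E := (pairing l1 r1 l2 r2 c).

Let cb : continuous b. Proof. exact: bump_cont (sb_on sb). Qed.
Let cc : continuous c. Proof. exact: bump_cont (sb_on sc). Qed.

Let bump_end (l r : R) (h : R -> R) : 0 < l -> r < pi -> bump_on l r h ->
  forall x, l <= x <= r -> ~~ (l < x < r) -> h x = 0.
Proof.
move=> l0 rpi bh x /andP[h1 h2] nx; apply: (bump_out bh) => //.
by apply/andP; split; lra.
Qed.

Let wd : [/\ 0 < l1, l1 < r1, r1 <= l2, l2 < r2 & r2 < pi].
Proof. by have [w1 w2 /andP[w3 w4] w5 w6] := windows; split=> //; lra. Qed.
Let wlt : r1 < l2.
Proof. by have [w1 w2 /andP[w3 w4] w5 w6] := windows; lra. Qed.

Let phb1 : phase l1 r1 cos (fun x => - sin x).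
Proof. by have [w1 w2 /andP[w3 w4] w5 w6] := windows; apply: phase_cos; lra. Qed.
Let phb2 : phase l1 r1 sin cos.
Proof. by have [w1 w2 /andP[w3 w4] w5 w6] := windows; apply: phase_sin; lra. Qed.
Let phc1 : phase l2 r2 sin cos.
Proof. by have [w1 w2 /andP[w3 w4] w5 w6] := windows; apply: phase_sin; lra. Qed.
Let phc2 : phase l2 r2 (fun x => - cos x) sin.
Proof. by have [w1 w2 /andP[w3 w4] w5 w6] := windows; apply: phase_cosN; lra. Qed.

Let sfa1 := support_modulated sb phb1.
Let sfb1 := support_modulated sc phc1.
Let sfc1 := support_modulated2 sb phb1 sc phc1.
Let sfa2 := support_modulated sb phb2.
Let sfb2 := support_modulated sc phc2.
Let sfc2 := support_modulated2 sb phb2 sc phc2.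
Let bb1 := modulated_bump sb phb1.
Let bc1 := modulated_bump sc phc1.
Let bb2 := modulated_bump sb phb2.
Let bc2 := modulated_bump sc phc2.

Lemma paired_functional_convex phi phi1 phi2 :
  (forall x : R, is_derive x 1 phi (phi1 x)) ->
  (forall x : R, is_derive x 1 phi1 (phi2 x)) -> continuous phi2 ->
  (forall x, 0 <= phi2 x) -> paired_functional phi = E phi2 b.
Proof.
move=> d1 d2 cphi2 phi2_ge0.
have [w1 w2 /andP[w3 w4] w5 w6] := windows.
have mphi := measurable_subadd cphi2.
apply: EFin_inj; rewrite /paired_functional EFinD.
rewrite -(mixed_functional_convex wd wlt bb1 bc1 sfa1 sfb1 sfc1 d1 d2 cphi2 phi2_ge0).
rewrite -(mixed_functional_convex wd wlt bb2 bc2 sfa2 sfb2 sfc2 d1 d2 cphi2 phi2_ge0).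
have mw1 := measurable_strip_weight w1 (ltW wlt) w6 (bump_cont bb1) (bump_cont bc1).
have mw2 := measurable_strip_weight w1 (ltW wlt) w6 (bump_cont bb2) (bump_cont bc2).
have w_ge0 h1 h2 z : bump_on l1 r1 h1 -> bump_on l2 r2 h2 ->
    0 <= strip_weight l1 r1 l2 r2 h1 h2 z.
  move=> bh1 bh2; rewrite /strip_weight; case: ifPn => // /andP[/andP[? ?] /andP[? ?]].
  rewrite divr_ge0 ?mulr_ge0 ?(bump_ge0 bh1) ?(bump_ge0 bh2)//.
  by apply: sin_ge0_pi; apply/andP; split; lra.
rewrite -ge0_integralD//; last 4 first.
- by move=> z _; rewrite lee_fin mulr_ge0// w_ge0.
- by apply/measurable_EFinP; exact: measurable_funM.
- by move=> z _; rewrite lee_fin mulr_ge0// w_ge0.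
- by apply/measurable_EFinP; exact: measurable_funM.
pose u z := phi2 (pi - z.2 + z.1) *
  (if (l1 < z.1 < r1) && (l2 < z.2 < r2) then b z.1 * c z.2 else 0).
transitivity (\int[mu2]_z (u z)%:E)%E.
  apply: eq_integral => z _; rewrite -EFinD; congr EFin.
  rewrite -mulrDr /u; congr (_ * _); rewrite /strip_weight.
  case: ifPn => [/andP[/andP[? ?] /andP[? ?]]|_]; last by rewrite addr0.
  have s0 : 0 < sin (z.2 - z.1) by apply: sin_gt0_pi; apply/andP; split; lra.
  rewrite /modulated -mulrDl.
  rewrite (_ : _ + _ = b z.1 * c z.2 * sin (z.2 - z.1)); last by rewrite sinB; ring.
  by rewrite mulfK// gt_eqF.
rewrite fubini_tonelli2; last 2 first.
- apply/measurable_EFinP; apply: measurable_funM => //.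
  apply: measurable_fun_ifT => //; first exact: measurable_window.
  apply: measurable_funM.
    exact: (measurableT_comp (continuous_measurable_fun cb)).
  exact: (measurableT_comp (continuous_measurable_fun cc)).
- move=> z; rewrite lee_fin mulr_ge0//; case: ifP => // _.
  by rewrite mulr_ge0 ?(bump_ge0 (sb_on sb)) ?(bump_ge0 (sb_on sc)).
pose I y := \int[mu]_(x in `[l1, r1]) (phi2 (pi - y + x) * b x).
have cI : continuous I by exact: inner_continuous.
have cin y : continuous (fun x => phi2 (pi - y + x) * b x).
  by move=> x; apply: cvgM; [exact: continuous_subadd2|exact: cb].
have inner y : (\int[mu]_x (u (x, y))%:E)%E = (((fun y => c y * I y) \_ `[l2, r2]) y)%:E.
  rewrite patchE mem_setE in_itv/=; case: ifPn => [yI|yI]; last first.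
    apply: integral0_eq => x _; rewrite /u/= ifF ?mulr0//.
    by apply/negbTE; apply: contra yI => /andP[_ /andP[/ltW-> /ltW->]].
  (* [strip_weight] lives on open windows and [pairing] on closed ones; they agree because the bumps
     vanish at the ends. *)
  have [ly|nly] := boolP (l2 < y < r2); last first.
    rewrite (bump_end _ w6 (sb_on sc) yI nly); last by lra.
    by rewrite mul0r; apply: integral0_eq => x _; rewrite /u/= (negbTE nly) andbF mulr0.
  rewrite /I -RintegralZl//; last exact: continuous_integrable.
  rewrite -integral_EFin_itv; last first.
    by move=> x; apply: cvgM; [exact: cvg_cst|exact: cin].
  rewrite [RHS]integral_mkcond; apply: eq_integral => x _.
  rewrite patchE mem_setE in_itv/= /u/= ly andbT.
  case: ifPn => [/andP[h1 h2]|nx].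
    by rewrite (ltW h1) (ltW h2)/=; congr EFin; ring.
  case: ifPn => xI; last by rewrite mulr0.
  rewrite (bump_end w1 _ (sb_on sb) xI nx); last by lra.
  by rewrite !mulr0.
under eq_integral do rewrite /fubini_G/= inner.
rewrite /pairing -integral_EFin_itv; last first.
  by move=> y; apply: cvgM; [exact: cc|exact: cI].
by rewrite [RHS]integral_mkcond; apply: eq_integral => y _; rewrite !patchE; case: ifPn.
Qed.

Lemma pairing_parts phi phi1 phi2 :
  (forall x : R, is_derive x 1 phi (phi1 x)) ->
  (forall x : R, is_derive x 1 phi1 (phi2 x)) -> continuous phi2 ->
  E phi2 b = E phi b2.
Proof.
move=> d1 d2 c2'; have [w1 w2 w3 w4 w5] := wd.
apply: eq_Rintegral => y _; congr (_ * _).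
by apply: (smooth_bump_parts w1 w2 _ sb (pi - y) d1 d2 c2'); lra.
Qed.

Lemma paired_functionalD phi psi (m : R) : continuous phi -> continuous psi ->
  paired_functional (fun x => phi x + m * psi x) =
  paired_functional phi + m * paired_functional psi.
Proof.
move=> cphi cpsi; rewrite /paired_functional.
rewrite (mixed_functionalD wd wlt bb1 bc1 sfa1 sfb1 sfc1)//.
rewrite (mixed_functionalD wd wlt bb2 bc2 sfa2 sfb2 sfc2)//.
by rewrite mulrDr addrACA.
Qed.

Lemma paired_functional_lip : exists2 V, 0 <= V & forall phi psi e,
  continuous phi -> continuous psi -> 0 <= e ->
  (forall x, 0 <= x <= pi -> `|phi x - psi x| <= e) ->
  `|paired_functional phi - paired_functional psi| <= e * V.
Proof.
have [V1 V10 h1] := mixed_functional_lip wd wlt bb1 bc1 sfa1 sfb1 sfc1.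
have [V2 V20 h2] := mixed_functional_lip wd wlt bb2 bc2 sfa2 sfb2 sfc2.
exists (V1 + V2); first exact: addr_ge0.
move=> phi psi e cphi cpsi e0 h; rewrite /paired_functional opprD addrACA mulrDr.
by rewrite (le_trans (ler_normD _ _))// lerD ?h1 ?h2.
Qed.

Let cb2 : continuous b2.
Proof. by move=> x; exact: is_derive_continuous (sb_d3 sb x). Qed.

(** Adding M x^2 / 2 makes the second derivative nonnegative. Both sides are linear, and the
    identity for the quadratic itself is an instance of the convex case, so it can be subtracted. *)
Lemma paired_functional_C2 phi phi1 phi2 (M : R) :
  (forall x : R, is_derive x 1 phi (phi1 x)) ->
  (forall x : R, is_derive x 1 phi1 (phi2 x)) -> continuous phi2 ->
  (forall x, `|phi2 x| <= M) -> paired_functional phi = E phi b2.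
Proof.
move=> d1 d2 cphi2 hM.
have cphi : continuous phi by move=> x; exact: is_derive_continuous (d1 x).
have M0 : 0 <= M by exact: le_trans (normr_ge0 _) (hM 0).
have q1 (x : R) : is_derive x 1 (fun x : R => 1 / 2 * x ^+ 2) x.
  by apply: is_derive_eq; rewrite /GRing.scale/=; field.
have q2 (x : R) : is_derive x 1 (fun x : R => x) 1 by exact: is_derive_id.
have q3 : continuous (fun _ : R => 1 : R) by move=> x; exact: cvg_cst.
have cq : continuous (fun x : R => 1 / 2 * x ^+ 2).
  by move=> x; exact: is_derive_continuous (q1 x).
have Eq := paired_functional_convex q1 q2 q3 (fun _ => ler01).
have s1 (x : R) : is_derive x 1 (fun x => phi x + M * (1 / 2 * x ^+ 2)) (phi1 x + M * x).
  have e1 := d1 x; have e2 := q1 x.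
  by apply: is_derive_eq; rewrite /GRing.scale/=; ring.
have s2 (x : R) : is_derive x 1 (fun x => phi1 x + M * x) (phi2 x + M * 1).
  have e1 := d2 x.
  by apply: is_derive_eq; rewrite /GRing.scale/=; ring.
have s3 : continuous (fun x => phi2 x + M * 1).
  by move=> x; apply: cvgD; [exact: cphi2|exact: cvg_cst].
have s4 x : 0 <= phi2 x + M * 1.
  by have := ler_norm (- phi2 x); have := hM x; rewrite normrN mulr1; lra.
have := paired_functional_convex s1 s2 s3 s4.
have S := pairing_parts s1 s2 s3.
have Q := etrans Eq (pairing_parts q1 q2 q3).
have D := paired_functionalD M cphi cq; rewrite Q in D.
have D' := pairingD l1 r1 l2 r2 cc M cphi cq cb2.
move=> h; exact: addIr (etrans (esym D) (etrans h (etrans S D'))).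
Qed.

(** Once the derivatives rest on b, both sides are Lipschitz in phi for the uniform norm on [0, pi],
    with constants [V] and [W], and agree on the Steklov means of phi. *)
Lemma paired_functionalE phi (C : R) : continuous phi -> (forall x, `|phi x| <= C) ->
  paired_functional phi = E phi b2.
Proof.
move=> cphi hC; have [w1 w2 w3 w4 w5] := wd.
have [V V0 hV] := paired_functional_lip.
pose W := \int[mu]_(y in `[l2, r2]) (c y * \int[mu]_(x in `[l1, r1]) `|b2 x|).
apply/eqP; rewrite -subr_eq0 -normr_le0; apply/ler_addgt0Pr => e e0; rewrite add0r.
have D0 : 0 < V + `|W| + 1 by have := normr_ge0 W; lra.
have d0 : 0 < e / (V + `|W| + 1) by rewrite divr_gt0.
have [psi [psi1 [psi2 [M [d1 d2 cpsi2 hM hpsi]]]]] :=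
  C2_approximation 0 pi cphi hC d0.
have cpsi : continuous psi by move=> x; exact: is_derive_continuous (d1 x).
have e1 := paired_functional_C2 d1 d2 cpsi2 hM.
have h1 := hV _ _ _ cpsi cphi (ltW d0) hpsi.
have cD : continuous (fun x => psi x + -1 * phi x).
  by move=> x; apply: cvgD; [exact: cpsi|apply: cvgM; [exact: cvg_cst|exact: cphi]].
have h2 : `|E psi b2 - E phi b2| <= e / (V + `|W| + 1) * W.
  rewrite -mulN1r -(pairingD l1 r1 l2 r2 cc)//.
  apply: pairing_bound => //; [exact: ltW|exact: bump_ge0 (sb_on sc)|exact: ltW|exact: ltW|].
  by move=> x xpi; rewrite mulN1r; exact: hpsi.
have -> : paired_functional phi - E phi b2 =
    (E psi b2 - E phi b2) - (paired_functional psi - paired_functional phi).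
  by rewrite e1; move: (paired_functional phi) (E psi b2) (E phi b2) => x y z; ring.
rewrite (le_trans (ler_normB _ _))//.
apply: (@le_trans _ _ (e / (V + `|W| + 1) * (W + V))); first by rewrite mulrDr lerD.
rewrite -mulrA; apply: ler_piMr; first exact: ltW.
rewrite mulrC ler_pdivrMr// mul1r.
by have := ler_norm W; lra.
Qed.

(** The kernel sin (pi - y + x) = sin (y - x) splits by the addition theorem into the products of
    integrals that [mixed_functional_formula] produces. As sin is the second derivative of x - sin
    x, this singles out that function. *)
Lemma pairing_sin : E sin b =
  (\int[mu]_(x in `[l1, r1]) modulated b cos x) *
    (\int[mu]_(y in `[l2, r2]) modulated c sin y) +
  (\int[mu]_(x in `[l1, r1]) modulated b sin x) *
    \int[mu]_(y in `[l2, r2]) modulated c (fun y => - cos y) y.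
Proof.
have ci1 := bump_cont bb1; have ci2 := bump_cont bb2.
have co1 := bump_cont bc1; have co2 := bump_cont bc2.
have cM (h : R -> R) m : continuous h -> continuous (fun x => m * h x).
  by move=> ch x; apply: cvgM; [exact: cvg_cst|exact: ch].
set A := (X in X * _ + _); set B := (X in _ + X * _).
rewrite -RintegralZl//; last exact: continuous_integrable.
rewrite -Rintegral_itvD//; last exact: cM.
apply: eq_Rintegral => y _.
transitivity (c y * (sin y * A + - cos y * B)); last by rewrite /modulated; ring.
congr (_ * _); rewrite /A -RintegralZl//; last exact: continuous_integrable.
rewrite -Rintegral_itvD//; last exact: cM.
apply: eq_Rintegral => x _.
rewrite (_ : pi - y + x = x - y + pi); last by ring.
by rewrite sinDpiE sinB /modulated; ring.
Qed.

Let modulated_support l r h : 0 < l -> r < pi -> bump_on l r h ->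
  \int[mu]_(x in `[0, 2 * pi]) h x = \int[mu]_(x in `[l, r]) h x.
Proof.
move=> l0 rpi bh; apply: Rintegral_support => [||x /andP[x0 x2] nx].
- exact: ltW.
- by have := pi_gt0 R; lra.
have [x2'|x2'] := ltP x (2 * pi).
  apply: (bump_out bh); first by rewrite x0.
  by apply: contra nx => /andP[/ltW-> /ltW->].
have -> : x = 0 + 2 * pi by lra.
rewrite (bump_per bh) (bump_out bh)// ?lexx ?mulr_gt0 ?pi_gt0//.
by rewrite lt_gtF.
Qed.

Lemma pairing_defect (f : R -> R) (a' b' : R) :
  differentiable_on_cc f 0 pi -> visual_angle_formula f a' b' ->
  E (fun x => (f \o clamp) x + - (2 * a') * (x - sin x)) b2 = 0.
Proof.
move=> fd fint; have [w1 w2 w3 w4 w5] := wd.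
have cf := clamp_continuous fd.
have [C _ hC] := continuous_bounded_itv 0 pi cf.
have s1 (x : R) : is_derive x 1 (fun x : R => x - sin x) (1 - cos x).
  by apply: is_derive_eq.
have s2 (x : R) : is_derive x 1 (fun x : R => 1 - cos x) (sin x).
  by apply: is_derive_eq; ring.
have cs1 : continuous (fun x : R => x - sin x).
  by move=> x; exact: is_derive_continuous (s1 x).
rewrite (pairingD l1 r1 l2 r2 cc)// -(pairing_parts s1 s2); last exact: continuous_sin.
rewrite -(@paired_functionalE _ C)//; last first.
  by move=> x; rewrite /= -(clamp_id (clamp_itv x)); apply: hC; exact: clamp_itv.
rewrite /paired_functional (mixed_functional_formula fd fint wd bb1 bc1 sfa1 sfb1 sfc1).
rewrite (mixed_functional_formula fd fint wd bb2 bc2 sfa2 sfb2 sfc2).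
rewrite (modulated_support _ _ bb1)// ?(modulated_support _ _ bc1)//; try lra.
rewrite (modulated_support _ _ bb2)// ?(modulated_support _ _ bc2)//; try lra.
by rewrite pairing_sin; ring.
Qed.

End bump_pair.

(** * Jensen's equation *)

Section derivatives.
Context {R : realType}.
Implicit Types (f df : R -> R) (x T : R).

Lemma is_derive_quadratic f x (d C : R) :
  (forall h, `|f (h + x) - f x - h * d| <= C * h ^+ 2) -> is_derive x 1 f d.
Proof.
move=> hf.
have C0 : 0 <= C by have := hf 1; rewrite expr1n mulr1; apply: le_trans.
have cv : (fun h : R => h^-1 *: (f (h *: (1 : R) + x) - f x)) @ 0^' --> d.
  apply/cvgrPdist_le => e e0; have C1 : 0 < C + 1 by lra.
  rewrite near_withinE; apply/nbhs_ballP; exists (e / (C + 1)); first exact: divr_gt0.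
  move=> h; rewrite /ball/= sub0r normrN ltr_pdivlMr// => hs h0.
  have -> : d - h^-1 *: (f (h *: (1 : R) + x) - f x) = - h^-1 * (f (h + x) - f x - h * d).
    by rewrite /GRing.scale/= mulr1; field.
  rewrite normrM normrN normfV ler_pdivrMl ?normr_gt0// (le_trans (hf h))//.
  rewrite -(real_normK (num_real h)) expr2 mulrCA ler_wpM2l// mulrC (le_trans _ (ltW hs))//.
  by rewrite ler_wpM2l//; lra.
by apply: DeriveDef; [apply/cvg_ex; exists d|exact: cvg_lim cv].
Qed.

(** Truncated powers are the source of all bumps: each further exponent brings one more continuous
    derivative. The square is differentiated through a quadratic remainder, which covers the corner
    at 0; higher powers follow from the product rule with the factor x. *)
Lemma is_derive_max0 x (n : nat) :
  is_derive x 1 (fun x => Num.max x 0 ^+ n.+2) (n.+2%:R * Num.max x 0 ^+ n.+1).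
Proof.
elim: n => [|n IHn].
  apply: (@is_derive_quadratic _ _ _ 1) => h; rewrite mul1r expr1 ler_norml.
  by apply/andP; split; case: (leP (h + x) 0); case: (leP x 0); nra.
have -> : (fun x => Num.max x 0 ^+ n.+3) = (fun x => x * Num.max x 0 ^+ n.+2).
  by apply/funext => y; rewrite [LHS]exprS; case: (leP y 0) => // _; rewrite expr0n !mulr0.
apply: is_derive_eq; rewrite /GRing.scale/= (_ : x * _ = n.+2%:R * Num.max x 0 ^+ n.+2).
  rewrite -[n.+3%:R]natr1; move: (n.+2%:R : R) => k; ring.
rewrite mulrCA [Num.max x 0 ^+ n.+2]exprS; congr (_ * _).
by case: (leP x 0) => // _; rewrite exprS !mul0r mulr0.
Qed.

Lemma derive0_cst f : (forall x, is_derive x 1 f 0) -> forall x y, f x = f y.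
Proof.
move=> f0 x y; wlog xy : x y / x < y => [h|].
  by have [/h//|/h//|->] := ltgtP x y.
have [c _] := is_derive_MVT xy f0; rewrite mul0r => /eqP; rewrite subr_eq0.
by move=> /eqP.
Qed.

Lemma periodic_derive f df T : (forall x, is_derive x 1 f (df x)) ->
  (forall x, f (x + T) = f x) -> forall x, df (x + T) = df x.
Proof.
move=> fdf per x; have d1 := is_derive_addr fdf T x.
have e : (fun x => f (T + x)) = f by apply/funext => y; rewrite addrC per.
rewrite e in d1; have [_ e1] := d1; have [_ e2] := fdf x.
by rewrite addrC -e1 -e2.
Qed.

Lemma continuous_periodic_bounded f T : 0 < T -> continuous f ->
  (forall x, f (x + T) = f x) -> exists2 M, 0 <= M & forall x, `|f x| <= M.
Proof.
move=> T0 cf per; have [M M0 hM] := @continuous_bounded_itv R f 0 T cf.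
exists M => // x; have [k /andP[k1 k2] <-] := periodic_fund per 0 x T0.
by apply: hM; rewrite k1 ltW//; rewrite add0r in k2.
Qed.

End derivatives.

Lemma smooth_bump_scale (R : realType) (l r : R) (b b1 b2 b3 : R -> R) :
  bump_on l r b ->
  (forall x : R, is_derive x 1 b (b1 x)) -> (forall x : R, is_derive x 1 b1 (b2 x)) ->
  (forall x : R, is_derive x 1 b2 (b3 x)) -> continuous b3 ->
  exists2 d : R, 0 < d & smooth_bump l r (fun x => d * b x) (fun x => d * b1 x)
    (fun x => d * b2 x) (fun x => d * b3 x).
Proof.
move=> bb d1 d2 d3 c3.
have p1 := periodic_derive d1 (bump_per bb); have p2 := periodic_derive d2 p1.
have [M1 M10 h1] := continuous_periodic_bounded (twopi_gt0 R)
  (fun x => is_derive_continuous (d2 x)) p1.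
have [M2 M20 h2] := continuous_periodic_bounded (twopi_gt0 R)
  (fun x => is_derive_continuous (d3 x)) p2.
have dZ (d : R) (f g : R -> R) : (forall x : R, is_derive x 1 f (g x)) ->
    forall x : R, is_derive x 1 (fun x => d * f x) (d * g x).
  by move=> fg x; have := fg x => ?; apply: is_derive_eq; rewrite /GRing.scale/=; ring.
have D0 : 0 < 4 * (M1 + M2 + 1) by lra.
(* This meets [sb_small], since M2 + 2 M1 < 2 (M1 + M2 + 1). *)
exists (4 * (M1 + M2 + 1))^-1; first by rewrite invr_gt0.
set d := _^-1; have d0 : 0 < d by rewrite invr_gt0.
split; [|exact: dZ..| |].
- split.
  + by move=> x; rewrite mulr_ge0 ?(bump_ge0 bb) ?ltW.
  + by move=> x x0 nx; rewrite (bump_out bb)// mulr0.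
  + by move=> x; rewrite (bump_per bb).
  + by move=> x; apply: cvgM; [exact: cvg_cst|exact: (bump_cont bb)].
- by move=> x; apply: cvgM; [exact: cvg_cst|exact: c3].
- move=> x; rewrite !normrM (gtr0_norm d0) mulrCA -mulrDr mulrC ltr_pdivrMr//.
  by have := h1 x; have := h2 x; lra.
Qed.

(** * Bumps from a truncated cosine *)

Section cap.
Context {R : realType}.
Variables (e : R).
Hypothesis e_itv : 0 < e < pi / 2.

(** Periodic by construction, and positive exactly at distance less than e from the multiples of 2
    pi. A bump needs three continuous derivatives: the fourth power has them, and so has the square
    after two integrations. *)
Definition cap (x : R) : R := Num.max (cos x - cos e) 0.

Lemma cap_ge0 x : 0 <= cap x.
Proof. by rewrite le_max lexx orbT. Qed.

Lemma cap_2pi x : cap (x + 2 * pi) = cap x.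
Proof. by rewrite /cap cos_2pi. Qed.

Lemma cap_continuous : continuous cap.
Proof.
move=> x; apply: (@continuous_comp _ _ _ (fun x => cos x - cos e) (fun x => Num.max x 0)).
  by apply: cvgB; [exact: continuous_cos|exact: cvg_cst].
exact: continuous_maxr0.
Qed.

Lemma cap_out x : e <= `|x| <= 2 * pi - e -> cap x = 0.
Proof.
have /andP[e0 epi] := e_itv; have p0 := pi_gt0 R.
move=> /andP[ex x2]; apply: max_r; rewrite subr_le0.
have -> : cos x = cos `|x| by case: (ger0P x) => // _; rewrite cosN.
move: ex x2; move: `|x| => t et t2.
have [tpi|pit] := leP t pi.
  by rewrite leNgt ltr_cos ?in_itv/= -?leNgt//; apply/andP; split; lra.
have -> : cos t = cos (2 * pi - t) by rewrite -[RHS]cosN opprB -(cos_2pi (t - _)) subrK.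
by rewrite leNgt ltr_cos ?in_itv/= -?leNgt//; try (apply/andP; split); lra.
Qed.

Lemma cap_gt0 x : `|x| < e -> 0 < cap x.
Proof.
have /andP[e0 epi] := e_itv; have p0 := pi_gt0 R.
move=> xe; rewrite lt_max subr_gt0; apply/orP; left.
have -> : cos x = cos `|x| by case: (ger0P x) => // _; rewrite cosN.
by rewrite ltr_cos ?in_itv/= ?normr_ge0//=; try (apply/andP; split); lra.
Qed.

Lemma is_derive_cap (x : R) (n : nat) :
  is_derive x 1 (fun x => cap x ^+ n.+2) (- (n.+2%:R * cap x ^+ n.+1 * sin x)).
Proof.
have dc : is_derive x (1 : R) (fun x => cos x - cos e) (- sin x).
  by apply: is_derive_eq; ring.
apply: (is_derive_eq (@is_derive1_comp _ (fun u => Num.max u 0 ^+ n.+2)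
  (fun x => cos x - cos e) _ _ _ (is_derive_max0 (cos x - cos e) n) dc)).
by rewrite mulrN.
Qed.

Let shift (F f : R -> R) c : (forall x : R, is_derive x 1 F (f x)) ->
  forall x : R, is_derive x 1 (fun x => F (- c + x)) (f (- c + x)).
Proof. by move=> Ff x; exact: is_derive_addr. Qed.

Let shift_cont (f : R -> R) c : continuous f -> continuous (fun x => f (- c + x)).
Proof.
move=> cf x; apply: continuous_comp; last exact: cf.
by apply: cvgD; [exact: cvg_cst|exact: cvg_id].
Qed.

Lemma smooth_bump_cap (c : R) : 0 < c - e -> c + e < pi ->
  exists (d : R) (b1 b2 b3 : R -> R), 0 < d /\
    smooth_bump (c - e) (c + e) (fun x => d * cap (- c + x) ^+ 4) b1 b2 b3.
Proof.
move=> c0 cpi; have /andP[e0 epi] := e_itv; have p0 := pi_gt0 R.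
pose F1 x := - (4 * cap x ^+ 3 * sin x).
pose F2 x := 12 * (cap x ^+ 2 * sin x ^+ 2) - 4 * (cap x ^+ 3 * cos x).
pose F3 x := - (24 * (cap x * sin x ^+ 3)) + 36 * (cap x ^+ 2 * (sin x * cos x)) +
  4 * (cap x ^+ 3 * sin x).
have d1 (x : R) : is_derive x 1 (fun x => cap x ^+ 4) (F1 x) by exact: is_derive_cap.
have d2 (x : R) : is_derive x 1 F1 (F2 x).
  have := is_derive_cap x 1 => ?; apply: is_derive_eq.
  by rewrite /F2 /GRing.scale/=; ring.
have d3 (x : R) : is_derive x 1 F2 (F3 x).
  have := is_derive_cap x 1 => ?; have := is_derive_cap x 0 => ?.
  by apply: is_derive_eq; rewrite /F3 /GRing.scale/=; ring.
have c3 : continuous F3.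
  have cX (f : R -> R) n : continuous f -> continuous (fun x => f x ^+ n).
    move=> cf x; apply: (@continuous_comp _ _ _ f (fun x => x ^+ n)); first exact: cf.
    exact: exprn_continuous.
  have cM (f g : R -> R) : continuous f -> continuous g -> continuous (fun x => f x * g x).
    by move=> cf cg x; apply: cvgM; [exact: cf|exact: cg].
  have cD (f g : R -> R) : continuous f -> continuous g -> continuous (fun x => f x + g x).
    by move=> cf cg x; apply: cvgD; [exact: cf|exact: cg].
  have cN (f : R -> R) : continuous f -> continuous (fun x => - f x).
    by move=> cf x; apply: cvgN; exact: cf.
  have ck (k : R) : continuous (fun _ : R => k) by move=> x; exact: cvg_cst.
  have cc := cap_continuous; have cs := @continuous_sin R; have cco := @continuous_cos R.
  apply: (cD); [apply: (cD)|].
  - by apply: (cN); apply: (cM); [exact: ck|apply: (cM); [exact: cc|exact: cX]].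
  - by apply: (cM); [exact: ck|apply: (cM); [exact: cX|exact: cM]].
  - by apply: (cM); [exact: ck|apply: (cM); [exact: cX|exact: cs]].
have bb : bump_on (c - e) (c + e) (fun x => cap (- c + x) ^+ 4).
  split.
  - by move=> x; rewrite exprn_ge0// cap_ge0.
  - move=> x /andP[x0 x2] nx; rewrite cap_out ?expr0n//.
    by case: (ger0P (- c + x)) => h; apply/andP; split; lra.
  - by move=> x; rewrite addrA cap_2pi.
  - by move=> x; exact: is_derive_continuous (shift c d1 x).
have [d d0 sb] := smooth_bump_scale bb (shift c d1) (shift c d2) (shift c d3) (shift_cont c3 (c := c)).
by exists d, (fun x => d * F1 (- c + x)), (fun x => d * F2 (- c + x)), (fun x => d * F3 (- c + x)).
Qed.

(* The bump is the second difference of a second primitive N of the squared cap: it is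
   nonnegative because N is convex, and periodic because N (x + 2 pi) - N x is affine. *)
Lemma smooth_bump_second_difference (c h : R) : 0 < h -> 0 < c - h - e -> c + h + e < pi ->
  exists (d : R) (b b1 b3 : R -> R), 0 < d /\
    smooth_bump (c - h - e) (c + h + e) b b1 (fun x => d *
      (cap (- (c - h) + x) ^+ 2 + -2 * cap (- c + x) ^+ 2 + cap (- (c + h) + x) ^+ 2)) b3.
Proof.
move=> h0 c0 cpi; have /andP[e0 epi] := e_itv; have p0 := pi_gt0 R.
pose k x := cap (- c + x) ^+ 2.
have ck : continuous k.
  apply: (@shift_cont (fun x => cap x ^+ 2)) => x.
  apply: (@continuous_comp _ _ _ cap (fun x => x ^+ 2)); first exact: cap_continuous.
  exact: exprn_continuous.
have k_ge0 x : 0 <= k x by rewrite sqr_ge0.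
pose k' x := - (2 * cap (- c + x) * sin (- c + x)).
have dk (x : R) : is_derive x 1 k (k' x).
  exact: (@shift (fun x => cap x ^+ 2) (fun x => - (2 * cap x * sin x)) c (is_derive_cap ^~ 0)).
have ck' : continuous k'.
  apply: (@shift_cont (fun x => - (2 * cap x * sin x))) => x; apply: cvgN.
  apply: cvgM; last exact: continuous_sin.
  by apply: cvgM; [exact: cvg_cst|exact: cap_continuous].
have [N1 dN1] := primitive_exists ck.
have [N dN] := @primitive_exists R N1 (fun x => is_derive_continuous (dN1 x)).
pose D (f : R -> R) x := f (h + x) + -2 * f x + f (- h + x).
have dD (f g : R -> R) : (forall x : R, is_derive x 1 f (g x)) ->
    forall x : R, is_derive x 1 (D f) (D g x).
  move=> fg x; have := fg x => ?.
  have := is_derive_addr fg h x => ?; have := is_derive_addr fg (- h) x => ?.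
  by apply: is_derive_eq; rewrite /D /GRing.scale/=; ring.
have kper x : k (x + 2 * pi) = k x by rewrite /k addrA cap_2pi.
(* Three mean values write the second difference of N as t k(z) with t >= 0 and z at distance less
   than h from x; this gives both the sign and the support of the bump. *)
have convex x : exists (t z : R), [/\ 0 <= t, x - h < z < x + h & D N x = t * k z].
  have [|u /andP[xu uh] e1] := @is_derive_MVT R N N1 x (h + x) _ dN; first by lra.
  have [|v /andP[vh vx] e2] := @is_derive_MVT R N N1 (- h + x) x _ dN; first by lra.
  have [|z /andP[vz zu] e3] := @is_derive_MVT R N1 k v u _ dN1; first by lra.
  exists (h * (u - v)), z; split.
  - by rewrite mulr_ge0//; lra.
  - by apply/andP; split; lra.
  - have -> : D N x = N (h + x) - N x - (N x - N (- h + x)) by rewrite /D; ring.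
    rewrite e1 e2 (_ : N1 u = N1 v + k z * (u - v)); first by ring.
    by rewrite -e3; ring.
have N1per x : N1 (x + 2 * pi) = N1 x + (N1 (2 * pi) - N1 0).
  have d0 y : is_derive y (1 : R) (fun y => N1 (2 * pi + y) - N1 y) 0.
    apply: (is_derive_eq (is_deriveB (is_derive_addr dN1 (2 * pi) y) (dN1 y))).
    by rewrite addrC [_ + y]addrC kper addNr.
  by have := derive0_cst d0 x 0; rewrite addr0 addrC [_ + x]addrC => <-; ring.
have Nper x : N (x + 2 * pi) = N x + (N1 (2 * pi) - N1 0) * x + (N (2 * pi) - N 0).
  have d0 y : is_derive y (1 : R)
      (fun y => N (2 * pi + y) - N y - (N1 (2 * pi) - N1 0) * y) 0.
    have ? := is_derive_addr dN (2 * pi) y; have ? := dN y.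
    by apply: is_derive_eq; rewrite /GRing.scale/= addrC [_ + y]addrC N1per; ring.
  by have := derive0_cst d0 x 0; rewrite addr0 (addrC (2 * pi) x); lra.
have bb : bump_on (c - h - e) (c + h + e) (D N).
  split.
  - by move=> x; have [t [z [t0 _ ->]]] := convex x; rewrite mulr_ge0.
  - move=> x /andP[x0 x2] nx; have [t [z [_ /andP[z1 z2] ->]]] := convex x.
    rewrite /k cap_out ?expr0n ?mulr0//.
    by case: (ger0P (- c + z)) => ?; apply/andP; split; lra.
  - by move=> x; rewrite /D !addrA !Nper; ring.
  - by move=> x; exact: is_derive_continuous (dD _ _ dN x).
have cDk' : continuous (D k').
  move=> x; apply: cvgD; [apply: cvgD|].
  - by rewrite -[h]opprK; exact: shift_cont.
  - by apply: cvgM; [exact: cvg_cst|exact: ck'].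
  - exact: shift_cont.
have [d d0 sb] := smooth_bump_scale bb (dD _ _ dN) (dD _ _ dN1) (dD _ _ dk) cDk'.
exists d, (fun x => d * D N x), (fun x => d * D N1 x), (fun x => d * D k' x); split=> //.
congr smooth_bump: sb; apply/funext => x; rewrite /D /k.
by rewrite (_ : - c + (h + x) = - (c - h) + x) 1?(_ : - c + (- h + x) = - (c + h) + x)//; ring.
Qed.

End cap.

(** * From vanishing pairings to vanishing second differences *)

Lemma Rintegral_mean (R : realType) (f : R -> R) (u v : R) : u < v -> continuous f ->
  exists2 c, u < c < v & \int[@lebesgue_measure R]_(x in `[u, v]) f x = f c * (v - u).
Proof.
move=> uv cf; have [F dF] := primitive_exists cf.
by have [c cuv e] := is_derive_MVT uv dF; exists c => //; rewrite (Rintegral_derive uv dF cf).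
Qed.

Lemma Rintegral_shift (R : realType) (f : R -> R) (s u v : R) : u < v -> continuous f ->
  \int[@lebesgue_measure R]_(x in `[u, v]) f (s + x) =
  \int[@lebesgue_measure R]_(x in `[s + u, s + v]) f x.
Proof.
move=> uv cf; have [F dF] := primitive_exists cf.
rewrite (@Rintegral_derive _ F f)//; last by rewrite ltrD2l.
apply: (Rintegral_derive uv (is_derive_addr dF s)) => x.
apply: continuous_comp; last exact: cf.
by apply: cvgD; [exact: cvg_cst|exact: cvg_id].
Qed.

Definition second_difference (R : realType) (u : R -> R) (h x : R) : R :=
  u (x - h) + -2 * u x + u (x + h).

Lemma second_difference_continuous (R : realType) (u : R -> R) (h : R) :
  continuous u -> continuous (second_difference u h).
Proof.
move=> cu x; rewrite /second_difference.
have cu1 s : {for x, continuous (fun x => u (x + s))}.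
  apply: continuous_comp; last exact: cu.
  by apply: cvgD; [exact: cvg_id|exact: cvg_cst].
apply: cvgD; [apply: cvgD|]; [exact: cu1| |exact: cu1].
by apply: cvgM; [exact: cvg_cst|exact: cu].
Qed.

Section integral_second_difference_cap.
Context {R : realType}.
Local Notation mu := (@lebesgue_measure R).
Variables (G : R -> R) (e h u : R).
Hypotheses (cG : continuous G) (e_itv : 0 < e < pi / 2) (h0 : 0 < h)
  (u_gt : 0 < u - h - e) (u_lt : u + h + e < pi / 2).
Let k (x : R) := cap e x ^+ 2.

Let ck : continuous k.
Proof.
move=> x; apply: (@continuous_comp _ _ _ (cap e) (fun x => x ^+ 2)).
  exact: cap_continuous.
exact: exprn_continuous.
Qed.

Let cGk (s t : R) : continuous (fun x => G (s + x) * k (t + x)).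
Proof.
have cadd (f : R -> R) r : continuous f -> continuous (fun x => f (r + x)).
  move=> cf x; apply: continuous_comp; last exact: cf.
  by apply: cvgD; [exact: cvg_cst|exact: cvg_id].
by move=> x; apply: cvgM; exact: cadd.
Qed.

Let cD (f g : R -> R) (m : R) : continuous f -> continuous g -> continuous (fun x => f x + m * g x).
Proof.
by move=> cf cg x; apply: cvgD; [exact: cf|apply: cvgM; [exact: cvg_cst|exact: cg]].
Qed.

Let piece (q : R) : u - h <= q <= u + h ->
  \int[mu]_(x in `[u - h - e, u + h + e]) (G (0 + x) * k (- q + x)) =
  \int[mu]_(x in `[- e, e]) (G (q + x) * k (0 + x)).
Proof.
move=> /andP[q1 q2]; have /andP[e0 _] := e_itv; have l0 := u_gt; have lpi := u_lt.
have qe : - e < e by lra.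
rewrite (@Rintegral_support _ _ _ _ (q + - e) (q + e)); [|lra..|].
  rewrite -(@Rintegral_shift _ _ q _ _ qe (@cGk 0 (- q))).
  by apply: eq_Rintegral => x _; rewrite addKr !add0r.
move=> x /andP[x1 x2] nx; rewrite /k (cap_out e_itv) ?expr0n ?mulr0//.
by case: (ger0P (- q + x)) => ?; apply/andP; split; lra.
Qed.

(** The supports of the three translated caps lie inside the interval of integration. Shifting each
    cap to the origin moves the second difference from the bump onto G. *)
Lemma integral_second_difference_cap :
  \int[mu]_(x in `[u - h - e, u + h + e]) (G x *
    (cap e (- (u - h) + x) ^+ 2 + -2 * cap e (- u + x) ^+ 2 + cap e (- (u + h) + x) ^+ 2)) =
  \int[mu]_(x in `[- e, e]) (cap e x ^+ 2 * second_difference G h (u + x)).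
Proof.
have h_gt0 := h0.
transitivity (\int[mu]_(x in `[u - h - e, u + h + e]) (G (0 + x) * k (- (u - h) + x) +
    -2 * (G (0 + x) * k (- u + x)) + 1 * (G (0 + x) * k (- (u + h) + x)))).
  by apply: eq_Rintegral => x _; rewrite add0r /k; ring.
rewrite Rintegral_itvD; [|exact: cD|exact: cGk].
rewrite Rintegral_itvD; [|exact: cGk..].
rewrite piece ?piece; [|apply/andP; split; lra..].
rewrite -Rintegral_itvD; [|exact: cGk..].
rewrite -Rintegral_itvD; [|exact: cD|exact: cGk].
apply: eq_Rintegral => x _; rewrite /second_difference add0r /k.
by rewrite (addrAC u x) (addrAC u x h); ring.
Qed.

End integral_second_difference_cap.

Section second_difference.
Context {R : realType}.
Variable g : R -> R.
Hypothesis cg : continuous g.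
Hypothesis pairing0 : forall (l1 r1 l2 r2 : R) (b b1 b2 b3 c c1 c2 c3 : R -> R),
  [/\ 0 < l1, l1 < r1, r1 < pi / 2 < l2, l2 < r2 & r2 < pi] ->
  smooth_bump l1 r1 b b1 b2 b3 -> smooth_bump l2 r2 c c1 c2 c3 ->
  pairing l1 r1 l2 r2 c g b2 = 0.

(** In the vanishing pairing the weights are powers of caps, positive in the interior of their
    intervals. The mean value theorem for integrals, in y and then in x, yields an interior point
    where the remaining factor, the second difference of g, is 0. *)
Lemma second_difference_near (h e u v : R) : 0 < h -> 0 < e ->
  0 < u - h - e -> u + h + e < pi / 2 -> pi / 2 < v - e -> v + e < pi ->
  exists x y, [/\ `|x - u| < e, `|y - v| < e & second_difference g h (pi - y + x) = 0].
Proof.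
move=> h0 e0 u0 upi v0 vpi; have p0 := pi_gt0 R.
have eI : 0 < e < pi / 2 by apply/andP; split; lra.
have [d [b [b1 [b3 [d0 sb]]]]] := smooth_bump_second_difference eI h0 u0 ltac:(lra).
have [d' [c1 [c2 [c3 [d'0 sc]]]]] := @smooth_bump_cap _ _ eI v ltac:(lra) vpi.
have w : [/\ 0 < u - h - e, u - h - e < u + h + e, u + h + e < pi / 2 < v - e,
    v - e < v + e & v + e < pi].
  by split; [exact: u0|lra|apply/andP; split; lra|lra|exact: vpi].
pose G y x := g (pi - y + x).
have cG y : continuous (G y) by move=> x; exact: continuous_subadd2.
pose b2 x := d * (cap e (- (u - h) + x) ^+ 2 + -2 * cap e (- u + x) ^+ 2 +
  cap e (- (u + h) + x) ^+ 2).
have := pairing0 w (sb : smooth_bump _ _ _ _ b2 _) sc; rewrite /pairing.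
have cb2 : continuous b2 by move=> x; exact: is_derive_continuous (sb_d3 sb x).
have cc := bump_cont (sb_on sc).
pose I y := \int[@lebesgue_measure R]_(x in `[u - h - e, u + h + e]) (g (pi - y + x) * b2 x).
have cI : continuous I by exact: inner_continuous.
have [|y /andP[y1 y2] ->] := @Rintegral_mean R (fun y => d' * cap e (- v + y) ^+ 4 * I y)
    (v - e) (v + e) ltac:(lra).
  by move=> y; apply: cvgM; [exact: cc|exact: cI].
have yv : `|- v + y| < e by rewrite ltr_norml; apply/andP; split; lra.
have cy := cap_gt0 eI yv.
have I0 : d' * cap e (- v + y) ^+ 4 * I y * (v + e - (v - e)) = 0 -> I y = 0.
  have P : 0 < d' * cap e (- v + y) ^+ 4 by rewrite mulr_gt0// exprn_gt0.
  have L : 0 < v + e - (v - e) by lra.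
  by move/eqP; rewrite mulf_eq0 (gt_eqF L) orbF mulf_eq0 (gt_eqF P) => /eqP.
move/I0 => {I0}.
have -> : I y = d * \int[@lebesgue_measure R]_(x in `[- e, e])
    (cap e x ^+ 2 * second_difference (G y) h (u + x)).
  rewrite -integral_second_difference_cap// -RintegralZl//; last first.
    have cd : continuous (fun x => d^-1 * (G y x * b2 x)).
      move=> x; apply: cvgM; first exact: cvg_cst.
      by apply: cvgM; [exact: cG|exact: cb2].
    have := continuous_integrable (u - h - e) (u + h + e) cd.
    by apply: eq_integrable => // x _; congr EFin; rewrite /b2; field; rewrite gt_eqF.
  by apply: eq_Rintegral => x _; rewrite /b2 /G; ring.
have [|x /andP[x1 x2] ->] := @Rintegral_mean R (fun x => cap e x ^+ 2 *
  second_difference (G y) h (u + x)) (- e) e ltac:(lra).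
  move=> x; apply: cvgM.
    apply: (@continuous_comp _ _ _ (cap e) (fun x => x ^+ 2)); first exact: cap_continuous.
    exact: exprn_continuous.
  apply: (@continuous_comp _ _ _ (fun x => u + x) (second_difference (G y) h)); last first.
    exact: second_difference_continuous.
  by apply: cvgD; [exact: cvg_cst|exact: cvg_id].
have kx : 0 < cap e x ^+ 2 by rewrite exprn_gt0// cap_gt0// ltr_norml; apply/andP; split; lra.
have L : 0 < e - - e by lra.
move/eqP; rewrite mulf_eq0 (gt_eqF d0) mulf_eq0 (gt_eqF L) orbF mulf_eq0 (gt_eqF kx)/=.
move/eqP => S0; exists (u + x), y; split.
- by rewrite addrC addKr ltr_norml; apply/andP; split; lra.
- by rewrite addrC.
- by rewrite -[RHS]S0 /second_difference /G -!addrA.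
Qed.

Lemma second_difference0 (h X : R) : 0 < h < pi / 4 -> 0 < X - h -> X + h < pi ->
  second_difference g h X = 0.
Proof.
move=> /andP[h0 hpi] X0 Xpi; have p0 := pi_gt0 R.
(* With u = X - pi + v the required inequalities h < u < pi / 2 - h and pi / 2 < v < pi are two
   lower and two upper bounds on v. They are compatible because h < X, X + h < pi and h < pi / 4,
   and v is taken midway. *)
have [v [v1 v2 v3 v4]] : exists v, [/\ pi / 2 < v, pi - X + h < v, v < pi & v < pi + pi / 2 - X - h].
  exists ((Num.max (pi / 2) (pi - X + h) + Num.min pi (pi + pi / 2 - X - h)) / 2).
  by case: (leP (pi / 2) (pi - X + h)) => ?; case: (leP pi (pi + pi / 2 - X - h)) => ?; split; lra.
pose u := X - pi + v.
pose s := Num.min (Num.min (u - h) (pi / 2 - u - h)) (Num.min (v - pi / 2) (pi - v)).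
have s0 : 0 < s by rewrite !lt_min /u; apply/andP; split; apply/andP; split; lra.
have [s1 s2 s3 s4] : [/\ s <= u - h, s <= pi / 2 - u - h, s <= v - pi / 2 & s <= pi - v].
  by split; rewrite /s !ge_min lexx ?orbT.
apply/eqP; rewrite -normr_le0; apply/ler_addgt0Pr => e e0; rewrite add0r.
have /cvgrPdist_lt/(_ e e0)/nbhs_ballP[t /= t0 ht] := second_difference_continuous (h := h) cg (x := X).
pose q := Num.min (s / 2) (t / 2).
have q0 : 0 < q by rewrite lt_min !divr_gt0.
have [qs qt] : q <= s / 2 /\ q <= t / 2 by rewrite /q !ge_min !lexx orbT.
have [x [y [xu yv S0]]] := @second_difference_near h q u v h0 q0
  ltac:(lra) ltac:(lra) ltac:(lra) ltac:(lra).
have : ball X t (pi - y + x).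
  rewrite /ball/= (_ : X - _ = (y - v) - (x - u)); last by rewrite /u; ring.
  by rewrite (le_lt_trans (ler_normB _ _))//; lra.
by move/ht; rewrite S0 subr0 => /ltW.
Qed.

End second_difference.

(** * Continuous solutions of Jensen's equation, and decay at 0 *)

Section jensen.
Context {R : realType}.
Implicit Types u : R -> R.

Definition jensen u := forall h X : R, 0 < h < pi / 4 -> 0 < X - h -> X + h < pi ->
  second_difference u h X = 0.

(* Adding a small multiple of the strictly convex x (x - pi) excludes an interior maximum. *)
Lemma jensen_le0 u : continuous u -> jensen u -> u 0 = 0 -> u pi = 0 ->
  forall x, 0 <= x <= pi -> u x <= 0.
Proof.
move=> cu ju u0 upi x xpi; have p0 := pi_gt0 R.
apply/ler_addgt0Pr => e e0; rewrite add0r.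
(* The added term d x (x - pi) is then at least - e on [0, pi], while its second difference is 2 d
   h^2 > 0. *)
pose d := e / pi ^+ 2; have d0 : 0 < d by rewrite divr_gt0// exprn_gt0.
pose v x := u x + d * (x * (x - pi)).
have [|c cI hc] := @EVT_max R v 0 pi (ltW p0).
  apply: continuous_subspaceT => y; apply: cvgD; first exact: cu.
  apply: cvgM; first exact: cvg_cst.
  by apply: cvgM; [exact: cvg_id|apply: cvgB; [exact: cvg_id|exact: cvg_cst]].
have vc : v c <= 0.
  move: cI; rewrite in_itv/= => /andP[c0 cpi].
  have [->|cn0] := eqVneq c 0; first by rewrite /v u0; lra.
  have [->|cnpi] := eqVneq c pi; first by rewrite /v upi; lra.
  have c0' : 0 < c by rewrite lt_neqAle eq_sym cn0.
  have cpi' : c < pi by rewrite lt_neqAle cnpi.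
  pose h := Num.min (pi / 8) (Num.min (c / 2) ((pi - c) / 2)).
  have h0 : 0 < h by rewrite !lt_min; do 2?[apply/andP; split]; lra.
  have [h1 h2 h3] : [/\ h <= pi / 8, h <= c / 2 & h <= (pi - c) / 2].
    by rewrite /h !ge_min !lexx ?orbT; split.
  have J := ju h c ltac:(apply/andP; split; lra) ltac:(lra) ltac:(lra).
  have m1 := hc (c - h) ltac:(rewrite in_itv/=; apply/andP; split; lra).
  have m2 := hc (c + h) ltac:(rewrite in_itv/=; apply/andP; split; lra).
  have : 0 < d * h ^+ 2 by rewrite mulr_gt0// exprn_gt0.
  by move: J m1 m2; rewrite /second_difference /v; lra.
have := le_trans (hc x _) vc; rewrite in_itv/= xpi => /(_ isT); rewrite /v.
have : d * (x * (pi - x)) <= e.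
  rewrite /d mulrAC ler_pdivrMr ?exprn_gt0//; apply: ler_wpM2l; first exact: ltW.
  by rewrite expr2; move: xpi => /andP[x0 x1]; apply: ler_pM => //; lra.
by move=> *; lra.
Qed.

(** The deviation from the chord over [0, pi] solves the same equation and vanishes at both ends,
    and so does its negative: [jensen_le0] applies with k = 1 and k = -1. *)
Lemma jensen_affine u : continuous u -> jensen u ->
  exists c, forall x, 0 <= x <= pi -> u x = u 0 + c * x.
Proof.
move=> cu ju; have p0 := pi_gt0 R; exists ((u pi - u 0) / pi) => x xpi.
set c := _ / _; pose v k x := k * (u x - u 0 - c * x).
have vle k y : 0 <= y <= pi -> v k y <= 0.
  move=> ypi; apply: jensen_le0 => //.
  - move=> z; apply: cvgM; first exact: cvg_cst.
    apply: cvgB; first by apply: cvgB; [exact: cu|exact: cvg_cst].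
    by apply: cvgM; [exact: cvg_cst|exact: cvg_id].
  - move=> h X h1 h2 h3; have := ju h X h1 h2 h3.
    rewrite /second_difference /v => e.
    by transitivity (k * (u (X - h) + -2 * u X + u (X + h))); [ring|rewrite e mulr0].
  - by rewrite /v; ring.
  - by rewrite /v /c divfK ?gt_eqF//; ring.
have := vle 1 x xpi; have := vle (-1) x xpi; rewrite /v.
by move=> *; apply/eqP; rewrite eq_le; apply/andP; split; lra.
Qed.

Lemma affine_quadratic0 (p q K e : R) : 0 < e ->
  (forall w, 0 < w < e -> `|p + q * w| <= K * w ^+ 2) -> p = 0 /\ q = 0.
Proof.
move=> e0 h.
have small (r M : R) : (forall w, 0 < w < Num.min e 1 -> `|r| <= M * w) -> r = 0.
  move=> hr; apply/eqP; rewrite -normr_le0; apply/ler_addgt0Pr => s s0; rewrite add0r.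
  have m0 : 0 < Num.min e 1 by rewrite lt_min e0 ltr01.
  have M0 : 0 < `|M| + 1 by rewrite ltr_wpDl.
  pose w := Num.min (Num.min e 1 / 2) (s / (`|M| + 1)).
  have w0 : 0 < w by rewrite lt_min !divr_gt0.
  have wm : w < Num.min e 1.
    by apply: (@le_lt_trans _ _ (Num.min e 1 / 2)); [rewrite /w ge_min lexx|lra].
  have ws : w * (`|M| + 1) <= s by rewrite -ler_pdivlMr// /w ge_min lexx orbT.
  rewrite (le_trans (hr w _)) ?w0// (le_trans _ ws)// mulrC ler_wpM2l ?ltW//.
  by have := ler_norm M; lra.
have p0 : p = 0.
  apply: (small _ (`|q| + `|K|)) => w /andP[w0]; rewrite lt_min => /andP[we w1].
  have h1 := h w ltac:(by rewrite w0).
  have -> : p = (p + q * w) - q * w by ring.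
  rewrite (le_trans (ler_normB _ _))// mulrDl addrC lerD//.
    by rewrite normrM (gtr0_norm w0).
  rewrite (le_trans h1)// expr2 mulrA; apply: ler_wpM2r; first exact: ltW.
  rewrite (le_trans (ler_norm _))// normrM (gtr0_norm w0) ler_piMr//; exact: ltW.
split=> //; apply: (small _ K) => w /andP[w0]; rewrite lt_min => /andP[we w1].
have := h w ltac:(by rewrite w0); rewrite p0 add0r normrM (gtr0_norm w0).
by rewrite expr2 mulrA ler_pM2r.
Qed.

Lemma sub_sin_le (w : R) : 0 < w -> `|w - sin w| <= w ^+ 2.
Proof.
move=> w0; have [c /andP[c0 cw]] := is_derive_MVT w0 (@is_derive_sin R).
have [d /andP[d0 dc]] := is_derive_MVT c0 (@is_derive_cos R).
rewrite cos0 sin0 !subr0 => e1 e2.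
have -> : w - sin w = sin d * c * w by rewrite e2 -[cos c](subrK 1) e1; ring.
rewrite expr2 !normrM (gtr0_norm c0) (gtr0_norm w0).
apply: ler_wpM2r; first exact: ltW.
by apply: (@le_trans _ _ c); [rewrite ler_piMl ?sin_max// ltW|exact: ltW].
Qed.

End jensen.

Lemma visual_angle_formula_sub_sin (R : realType) (f : R -> R) (a b : R) :
  differentiable_on_cc f 0 pi -> f =O_ (0^'+) (fun w : R => w ^+ 3) ->
  visual_angle_formula f a b ->
  forall w, 0 <= w <= pi -> f w = 2 * a * (w - sin w).
Proof.
move=> fd fO fint w wpi; have p0 := pi_gt0 R.
pose g (x : R) := (f \o clamp) x + - (2 * a) * (x - sin x).
have cs : continuous (fun x : R => x - sin x).
  by move=> x; apply: cvgB; [exact: cvg_id|exact: continuous_sin].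
have cg : continuous g.
  move=> x; apply: cvgD; first exact: clamp_continuous.
  by apply: cvgM; [exact: cvg_cst|exact: cs].
have [|c gE] := jensen_affine cg.
  move=> h X; apply: second_difference0 => // l1 r1 l2 r2 k k1 k2 k3 c c1 c2 c3 w1 sb sc.
  exact: (pairing_defect w1 sb sc fd fint).
have /eqO_exP[k k0] := fO; rewrite near_withinE => /nbhs_ballP[e /= e0 he].
have [g0 c0] : g 0 = 0 /\ c = 0.
  (* The range stops at 1 so that w^3 <= w^2, and at pi so that [clamp] is the identity; 2 |a| comes
     from |w - sin w| <= w^2. *)
  apply: (@affine_quadratic0 _ _ _ (k + 2 * `|a|) (Num.min e (Num.min 1 pi))).
    by rewrite !lt_min e0 ltr01 p0.
  move=> x /andP[x0]; rewrite !lt_min => /andP[xe /andP[x1 xpi]].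
  have xI : 0 <= x <= pi by rewrite !ltW.
  rewrite -gE// /g/= clamp_id// (le_trans (ler_normD _ _))// (mulrDl k) lerD//.
    have fx : `|f x| <= k * `|x ^+ 3|.
      by apply: he => //=; rewrite /ball/= sub0r normrN gtr0_norm.
    rewrite (le_trans fx)//; apply: ler_wpM2l; first exact: ltW.
    by rewrite normrX gtr0_norm// exprSr ler_piMr ?(ltW x1)// exprn_ge0// ltW.
  by rewrite !normrM normrN normrM (ger0_norm (ler0n _ _)) ler_wpM2l ?mulr_ge0// sub_sin_le.
have := gE w wpi; rewrite g0 c0 /g/= clamp_id// => e1; lra.
Qed.

Lemma Rintegral_derive_le (R : realType) (F f : R -> R) (u v : R) : u <= v ->
  (forall x : R, is_derive x 1 F (f x)) -> continuous f ->
  \int[@lebesgue_measure R]_(x in `[u, v]) f x = F v - F u.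
Proof.
rewrite le_eqVlt => /predU1P[<-|uv] dF cf; last exact: Rintegral_derive.
by rewrite set_itv1 Rintegral_set1 subrr.
Qed.

Lemma Rintegral_split (R : realType) (f : R -> R) (u v w : R) : u <= v -> v <= w ->
  continuous f -> \int[@lebesgue_measure R]_(x in `[u, w]) f x =
  \int[@lebesgue_measure R]_(x in `[u, v]) f x + \int[@lebesgue_measure R]_(x in `[v, w]) f x.
Proof.
move=> uv vw cf; have [F dF] := primitive_exists cf.
by rewrite !(Rintegral_derive_le (F := F))// ?(le_trans uv)//; ring.
Qed.

(** * Crofton's formula for the disc *)

Section chords.
Context {R : realType}.
Local Notation mu := (@lebesgue_measure R).
Local Notation mu2 := (mu \x mu)%E.
Local Notation one := (fun _ : R => 1 : R).
Implicit Types P : R * R.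

Definition slab P (x : R) : bool := `|dotn P x| <= 1.

Lemma slab_pi P x : slab P (x + pi) = slab P x.
Proof. by rewrite /slab dotnDpi normrN. Qed.

(** Membership in the slab has period pi in x. For P outside the disc with arc ]u, v[, neither n(x)
    nor - n(x) separates for x in [v, u + pi], whose length is the visual angle, and ]u + pi, v +
    pi[ is the arc of the opposite normals. Inside the disc all directions qualify and the length is
    pi. *)
Lemma slab_window P : exists v, forall x, v <= x < v + pi ->
  slab P x = (x <= v + angle one P).
Proof.
have p0 := pi_gt0 R; have sf := support_one R.
have [KP|/nbodyP[c /(arc_exists sf)[u [v [_ Puv]]]]] := pselect (body one P).
  exists 0 => x /andP[x0 xpi]; rewrite /angle (separating_body KP) subr0 (ltW xpi).
  by rewrite /slab ler_norml KP andbT -[dotn P x]opprK -dotnDpi lerN2 KP.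
exists v => x /andP[vx xv]; rewrite /angle (separating_arc sf Puv).
have [/andP[uv vu] [Pu Pv] P1 P2] := Puv.
rewrite (_ : v + _ = u + pi); last by ring.
have [xu|ux] := leP x (u + pi).
  have h1 y : v <= y <= u + 2 * pi -> dotn P y <= 1.
    move=> /andP[]; rewrite le_eqVlt => /predU1P[<-|vy]; first by rewrite Pv.
    rewrite le_eqVlt => /predU1P[->|yu]; first by rewrite dotn_2pi Pu.
    by rewrite ltW// P2// vy.
  rewrite /slab ler_norml -[dotn P x]opprK -dotnDpi lerN2 [X in _ && X]lerNl.
  rewrite h1; last by apply/andP; split; lra.
  by rewrite dotnDpi lerN2 h1//; apply/andP; split; lra.
have : 1 < dotn P (x - pi) by apply: P1; apply/andP; split; lra.
rewrite -[x in slab P x](subrK pi) slab_pi /slab => h; apply/negbTE.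
by rewrite -ltNge (lt_le_trans h)// ler_norm.
Qed.

Lemma measurable_slab P : measurable_fun setT (slab P).
Proof.
have mP : measurable_fun setT (fun x : measurableTypeR R => dotn P x : measurableTypeR R).
  exact: (measurable_fun_pair2 P measurable_dotn_pair).
apply: measurable_fun_ler => //.
exact: (measurableT_comp (@normr_measurable _ setT) mP).
Qed.

Lemma integral_slab P (F : R -> R) (v : R) : continuous F -> (forall x, 0 <= F x) ->
  (forall x, F (x + pi) = F x) ->
  (forall x, v <= x < v + pi -> slab P x = (x <= v + angle one P)) ->
  (\int[mu]_(x in `]0%R, pi[) (if slab P x then F x else 0)%:E =
   (\int[mu]_(x in `[v, v + angle one P]) F x)%:E)%E.
Proof.
move=> cF F0 Fpi sw; have p0 := pi_gt0 R.
have /andP[a0 api] := angle_itv (support_one R) P.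
have mF := continuous_measurable_fun cF.
pose G (x : R) := (if slab P x then F x else 0)%:E.
have mG : measurable_fun setT G.
  apply/measurable_EFinP; apply: measurable_fun_ifT => //; exact: measurable_slab.
rewrite -[LHS]/(\int[mu]_(x in `]0%R, pi[) G x)%E.
rewrite integral_itv_obnd_cbnd; last exact: measurable_funTS.
rewrite -(ge0_integral_periodic v p0 mG); last 2 first.
- by move=> x; rewrite lee_fin; case: ifP.
- by move=> x; rewrite /G slab_pi Fpi.
pose H (x : R) := (if x <= v + angle one P then F x else 0)%:E.
transitivity (\int[mu]_(x in `[v, (v + pi)%R[) H x)%E.
  by apply: eq_integral => x; rewrite inE/= in_itv/= => /sw; rewrite /G /H => ->.
rewrite integral_itv_bndo_bndc; last first.
  apply: measurable_funTS; apply/measurable_EFinP.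
  by apply: measurable_fun_ifT => //; exact: measurable_fun_ler.
rewrite -integral_EFin_itv// integral_mkcond [RHS]integral_mkcond.
apply: eq_integral => x _; rewrite !patchE !mem_setE !in_itv/= /H.
case: (leP v x) => //= vx; case: (leP x (v + angle one P)) => /= h; last by case: ifP.
by rewrite ifT//; lra.
Qed.

(** Crofton's integrand: pairs of lines through P that meet the disc, with the weight that cancels
    the Jacobian of P -> (P.n(x), P.n(y)). *)
Definition chord_kernel P (z : R * R) : R :=
  if [&& 0 < z.1 < pi, 0 < z.2 < pi, slab P z.1 & slab P z.2]
  then `|sin (z.2 - z.1)| else 0.

Lemma measurable_chord_kernel : measurable_fun setT
  (fun w : (measurableTypeR R * measurableTypeR R) *
      (measurableTypeR R * measurableTypeR R) => (chord_kernel w.1 w.2)%:E).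
Proof.
apply/measurable_EFinP; rewrite /chord_kernel.
have m1 : measurable_fun setT (fun w : (measurableTypeR R * measurableTypeR R) *
      (measurableTypeR R * measurableTypeR R) => w.2.1) by exact: measurableT_comp.
have m2 : measurable_fun setT (fun w : (measurableTypeR R * measurableTypeR R) *
      (measurableTypeR R * measurableTypeR R) => w.2.2) by exact: measurableT_comp.
have md1 : measurable_fun setT (fun w : (measurableTypeR R * measurableTypeR R) *
      (measurableTypeR R * measurableTypeR R) => `|dotn w.1 w.2.1| : measurableTypeR R).
  apply: (measurableT_comp (@normr_measurable _ setT)).
  exact: (measurableT_comp measurable_dotn_pair (measurable_fun_pair measurable_fst m1)).
have md2 : measurable_fun setT (fun w : (measurableTypeR R * measurableTypeR R) *
      (measurableTypeR R * measurableTypeR R) => `|dotn w.1 w.2.2| : measurableTypeR R).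
  apply: (measurableT_comp (@normr_measurable _ setT)).
  exact: (measurableT_comp measurable_dotn_pair (measurable_fun_pair measurable_fst m2)).
apply: measurable_fun_ifT => //.
  by do !apply: measurable_and; do ?[exact: measurable_fun_ltr|exact: measurable_fun_ler].
apply: (measurableT_comp (@normr_measurable _ setT)).
apply: (measurableT_comp (continuous_measurable_fun (@continuous_sin R))).
exact: measurable_funB.
Qed.

Lemma chord_kernel_ge0 P z : 0 <= chord_kernel P z.
Proof. by rewrite /chord_kernel; case: ifP. Qed.

Lemma integral_abs_sin (v w x : R) : v <= x <= v + w -> w <= pi ->
  \int[mu]_(y in `[v, v + w]) `|sin (y - x)| = 2 - cos (x - v) - cos (v + w - x).
Proof.
move=> /andP[vx xw] wpi.
have cs : continuous (fun y => sin (y - x)).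
  move=> y; apply: (@continuous_comp _ _ _ (fun y => y - x) sin); last exact: continuous_sin.
  by apply: cvgB; [exact: cvg_id|exact: cvg_cst].
have ca : continuous (fun y => `|sin (y - x)|).
  by move=> y; apply: continuous_comp; [exact: cs|exact: norm_continuous].
have cN : continuous (fun y => - sin (y - x)) by move=> y; apply: cvgN; exact: cs.
have dc y : is_derive y (1 : R) (fun y => cos (y - x)) (- sin (y - x)).
  have di : is_derive y (1 : R) (fun y => y - x) 1 by apply: is_derive_eq; ring.
  apply: (is_derive_eq (@is_derive1_comp _ cos (fun y => y - x) _ _ _ (is_derive_cos _) di)).
  by rewrite mulr1.
have dN y : is_derive y (1 : R) (fun y => - cos (y - x)) (sin (y - x)).
  by have := dc y => ?; apply: is_derive_eq; rewrite opprK.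
rewrite (Rintegral_split vx xw ca).
have -> : \int[mu]_(y in `[v, x]) `|sin (y - x)| = 1 - cos (x - v).
  transitivity (\int[mu]_(y in `[v, x]) - sin (y - x)).
    apply: eq_Rintegral => y; rewrite inE/= in_itv/= => /andP[vy yx].
    rewrite ler0_norm// -oppr_ge0 -sinN; apply: sin_ge0_pi; apply/andP; split; lra.
  by rewrite (Rintegral_derive_le vx dc cN) subrr cos0 -[in RHS]cosN opprB.
have -> : \int[mu]_(y in `[x, v + w]) `|sin (y - x)| = 1 - cos (v + w - x).
  transitivity (\int[mu]_(y in `[x, v + w]) sin (y - x)).
    apply: eq_Rintegral => y; rewrite inE/= in_itv/= => /andP[xy yw].
    rewrite ger0_norm//; apply: sin_ge0_pi; apply/andP; split; lra.
  by rewrite (Rintegral_derive_le xw dN cs) subrr cos0; ring.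
by ring.
Qed.

(* By periodicity the integral is that of |sin (y - x)| over a square of side the angle. *)
Lemma integral_chord_kernel P :
  (\int[mu2]_z (chord_kernel P z)%:E =
   (2 * (angle one P - sin (angle one P)))%:E)%E.
Proof.
have [v sw] := slab_window P; have p0 := pi_gt0 R.
have /andP[a0 api] := angle_itv (support_one R) P.
set w := angle one P in sw a0 api *.
have mK : measurable_fun setT (fun z : measurableTypeR R * measurableTypeR R =>
    (chord_kernel P z)%:E) by exact: (measurable_fun_pair2 P measurable_chord_kernel).
rewrite fubini_tonelli1//; last by move=> z; rewrite lee_fin chord_kernel_ge0.
pose s (t : R) := `|sin t|.
have cs : continuous s.
  by move=> y; apply: continuous_comp; [exact: continuous_sin|exact: norm_continuous].
have spi t : s (t + pi) = s t by rewrite /s sinDpiE normrN.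
pose A x := \int[mu]_(y in `[v, v + w]) s (y - x).
have cA : continuous A.
  have -> : A = fun x => \int[mu]_(y in `[v, v + w]) (s (pi - x + y) * 1).
    apply/funext => x; apply: eq_Rintegral => y _; rewrite mulr1.
    by rewrite (_ : pi - x + y = y - x + pi) ?spi//; ring.
  by apply: inner_continuous => // x; exact: cvg_cst.
have inner x : (\int[mu]_y (chord_kernel P (x, y))%:E =
    (if (0 < x < pi)%R && slab P x then A x else 0)%:E)%E.
  transitivity (\int[mu]_(y in `]0%R, pi[)
     (if slab P y then (if (0 < x < pi)%R && slab P x then s (y - x) else 0) else 0)%:E)%E.
    rewrite [RHS]integral_mkcond; apply: eq_integral => y _.
    rewrite patchE mem_setE in_itv/= /chord_kernel/=.
    by case: (_ < x < _); case: (_ < y < _); case: (slab P x); case: (slab P y).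
  rewrite (@integral_slab P (fun y => if (0 < x < pi) && slab P x then s (y - x) else 0) v)//.
  - by case: (_ && _) => //; rewrite Rintegral_cst// mul0r.
  - case: (_ && _); last by move=> y; exact: cvg_cst.
    move=> y; apply: (@continuous_comp _ _ _ (fun y => y - x) s); last exact: cs.
    by apply: cvgB; [exact: cvg_id|exact: cvg_cst].
  - by move=> y; case: (_ && _); rewrite /s.
  - by move=> y; rewrite addrAC spi.
under eq_integral do rewrite /fubini_F inner.
transitivity (\int[mu]_(x in `]0%R, pi[) (if slab P x then A x else 0)%:E)%E.
  rewrite [RHS]integral_mkcond; apply: eq_integral => x _.
  by rewrite patchE mem_setE in_itv/=; case: (_ < x < _).
rewrite (@integral_slab P A v)//; last 2 first.
- by move=> x; apply: Rintegral_ge0 => y _; rewrite /s.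
- move=> x; apply: eq_Rintegral => y _.
  by rewrite -[LHS]spi; congr s; ring.
congr EFin; rewrite -/w.
pose E x := 2 - cos (x - v) - cos (v + w - x).
have di (x : R) : is_derive x (1 : R) (fun x => x - v) 1 by apply: is_derive_eq; ring.
have di' (x : R) : is_derive x (1 : R) (fun x => v + w - x) (-1) by apply: is_derive_eq; ring.
have dE (x : R) : is_derive x 1 (fun x => 2 * x - sin (x - v) + sin (v + w - x)) (E x).
  have d1 := @is_derive1_comp _ sin (fun x => x - v) _ _ _ (is_derive_sin _) (di x).
  have d2 := @is_derive1_comp _ sin (fun x => v + w - x) _ _ _ (is_derive_sin _) (di' x).
  have d3 : is_derive x (1 : R) (fun x => 2 * x) 2.
    by apply: is_derive_eq; rewrite /GRing.scale/=; ring.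
  apply: (is_derive_eq (is_deriveD (is_deriveB d3 d1) d2)).
  by rewrite /E; ring.
have cE : continuous E.
  have cc (h : R -> R) : continuous h -> continuous (fun x => cos (h x)).
    move=> ch x; apply: (@continuous_comp _ _ _ h cos); first exact: ch.
    exact: continuous_cos.
  move=> x; apply: cvgB; first apply: cvgB; first exact: cvg_cst.
    by apply: (cc (fun x => x - v)) => y; apply: cvgB; [exact: cvg_id|exact: cvg_cst].
  by apply: (cc (fun x => v + w - x)) => y; apply: cvgB; [exact: cvg_cst|exact: cvg_id].
transitivity (\int[mu]_(x in `[v, v + w]) E x).
  by apply: eq_Rintegral => x; rewrite inE/= in_itv/= => xI; apply: integral_abs_sin.
rewrite (Rintegral_derive_le _ dE cE); last by lra.
rewrite !subrr sin0 (addrC v w) addrK; ring.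
Qed.

(** The weight and the Jacobian cancel, leaving the area 4 of the square of pairs (P.n(x), P.n(y))
    in [-1, 1]^2. On the diagonal there is no change of variables, but the weight is 0. *)
Lemma integral_chord_kernel_plane z :
  (\int[mu2]_P (chord_kernel P z)%:E =
   (if [&& 0 < z.1 < pi, 0 < z.2 < pi & z.2 != z.1] then 4 else 0)%:E)%E.
Proof.
case: z => x y /=; rewrite /chord_kernel/=.
have [xI|_] := boolP (0 < x < pi); last by rewrite integral0.
have [yI|_] := boolP (0 < y < pi); last by rewrite integral0.
have [->|xy] := eqVneq y x.
  by apply: integral0_eq => P _; rewrite subrr sin0 normr0; case: ifP.
have s0 : sin (y - x) != 0.
  move: xI yI => /andP[x0 xpi] /andP[y0 ypi].
  have [yx|xy'|e] := ltgtP y x; last by rewrite e eqxx in xy.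
    by rewrite -oppr_eq0 -sinN gt_eqF// sin_gt0_pi//; apply/andP; split; lra.
  by rewrite gt_eqF// sin_gt0_pi//; apply/andP; split; lra.
pose H (q : R * R) : \bar R := (`|sin (y - x)|%:E * (\1_(square 1) q)%:E)%E.
transitivity (\int[mu2]_P H (dotn P x, dotn P y))%E.
  apply: eq_integral => P _; rewrite /H indicE /slab.
  have -> : ((dotn P x, dotn P y) \in square 1) = (`|dotn P x| <= 1) && (`|dotn P y| <= 1).
    rewrite !ler_norml; apply/idP/idP; rewrite inE /square /= !in_itv/=.
      by move=> [-> ->].
    by move=> /andP[-> ->].
  by rewrite /=; case: ifP => _; rewrite ?mule1 ?mule0.
rewrite ge0_integral_dotn2//; last 2 first.
- apply/measurable_EFinP; apply: measurable_funM => //.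
  by apply: measurable_indic; exact: measurable_square.
- by move=> q; rewrite /H -EFinM lee_fin mulr_ge0.
rewrite ge0_integralZl//; last first.
  by apply/measurable_EFinP; apply: measurable_indic; exact: measurable_square.
rewrite integral_indic//; last exact: measurable_square.
rewrite setIT [X in (_ * (_ * X))%E](_ : _ = ((2 * 1) ^+ 2)%:E); last exact: square_measure.
by rewrite -!EFinM mulKf ?normr_eq0//; congr EFin => /=; ring.
Qed.

Lemma angle_sub_sin_ge0 P : 0 <= angle one P - sin (angle one P).
Proof.
rewrite -(@pmulr_rge0 _ 2)// -lee_fin -integral_chord_kernel.
by apply: integral_ge0 => z _; rewrite lee_fin chord_kernel_ge0.
Qed.

Lemma measurable_angle_sub_sin : measurable_fun setT
  (fun P : measurableTypeR R * measurableTypeR R => angle one P - sin (angle one P)).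
Proof.
have ma := measurable_angle (support_one R).
apply: measurable_funB; first exact: ma.
exact: (measurableT_comp (continuous_measurable_fun (@continuous_sin R)) ma).
Qed.

Lemma integral_angle_sub_sin :
  (\int[mu2]_P (angle one P - sin (angle one P))%:E = (2 * pi ^+ 2)%:E)%E.
Proof.
have p0 := pi_gt0 R.
have e : (2%:E * \int[mu2]_P (angle one P - sin (angle one P))%:E =
    \int[mu2]_P (2 * (angle one P - sin (angle one P)))%:E)%E.
  rewrite -ge0_integralZl//; first by apply/measurable_EFinP; exact: measurable_angle_sub_sin.
  by move=> P _; rewrite lee_fin angle_sub_sin_ge0.
suff h : (\int[mu2]_P (2 * (angle one P - sin (angle one P)))%:E = (4 * pi ^+ 2)%:E)%E.
  rewrite -[LHS]mul1e (_ : 1 = 2^-1%:E * 2%:E)%E; last by rewrite -EFinM mulVf.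
  by rewrite -muleA e h -EFinM; congr EFin; field.
under eq_integral do rewrite -integral_chord_kernel.
rewrite (fubini_tonelli_plane measurable_chord_kernel); last first.
  by move=> w; rewrite lee_fin chord_kernel_ge0.
under eq_integral do rewrite integral_chord_kernel_plane.
pose q (z : R * R) : \bar R :=
  (if [&& 0 < z.1 < pi, 0 < z.2 < pi & z.2 != z.1] then 4 else 0)%:E.
rewrite -[LHS]/(\int[mu2]_z q z)%E fubini_tonelli1//; last 2 first.
- apply/measurable_EFinP; apply: measurable_fun_ifT => //.
  apply: measurable_and; first by apply: measurable_and; exact: measurable_fun_ltr.
  apply: measurable_and; first by apply: measurable_and; exact: measurable_fun_ltr.
  by apply: measurable_neg; apply: measurable_fun_eqr.
- by move=> z; rewrite lee_fin; case: ifP.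
have mI : measurable (`]0, pi[%classic : set (measurableTypeR R)) by exact: measurable_itv.
have muI : lebesgue_measure (`]0%R, pi[%classic : set R) = (pi : R)%:E.
  by rewrite lebesgue_measure_itv/= lte_fin p0 -EFinB subr0.
have cstI (r : R) : (\int[mu]_(x in `]0%R, pi[) r%:E = (r * pi)%:E)%E.
  by rewrite integral_cst// [X in (_ * X)%E]muI -EFinM.
transitivity (\int[mu]_(x in `]0%R, pi[) (4 * pi)%:E)%E; last first.
  by rewrite cstI; congr EFin; ring.
rewrite [RHS]integral_mkcond; apply: eq_integral => x _.
rewrite patchE mem_setE in_itv/= /fubini_F /q/=.
case: (0 < x < pi) => /=; last by rewrite integral0.
(* The diagonal meets each vertical line in one point, which is negligible. *)
rewrite -cstI -(@integral_setD1 _ _ x)//; last exact: measurableD.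
rewrite [RHS]integral_mkcond; apply: eq_integral => y _; rewrite patchE.
have -> : (y \in `]0%R, pi[%classic `\ x) = (0 < y < pi) && (y != x).
  apply/idP/idP; rewrite inE /= in_itv/=; first by move=> [-> /eqP].
  by move=> /andP[-> /eqP].
by case: (_ && _).
Qed.

End chords.

(** * The coefficient b from the unit disc *)

Lemma body_one_area (R : realType) :
  0 < fine ((@lebesgue_measure R \x @lebesgue_measure R)%E (body (fun=> 1))).
Proof.
have fK := body_measure_fin (support_one R).
suff h : ((@lebesgue_measure R \x @lebesgue_measure R)%E (square (1 / 2)%R) <=
    (@lebesgue_measure R \x @lebesgue_measure R)%E (body (fun=> 1%R)))%E.
  rewrite -lte_fin fineK//; apply: lt_le_trans h.
  by rewrite [ltRHS](_ : _ = ((2 * (1 / 2)) ^+ 2)%:E); [rewrite lte_fin exprn_gt0|apply: square_measure].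
apply: le_measure; rewrite ?inE; [exact: measurable_square|exact: measurable_body (support_one R)|].
move=> P; rewrite /square/= !in_itv/= -!ler_norml => -[P1 P2] x; rewrite /dotn.
rewrite (le_trans (ler_norm _))// (le_trans (ler_normD _ _))// !normrM.
have h1 : `|P.1| * `|cos x| <= 1 / 2 by rewrite (le_trans _ P1)// ler_piMr// cos_max.
have h2 : `|P.2| * `|sin x| <= 1 / 2 by rewrite (le_trans _ P2)// ler_piMr// sin_max.
lra.
Qed.

(** Of the integral 2 pi^2 over the whole plane the disc takes pi F, since the angle is pi on it.
    The formula becomes 2 a (2 pi^2 - pi F) = a (2 pi)^2 + b F; the perimeter terms cancel, and F >
    0 by an inscribed square can be divided out. *)
Lemma visual_angle_formula_area (R : realType) (f : R -> R) (a b : R) :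
  differentiable_on_cc f 0 pi -> visual_angle_formula f a b ->
  (forall w, 0 <= w <= pi -> f w = 2 * a * (w - sin w)) -> b = - pi * (2 * a).
Proof.
move=> fd fint fE; have p0 := pi_gt0 R.
pose mu2 := (@lebesgue_measure R \x @lebesgue_measure R)%E.
pose K := body (fun _ : R => 1 : R).
have mK : measurable (K : set (measurableTypeR R * measurableTypeR R)).
  exact: measurable_body (support_one R).
have [_] := body_formula fd fint (support_one R).
rewrite Rintegral_cst//; set F := fine (mu2 K).
rewrite -[X in fine X]/(lebesgue_measure `[0, 2 * pi]%classic) lebesgue_measure_itv/=.
rewrite lte_fin twopi_gt0 -EFinB subr0 mul1r.
pose psi P := angle (fun _ : R => 1 : R) P - sin (angle (fun _ : R => 1 : R) P).
have mpsi : measurable_fun setT (psi : measurableTypeR R * measurableTypeR R -> measurableTypeR R).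
  exact: measurable_angle_sub_sin.
have ipsi : mu2.-integrable setT (EFin \o psi).
  apply/integrableP; split; first exact/measurable_EFinP.
  under eq_integral do rewrite /= ger0_norm ?angle_sub_sin_ge0//.
  by rewrite integral_angle_sub_sin ltry.
have restr (A : set (measurableTypeR R * measurableTypeR R)) : measurable A ->
    mu2.-integrable setT (EFin \o (psi \_ A)).
  move=> mA; rewrite -restrict_EFin; apply/(integrable_mkcond _ mA).
  exact: integrableS ipsi.
have split : \int[mu2]_P psi P = \int[mu2]_P (psi \_ (~` K)) P + \int[mu2]_P (psi \_ K) P.
  rewrite -RintegralD//; [|by apply: restr; exact: measurableC|exact: restr].
  apply: eq_Rintegral => P _; rewrite !patchE in_setC.
  by case: (P \in K); rewrite ?add0r ?addr0.
have total : \int[mu2]_P psi P = 2 * pi ^+ 2 by rewrite /Rintegral integral_angle_sub_sin.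
have inside : \int[mu2]_P (psi \_ K) P = pi * F.
  rewrite -Rintegral_mkcond -(Rintegral_cst mu2 mK).
  apply: eq_Rintegral => P; rewrite inE => KP.
  by rewrite /psi /angle (separating_body KP) subr0 sinpi subr0.
have -> : \int[mu2]_P (((f \o clamp) \o angle (fun=> 1)) \_ (~` K)) P =
    2 * a * \int[mu2]_P (psi \_ (~` K)) P.
  rewrite -RintegralZl//; last by apply: restr; exact: measurableC.
  apply: eq_Rintegral => P _; rewrite !patchE; case: ifP => _; last by rewrite mulr0.
  have aI := angle_itv (support_one R) P.
  by rewrite /= clamp_id// fE.
move: split; rewrite total inside => split.
have F0 : F != 0 by rewrite gt_eqF// body_one_area.
move=> e; apply: (mulIf F0).
have -> : b * F = 2 * a * \int[mu2]_P (psi \_ (~` K)) P - a * (2 * pi) ^+ 2 by rewrite e /=; ring.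
have -> : \int[mu2]_P (psi \_ (~` K)) P = 2 * pi ^+ 2 - pi * F by rewrite split; ring.
ring.
Qed.

Theorem theorem2p1 (R : realType) (f : R -> R) (a b : R)
  (f_diff : differentiable_on_cc f 0 pi)
  (f_bigO : f =O_ (0^'+) (fun w : R => w ^+ 3))
  (f_int : forall (K : set (R * R)) (T : R) (gamma : R -> R * R),
     compact K -> convex K -> interior K !=set0 -> C2_boundary K T gamma ->
     (\int[lebesgue_measure2 R]_(P in ~` K) (f (visual_angle K P))%:E)%E
     = (a * curve_length gamma T ^+ 2 + b * area K)%:E) :
  exists lambda : R,
    [/\ forall w : R, w \in `[0, pi] -> f w = lambda * (w - sin w),
        a = lambda / 2
      & b = - pi * lambda].
Proof.
have fE := visual_angle_formula_sub_sin f_diff f_bigO f_int.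
exists (2 * a); split.
- by move=> w; rewrite in_itv; exact: fE.
- by field.
- exact: visual_angle_formula_area f_diff f_int fE.
Qed.
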